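(* Let $L^*$ be an irreducible real symmetric positive definite $N\times N$ matrix, let $Z_1,Z_2,\dots$ be i.i.d. with law $\mathsf{DPP}(L^* )$, let $\hat L=\hat L_n$ be the maximum likelihood estimator based on $Z_1,\dots,Z_n$, let $\hat D\in\mathcal D$ be such that $\|\hat D\hat L\hat D-L^*\|_F=\min_{D\in\mathcal D}\|D\hat LD-L^*\|_F$, and set $\tilde L=\hat D\hat L\hat D$. Then $\tilde L$ is asymptotically normal with asymptotic covariance operator $V(L^* )$: $$\sqrt n(\tilde L-L^* )\xrightarrow[n\to\infty]{}\mathcal N_{\mathcal S_{[N]}}(0,V(L^* ))\quad\text{in distribution.}$$
   Context: Notation: $[N]=\{1,\dots,N\}$; $\mathcal S_{[N]}$ is the space of real symmetric $N\times N$ matrices, $\mathcal S_{[N]}^{++}$ its subset of positive definite matrices; $\|\cdot\|_F$ is the Frobenius norm. $\mathcal D$ is the set of $N\times N$ diagonal matrices with diagonal entries $\pm1$. For a matrix $A$ and $J\subset[N]$, $A_J$ is the principal submatrix indexed by $J$, with $\det A_\emptyset=1$. For $L\in\mathcal S_{[N]}^{++}$, $\mathsf{DPP}(L)$ is the law of a random subset $Z\subset[N]$ with $\mathbb P[Z=J]=p_J(L)=\det(L_J)/\det(I+L)$ for all $J\subset[N]$. $L$ is irreducible if $\{DLD:D\in\mathcal D\}$ has cardinality $2^{N-1}$ (equivalently, the graph on $[N]$ with edges $\{i,j\}$ such that $L_{i,j}\neq0$ is connected). Maximum likelihood estimator: $\hat\Phi(L)=\frac1n\sum_{i=1}^n\log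 p_{Z_i}(L)$ for $L\in\mathcal S_{[N]}^{++}$; $\hat L$ is any random matrix that is a maximizer of $\hat\Phi$ over $\mathcal S_{[N]}^{++}$ (arbitrary on the event that no maximizer exists). Expected log-likelihood: $\Phi(L)=\sum_{J\subset[N]}p_J(L^* )\log\det(L_J)-\log\det(I+L)$ for $L\in\mathcal S_{[N]}^{++}$. When $L^*$ is irreducible, $-\mathrm{d}^2\Phi(L^* )$ is a positive definite symmetric bilinear form on $\mathcal S_{[N]}$. $V(L^* )$ denotes its inverse: equipping $\mathcal S_{[N]}$ with the inner product $\langle A,B\rangle=\mathrm{Tr}(AB)$ and letting $F$ be the linear operator on $\mathcal S_{[N]}$ with $\langle F(H),H'\rangle=-\mathrm{d}^2\Phi(L^* )(H,H')$, $V(L^* )(H,H')=\langle F^{-1}(H),H'\rangle$. For $M\in\mathcal S_{[N]}$ and a symmetric positive definite bilinear form $\Sigma$ on $\mathcal S_{[N]}$, $\mathcal N_{\mathcal S_{[N]}}(M,\Sigma)$ is the law of a random matrix $A\in\mathcal S_{[N]}$ such that for all $H\in\mathcal S_{[N]}$, $\mathrm{Tr}(AH)$ is Gaussian with mean $\mathrm{Tr}(MH)$ and variance $\Sigma(H,H)$. *)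

(* Defs.v *)
From HB Require Import structures.
From mathcomp Require Import all_boot all_order all_algebra.
From mathcomp Require Import all_classical all_reals all_analysis.

Set Implicit Arguments.
Unset Strict Implicit.
Unset Printing Implicit Defensive.

Import Order.TTheory GRing.Theory Num.Theory.
Import numFieldNormedType.Exports.

Local Open Scope classical_set_scope.
Local Open Scope ring_scope.

Section Matrices.
Context {R : realType} {N : nat}.
Implicit Types (L D H K : 'M[R]_N) (J : {set 'I_N}).

Definition symmx : set 'M[R]_N := [set L | L^T = L].

Definition posdefmx : set 'M[R]_N :=
  [set L | L \in symmx /\
    forall x : 'cV[R]_N, x != 0 -> 0 < (x^T *m L *m x) 0 0].

Definition frobenius_norm L : R := Num.sqrt (\sum_i \sum_j L i j ^+ 2).

Definition signmx : set 'M[R]_N :=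
  [set D | is_diag_mx D /\ forall i, D i i = 1 \/ D i i = -1].

Definition irreducible_mx L : Prop :=
  ([set D *m L *m D | D in signmx] #= `I_(2 ^ N.-1))%card.

(* For J = set0 this is the 0 x 0 matrix, whose determinant is 1. *)
Definition principal_submx L J : 'M[R]_#|J| :=
  mxsub (@enum_val _ (mem J)) (@enum_val _ (mem J)) L.

Definition dpp_pmf L J : R := \det (principal_submx L J) / \det (1%:M + L).

(* z 0, ..., z n.-1 are the observations Z_1, ..., Z_n. *)
Definition loglik (z : nat -> {set 'I_N}) (n : nat) L : R :=
  n%:R^-1 * \sum_(i < n) ln (dpp_pmf L (z i)).

Definition maximizer_on (S : set 'M[R]_N) (g : 'M[R]_N -> R) L : Prop :=
  L \in S /\ forall K, K \in S -> g K <= g L.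

(* Used on posdefmx, where all the determinants are positive. *)
Definition expected_loglik (Lstar : 'M[R]_N) L : R :=
  \sum_(J : {set 'I_N}) dpp_pmf Lstar J * ln (\det (principal_submx L J))
  - ln (\det (1%:M + L)).

(* The second differential d^2 g (L)(H, H') of a smooth g, as an iterated
   directional derivative. For L, H and H' symmetric it only depends on the
   values of g at symmetric matrices close to L. *)
Definition second_diff (g : 'M[R]_N -> R) L H H' : R :=
  'D_H' (fun K : 'M[R]_N => 'D_H g K) L.

(* The operator F on symmx such that <F(H), H'> = B(H, H'), where
   <A, B> = Tr(AB). If B is bilinear on symmx such a matrix exists and is
   unique; if moreover B is symmetric positive definite, F is invertible and
   inverse_form B (H, H') = <F^-1(H), H'>. *)
Definition form_operator (B : 'M[R]_N -> 'M[R]_N -> R) H : 'M[R]_N :=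
  get [set K | K \in symmx /\
    forall H', H' \in symmx -> \tr (K *m H') = B H H'].

Definition inverse_form (B : 'M[R]_N -> 'M[R]_N -> R) H H' : R :=
  \tr (get [set K | K \in symmx /\ form_operator B K = H] *m H').

Definition asymptotic_covariance (Lstar : 'M[R]_N) : 'M[R]_N -> 'M[R]_N -> R :=
  inverse_form (fun H H' => - second_diff (expected_loglik Lstar) Lstar H H').

End Matrices.

Section Probability.
Context {R : realType} {N : nat} {d : measure_display} {T : measurableType d}.
Implicit Types (P : probability T R).

Definition random_mx (X : T -> 'M[R]_N) : Prop :=
  forall i j, measurable_fun setT (fun w => X w i j).

(* {set 'I_N} carries the discrete sigma-algebra. *)
Definition random_subset (Y : T -> {set 'I_N}) : Prop :=
  forall A : set {set 'I_N}, measurable (Y @^-1` A).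

Definition has_dpp_law P (L : 'M[R]_N) (Y : T -> {set 'I_N}) : Prop :=
  forall J : {set 'I_N}, P (Y @^-1` [set J]) = (dpp_pmf L J)%:E.

Definition mutually_independent P (Z : nat -> T -> {set 'I_N}) : Prop :=
  forall (s : seq nat) (A : nat -> set {set 'I_N}), uniq s ->
    P (\bigcap_(i in [set` s]) Z i @^-1` A i)
      = (\prod_(i <- s) P (Z i @^-1` A i))%E.

(* The Gaussian law on R with mean m and variance v. The degenerate case is
   separate because normal_prob m 0 is not the Dirac mass at m. *)
Definition gaussian_law (m v : R) (B : set R) : \bar R :=
  if v == 0 then (\d_m B)%E else normal_prob m (Num.sqrt v) B.

Definition normal_random_symmx P (A : T -> 'M[R]_N) (M : 'M[R]_N)
    (Sigma : 'M[R]_N -> 'M[R]_N -> R) : Prop :=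
  [/\ random_mx A,
      forall w, A w \in symmx
    & forall H, H \in symmx -> forall B : set R, measurable B ->
        P ((fun w => \tr (A w *m H)) @^-1` B)
          = gaussian_law (\tr (M *m H)) (Sigma H H) B].

End Probability.

Definition cvg_in_distribution {R : realType} {N : nat}
    {d : measure_display} {T : measurableType d} (P : probability T R)
    (X : nat -> T -> 'M[R]_N)
    {d' : measure_display} {T' : measurableType d'} (P' : probability T' R)
    (A : T' -> 'M[R]_N) : Prop :=
  forall f : 'M[R]_N -> R, continuous f ->
    (exists C : R, forall x, `|f x| <= C) ->
    ('E_P[f \o X n] @[n --> \oo] --> 'E_P'[f \o A])%E.

(* Main.v *)
(* Write p_J for the law DPP(Lstar) and q_J for the empirical frequencies, so that
   the likelihood is L |-> sum_J q_J ln p_J(L).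

   Identifiability. Along a shortest path of the graph of Lstar the principal
   submatrix is tridiagonal up to its corner, and the corner enters the determinant
   linearly with a nonzero coefficient. Hence the principal minors determine Lstar
   up to sign conjugation, and the scores ln p_J have no common direction of
   vanishing derivative: the Fisher operator F is invertible.

   Expansion. By compactness and Gibbs' inequality a maximizer for q close to p is
   close to a sign conjugate of Lstar. Its score equation, linearized at Lstar,
   gives L~ - Lstar = sum_J (q_J - p_J) v_J + o(|q - p|) with v_J = F^-1 (grad ln p_J),
   deterministically in q.

   Limit. The main term is a normalized sum of the i.i.d. matrices v_{Z_i}, which
   are centered with covariance F^-1. Its characteristic function is computed by
   conditioning on the steps one by one, and Chebyshev's inequality controls the
   remainder. Convergence in distribution follows since, on a cube, bounded
   continuous functions are uniform limits of uniformly bounded trigonometric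
   polynomials (Bernstein polynomials in the sines of the entries). The same
   approximation shows that a law on R is determined by its characteristic function,
   which identifies the laws of Tr(A H) for the limit A = sum_J sqrt(p_J) g_J v_J,
   g_J being independent standard normal variables. *)

Require Import Defs.
From HB Require Import structures.
From mathcomp Require Import all_boot all_order all_algebra all_fingroup.
From mathcomp Require Import all_classical all_reals all_analysis.
From mathcomp Require Import measurable_realfun.
From mathcomp Require Import ring lra zify.
Import Order.TTheory GRing.Theory Num.Theory.
Import numFieldNormedType.Exports.
Local Open Scope classical_set_scope.
Local Open Scope ring_scope.
Set Implicit Arguments.
Unset Strict Implicit.
Unset Printing Implicit Defensive.

(** * Determinants and positive definite matrices *)

(** For N > 1 the symmetric matrices have empty interior, so neighbourhoods of [Ls] leave the
    positive definite cone. Differentiation therefore takes place on the open set [good], where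
    det(I + L) and all principal minors are positive. Symmetry returns only in the directions
    allowed in the score equation and in the Fisher operator, which is inverted after adding a skew
    part. The likelihood is never expanded to second order. Differentiating sum_J p_J(L) = 1 gives
    sum_J p_J(L) d ln p_J(L) = 0 at every good L, and subtracting the score equation leaves sum_J
    (p_J(L) - q_J) d ln p_J(L) = 0. The factors p_J(L) - q_J are already small, so continuity of the
    scores and a first-order expansion of p_J suffice. The same identity yields the Hessian of the
    expected log-likelihood. In the limit, test functions are approximated on a cube only, and the
    global bound on the approximant controls what happens outside. Cosines with an arbitrary phase
    replace complex exponentials, so that all expectations are real. *)

Lemma det_mxsub_bij (R : comNzRingType) (m n : nat) (f : 'I_m -> 'I_n)
    (A : 'M[R]_n) : bijective f -> \det (mxsub f f A) = \det A.
Proof.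
move=> fbij; have e : m = n by have := bij_eq_card fbij; rewrite !card_ord.
subst m; case: fbij => g fK gK.
have finj : injective f := can_inj fK.
have -> : mxsub f f A = row_perm (perm finj) (col_perm (perm finj) A).
  by apply/matrixP => i j; rewrite !mxE !permE.
rewrite row_permE col_permE !det_mulmx !det_perm odd_permV mulrCA.
by rewrite -signr_addb addbb mulr1.
Qed.

(** * Principal minors as determinants of full size *)

Section Fill.
Variables (R : realType) (N : nat).
Implicit Types (L H : 'M[R]_N) (J : {set 'I_N}).

(** The size N is kept for every [J], so that the Leibniz expansions for different [J] can be summed
    permutation by permutation. *)
Definition rowfill J L : 'M[R]_N :=
  \matrix_(i, j) if i \in J then L i j else (i == j)%:R.

(** Unlike [rowfill], this filling preserves symmetry and can inherit positive definiteness. *)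
Definition fillmx J L : 'M[R]_N :=
  \matrix_(i, j) if (i \in J) && (j \in J) then L i j else (i == j)%:R.

(** Listing [J] first and its complement next puts [rowfill J L] in block triangular form with an
    identity block. *)
Let splitJ J (k : 'I_(#|J| + #|~: J|)) : 'I_N :=
  match fintype.split k with
  | inl a => @enum_val _ (mem J) a
  | inr b => @enum_val _ (mem (~: J)) b
  end.

Let splitJ_bij J : bijective (@splitJ J).
Proof.
apply: inj_card_bij; last by rewrite card_ord [leqRHS]card_ord finset.cardsC card_ord.
move=> a b; rewrite /splitJ; case: splitP => i ai; case: splitP => j bj.
- by move/enum_val_inj => ij; apply: val_inj; rewrite /= ai bj ij.
- by move=> e; have := enum_valP j; rewrite -e inE; have := enum_valP i => ->.
- by move=> e; have := enum_valP i; rewrite e inE; have := enum_valP j => ->.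
- by move/enum_val_inj => ij; apply: val_inj; rewrite /= ai bj ij.
Qed.

Lemma det_rowfill J L : \det (principal_submx L J) = \det (rowfill J L).
Proof.
rewrite -(det_mxsub_bij (rowfill J L) (splitJ_bij J)).
have sl i : fintype.split (lshift #|~: J| i) = inl i := unsplitK (inl i).
have sr i : fintype.split (rshift #|J| i) = inr i := unsplitK (inr i).
rewrite -[mxsub _ _ _]submxK.
have -> : dlsubmx (mxsub (@splitJ J) (@splitJ J) (rowfill J L)) = 0.
  apply/matrixP => i j; rewrite !mxE /splitJ sl sr/=.
  have := enum_valP i; have := enum_valP j; rewrite inE.
  move=> jJ iJ; rewrite (negbTE iJ).
  by case: eqP => // e; move: iJ; rewrite e jJ.
have -> : drsubmx (mxsub (@splitJ J) (@splitJ J) (rowfill J L)) = 1%:M.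
  apply/matrixP => i j; rewrite !mxE /splitJ !sr/=.
  have := enum_valP i; rewrite inE => /negbTE ->.
  by rewrite (inj_eq enum_val_inj).
rewrite det_ublock det1 mulr1; congr (\det _).
apply/matrixP => i j; rewrite !mxE /splitJ !sl/=.
by have := enum_valP i => ->.
Qed.

Lemma rowfill_fill J L : rowfill J (fillmx J L) = fillmx J L.
Proof.
by apply/matrixP => i j; rewrite !mxE; case: (i \in J).
Qed.

Lemma principal_fillmx J L :
  principal_submx (fillmx J L) J = principal_submx L J.
Proof.
apply/matrixP => i j; rewrite !mxE.
by rewrite !enum_valP.
Qed.

Lemma det_fillmx J L : \det (principal_submx L J) = \det (fillmx J L).
Proof. by rewrite -principal_fillmx det_rowfill rowfill_fill. Qed.

(** For a fixed permutation s, expanding the product over i of [L i (s i) + (i == s i)] chooses one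
    term for each i; [J] is the set of indices that choose [L]. This identity normalizes the law. *)
Lemma sum_det_principal L :
  \sum_(J : {set 'I_N}) \det (principal_submx L J) = \det (1%:M + L).
Proof.
under eq_bigr do rewrite det_rowfill.
rewrite exchange_big /=; apply: eq_bigr => s _.
rewrite -mulr_sumr; congr (_ * _).
have -> : \prod_i (1%:M + L) i (s i) = \prod_i (L i (s i) + (i == s i)%:R).
  by apply: eq_bigr => i _; rewrite !mxE addrC.
rewrite bigA_distr; apply: eq_bigr => J _; apply: eq_bigr => i _.
by rewrite mxE.
Qed.

Lemma principal_set0 L : \det (principal_submx L finset.set0) = 1.
Proof.
rewrite det_rowfill (_ : rowfill _ _ = 1%:M) ?det1//.
by apply/matrixP => i j; rewrite !mxE inE.
Qed.

Lemma principal_setT L : \det (principal_submx L [set: 'I_N]%SET) = \det L.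
Proof.
rewrite det_rowfill; congr (\det _).
by apply/matrixP => i j; rewrite !mxE inE.
Qed.

End Fill.

(** * Positive definiteness, positive minors and the total mass of the law *)

Section PosDef.
Variables (R : realType) (N : nat).
Implicit Types (L H : 'M[R]_N) (x y : 'cV[R]_N).

Definition qform L x y : R := (x^T *m L *m y) 0 0.

Lemma qformE L x y : qform L x y = \sum_i \sum_j x i 0 * L i j * y j 0.
Proof.
rewrite /qform mxE exchange_big/=; apply: eq_bigr => j _.
by rewrite mxE mulr_suml; apply: eq_bigr => i _; rewrite mxE.
Qed.

Lemma posdefP L : L \in posdefmx <->
  L^T = L /\ forall x, x != 0 -> 0 < qform L x x.
Proof.
by split => [/set_mem[/set_mem]|[s p]]; last by apply/mem_set; split => //; apply/mem_set.
Qed.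

Lemma qformC L x y : L^T = L -> qform L x y = qform L y x.
Proof.
move=> sL; rewrite !qformE exchange_big/=; apply: eq_bigr => i _.
apply: eq_bigr => j _; rewrite -[in LHS]sL mxE; ring.
Qed.

Lemma posdef_unit L : L \in posdefmx -> \det L != 0.
Proof.
move=> /posdefP[sL pL]; apply/negP => /eqP/eqP/det0P[v v0 vL].
have := pL v^T; rewrite trmx_eq0 => /(_ v0).
by rewrite /qform trmxK vL mul0mx mxE ltxx.
Qed.

Lemma qform1 x : qform 1%:M x x = \sum_i x i 0 ^+ 2.
Proof.
rewrite /qform mulmx1 mxE; apply: eq_bigr => i _.
by rewrite mxE expr2.
Qed.

Lemma sum_sqr_gt0 x : x != 0 -> 0 < \sum_i x i 0 ^+ 2.
Proof.
move=> x0; rewrite lt_neqAle sumr_ge0 ?andbT; last by move=> i _; exact: sqr_ge0.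
apply: contra x0; rewrite eq_sym psumr_eq0 => [/allP/= h|i _]; last exact: sqr_ge0.
apply/eqP/colP => i; rewrite mxE; apply/eqP.
by have := h i (mem_index_enum _); rewrite sqrf_eq0.
Qed.

Lemma posdef1 : 1%:M \in @posdefmx R N.
Proof. by apply/posdefP; split; [rewrite trmx1|move=> x /sum_sqr_gt0; rewrite -qform1]. Qed.

Lemma qform_lin a b L H x :
  qform (a *: L + b *: H) x x = a * qform L x x + b * qform H x x.
Proof.
by rewrite /qform mulmxDr mulmxDl mxE -!scalemxAr -!scalemxAl !(mxE _ _ 0 0).
Qed.

Lemma posdefD a b L H : 0 < a -> 0 <= b -> L \in posdefmx -> H \in posdefmx ->
  a *: L + b *: H \in posdefmx.
Proof.
move=> a0 b0 /posdefP[sL pL] /posdefP[sH pH]; apply/posdefP; split.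
  by rewrite linearD !linearZ/= sL sH.
move=> x x0; rewrite qform_lin ltr_pwDl ?mulr_gt0 ?pL// mulr_ge0//.
by rewrite ltW// pH.
Qed.

(* The determinant does not vanish on the segment from the identity to L. *)
Lemma posdef_det_gt0 L : L \in posdefmx -> 0 < \det L.
Proof.
move=> pL; rewrite ltNge; apply/negP => dL.
pose p : {poly R} := \det (map_mx polyC 1%:M + 'X *: map_mx polyC (L - 1%:M)).
have pE t : p.[t] = \det (1%:M + t *: (L - 1%:M)).
  rewrite -horner_evalE -det_map_mx; congr (\det _).
  by apply/matrixP => i j; rewrite !mxE /= /horner_eval !hornerE.
have p01 : (- p).[0] <= 0 <= (- p).[1].
  rewrite !hornerN !pE scale0r addr0 det1 oppr_le0 ler01/=.
  by rewrite scale1r addrC subrK oppr_ge0.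
have [t /andP[t0 t1]] := poly_ivt ler01 p01.
rewrite rootN => /rootP; rewrite pE => /eqP; apply/negP.
have -> : 1%:M + t *: (L - 1%:M) = (1 - t) *: 1%:M + t *: L.
  by rewrite scalerBr scalerBl scale1r addrA addrAC.
apply: posdef_unit; have [->|tn0] := eqVneq t 1.
  by rewrite subrr scale0r add0r scale1r.
by apply: posdefD => //; [rewrite subr_gt0 lt_neqAle tn0|exact: posdef1].
Qed.

(** The form splits into [L] on the part of x supported by [J] and the squared norm of the other
    part; one of these parts is nonzero. *)
Lemma fillmx_posdef J L : L \in posdefmx -> fillmx J L \in posdefmx.
Proof.
move=> /posdefP[sL pL]; apply/posdefP; split.
  apply/matrixP => i j; rewrite !mxE andbC eq_sym.
  by rewrite -[in LHS]sL mxE.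
move=> x x0.
pose y : 'cV[R]_N := \col_i (if i \in J then x i 0 else 0).
pose z : 'cV[R]_N := \col_i (if i \in J then 0 else x i 0).
have -> : qform (fillmx J L) x x = qform L y y + qform 1%:M z z.
  rewrite !qformE -big_split/=; apply: eq_bigr => i _.
  rewrite -big_split/=; apply: eq_bigr => j _; rewrite !mxE.
  case: (boolP (i \in J)) => iJ; case: (boolP (j \in J)) => jJ /=; rewrite ?mul0r ?mulr0 ?addr0 ?add0r//.
  - by case: eqP => [e|_]; [move: jJ; rewrite -e iJ|rewrite mulr0 mul0r].
  - by case: eqP => [e|_]; [move: iJ; rewrite e jJ|rewrite mulr0 mul0r].
have [y0|yn0] := eqVneq y 0; last first.
  rewrite ltr_pwDl ?pL// qform1 sumr_ge0// => i _; exact: sqr_ge0.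
have -> : qform L y y = 0 by rewrite y0 /qform mulmx0 mxE.
rewrite add0r qform1 sum_sqr_gt0//; apply: contra x0 => /eqP z0.
apply/eqP/colP => i; rewrite mxE.
move/colP: y0 => /(_ i); move/colP: z0 => /(_ i); rewrite !mxE.
by case: ifP.
Qed.

Lemma principal_gt0 J L : L \in posdefmx -> 0 < \det (principal_submx L J).
Proof. by move=> pL; rewrite det_fillmx posdef_det_gt0// fillmx_posdef. Qed.

Lemma posdef1D L : L \in posdefmx -> 1%:M + L \in posdefmx.
Proof.
move=> pL; have := posdefD ltr01 ler01 posdef1 pL.
by rewrite !scale1r.
Qed.

Lemma det1D_gt0 L : L \in posdefmx -> 0 < \det (1%:M + L).
Proof. by move=> pL; rewrite posdef_det_gt0// posdef1D. Qed.

Lemma dpp_gt0 J L : L \in posdefmx -> 0 < dpp_pmf L J.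
Proof. by move=> pL; rewrite divr_gt0 ?principal_gt0 ?det1D_gt0. Qed.

Lemma dpp_sum L : L \in posdefmx -> \sum_J dpp_pmf L J = 1.
Proof.
move=> pL; rewrite -mulr_suml sum_det_principal divff// gt_eqF//.
exact: det1D_gt0.
Qed.

Lemma dpp_le1 J L : L \in posdefmx -> dpp_pmf L J <= 1.
Proof.
move=> pL; rewrite -(dpp_sum pL) (bigD1 J)//= lerDl sumr_ge0// => K _.
exact/ltW/dpp_gt0.
Qed.

(** The empty minor is 1, so the empty set has probability 1 / det(I + L): the law alone determines
    all principal minors. *)
Lemma principal_dpp J L : \det (1%:M + L) != 0 ->
  \det (principal_submx L J) = dpp_pmf L J / dpp_pmf L finset.set0.
Proof.
by move=> d0; rewrite /dpp_pmf principal_set0 div1r invrK divfK.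
Qed.

End PosDef.

(** * Invariance under conjugation by sign matrices *)

Section SignMx.
Variables (R : realType) (N : nat).
Implicit Types (L D : 'M[R]_N) (e : 'I_N -> bool).

Definition sgnmx e : 'M[R]_N := diag_mx (\row_i (-1) ^+ e i).

Lemma sgnmxE e i j : sgnmx e i j = (-1) ^+ e i *+ (i == j).
Proof. by rewrite !mxE. Qed.

Lemma sgnmxP D : D \in signmx <-> exists e, D = sgnmx e.
Proof.
split=> [/set_mem[/is_diag_mxP dD D1]|[e ->]]; last first.
  apply/mem_set; split; first exact: diag_mx_is_diag.
  by move=> i; rewrite sgnmxE eqxx; case: (e i); [right|left].
exists (fun i => D i i == -1); apply/matrixP => i j; rewrite sgnmxE.
have [<-|ij] := eqVneq i j; last by rewrite dD.
have [->|->] := D1 i; last by rewrite eqxx.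
have -> : (1 == -1 :> R) = false by apply/negP => /eqP; lra.
by [].
Qed.

Lemma sgnmx_conjE e L i j :
  (sgnmx e *m L *m sgnmx e) i j = (-1) ^+ (e i (+) e j) * L i j.
Proof.
by rewrite mul_mx_diag mul_diag_mx !mxE mulrAC -signr_addb.
Qed.

Lemma sgnmx_inv e : sgnmx e *m sgnmx e = 1%:M.
Proof.
apply/matrixP => i j; rewrite mul_diag_mx !mxE.
by case: eqP => [->|]; rewrite ?mulr0n ?mulr0// -signr_addb addbb.
Qed.

Lemma sgnmx_tr e : (sgnmx e)^T = sgnmx e.
Proof. by rewrite tr_diag_mx. Qed.

Lemma det_principal_conj D L J : D \in signmx ->
  \det (principal_submx (D *m L *m D) J) = \det (principal_submx L J).
Proof.
move=> /sgnmxP[e ->]; rewrite !det_rowfill.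
have -> : rowfill J (sgnmx e *m L *m sgnmx e) =
    sgnmx e *m rowfill J L *m sgnmx e.
  apply/matrixP => i j; rewrite sgnmx_conjE [LHS]mxE sgnmx_conjE [in RHS]mxE.
  by case: ifP => // _; case: eqP => [->|]; rewrite ?mulr0// addbb mul1r.
rewrite !det_mulmx mulrAC -det_mulmx sgnmx_inv det1 mul1r//.
Qed.

Lemma det1D_conj D L : D \in signmx ->
  \det (1%:M + D *m L *m D) = \det (1%:M + L).
Proof.
by move=> sD; rewrite -!sum_det_principal; apply: eq_bigr => J _; rewrite det_principal_conj.
Qed.

Lemma dpp_conj D L J : D \in signmx -> dpp_pmf (D *m L *m D) J = dpp_pmf L J.
Proof. by move=> sD; rewrite /dpp_pmf det_principal_conj// det1D_conj. Qed.

Lemma posdef_conj D L : D \in signmx -> L \in posdefmx -> D *m L *m D \in posdefmx.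
Proof.
move=> /sgnmxP[e ->] /posdefP[sL pL]; apply/posdefP; split.
  by rewrite !trmx_mul sgnmx_tr sL mulmxA.
move=> x x0; rewrite /qform -!mulmxA -[x in x^T]trmxK.
have -> : x^T^T^T *m (sgnmx e *m (L *m (sgnmx e *m x))) =
   (sgnmx e *m x)^T *m L *m (sgnmx e *m x).
  by rewrite trmx_mul sgnmx_tr trmxK !mulmxA.
apply: pL; apply: contra x0 => /eqP h.
by rewrite -[x]mul1mx -(sgnmx_inv e) -mulmxA h mulmx0.
Qed.

End SignMx.

(** * Identifiability *)

Section Walks.
Variables (T : finType) (e bad : rel T).

(** Since [f] is total on the natural numbers and only its values up to n count, cutting out a
    stretch is mere arithmetic on indices. *)
Definition walk n (f : nat -> T) := forall i, (i < n)%N -> e (f i) (f i.+1).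

Lemma connect_walk x y : connect e x y ->
  exists n f, [/\ walk n f, f 0%N = x & f n = y].
Proof.
move=> /connectP[p ep ->]; exists (size p), (fun i => nth x (x :: p) i).
split => //; last by rewrite (last_nth x).
by move=> i ip; move/(pathP x): ep => /(_ i ip).
Qed.

Lemma walk_shift n f i j : (i <= j <= n)%N -> walk n f ->
  walk (j - i)%N (fun m => f (m + i)%N).
Proof. by move=> ij wf m mi; apply: wf; lia. Qed.

(** Skips c steps after position i. The new edge is demanded only if some of the walk remains beyond
    the cut; otherwise the walk ends at [f i]. *)
Lemma walk_cut n f i c : (i + c <= n)%N ->
  ((i + c < n)%N -> e (f i) (f (i.+1 + c)%N)) -> walk n f ->
  walk (n - c)%N (fun m => if (m <= i)%N then f m else f (m + c)%N).
Proof.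
move=> ic eic wf m mn; have [mi|mi] := leqP m.+1 i.
  by rewrite ltnW//; apply: wf; lia.
have [mi2|mi2] := leqP m i; last by rewrite addSn; apply: wf; lia.
have -> : m = i by lia.
by apply: eic; lia.
Qed.

(** The minimum is taken over walks between the ends of any bad pair, not only x and y. A loop or a
    chord would give a shorter walk with the same ends, and a bad pair at smaller distance along the
    walk would itself bound a shorter one. *)
Lemma minimal_bad_walk x y : connect e x y -> bad x y ->
  exists k (w : 'I_k.+1 -> T), [/\ injective w,
    forall i j : 'I_k.+1, j = i.+1 :> nat -> e (w i) (w j),
    bad (w ord0) (w ord_max),
    (forall i j : 'I_k.+1, (i.+1 < j)%N -> ~~ e (w i) (w j)) &
    forall i j : 'I_k.+1, (i <= j)%N -> (j - i < k)%N -> ~~ bad (w i) (w j)].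
Proof.
move=> cxy bxy.
pose P n := `[< exists f, walk n f /\ bad (f 0%N) (f n) >].
have exP : exists n, P n.
  have [n [f [wf f0 fn]]] := connect_walk cxy; exists n; apply/asboolP.
  by exists f; rewrite f0 fn.
case: (ex_minnP exP) => k /asboolP[f [wf bf]] kmin.
have shorter m g : (m < k)%N -> walk m g -> ~~ bad (g 0%N) (g m).
  move=> mk wg; apply/negP => bg.
  by have := kmin m; rewrite leqNgt mk => /(_ _)/negP; apply=> //; apply/asboolP; exists g.
exists k, (fun i => f i); split.
- suff ne : forall i j : 'I_k.+1, (i < j)%N -> f i != f j.
    move=> i j fij; apply/val_inj; case: (ltngtP i j) => // h.
      by have := ne _ _ h; rewrite fij eqxx.
    by have := ne _ _ h; rewrite fij eqxx.
  (* The loop from i to j is cut out. If j is the last index, the cut walk ends at [f i], which is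
     still the old endpoint. *)
  move=> i j ij; apply/eqP => fij; have jk := ltn_ord j.
  have ijk : (i < j <= k)%N by rewrite ij -ltnS.
  have lt_k : (k - (j - i) < k)%N by lia.
  have ic : (i + (j - i) <= k)%N by lia.
  have eic : (i + (j - i) < k)%N -> e (f i) (f (i.+1 + (j - i))%N).
    move=> jk1; rewrite (_ : i.+1 + (j - i) = j.+1)%N; last by lia.
    by rewrite fij; apply: wf; lia.
  have /negP := shorter _ _ lt_k (walk_cut ic eic wf).
  apply; rewrite leq0n; have [h|h] := leqP (k - (j - i)) i; last first.
    by rewrite (_ : k - (j - i) + (j - i) = k)%N //; lia.
  have jk2 : (j : nat) = k by lia.
  by rewrite jk2 (_ : k - (k - i) = i)%N ?fij ?jk2//; lia.
- by move=> i j ji; rewrite ji; apply: wf; have := ltn_ord j; lia.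
- by [].
(* The chord replaces j - i steps by a single one. *)
- move=> i j ij; apply/negP => eij; have jk := ltn_ord j.
  have ijk : (i.+1 < j <= k)%N by rewrite ij -ltnS.
  have lt_k : (k - (j - i.+1) < k)%N by lia.
  have ic : (i + (j - i.+1) <= k)%N by lia.
  have eic : (i + (j - i.+1) < k)%N -> e (f i) (f (i.+1 + (j - i.+1))%N).
    by rewrite (_ : i.+1 + (j - i.+1) = j)%N //; lia.
  have /negP := shorter _ _ lt_k (walk_cut ic eic wf).
  apply; rewrite leq0n.
  have [h|h] := leqP (k - (j - i.+1)) i; first lia.
  by rewrite (_ : k - (j - i.+1) + (j - i.+1) = k)%N //; lia.
- move=> i j ij jik; have jk := ltn_ord j.
  have ijk : (i <= j <= k)%N by rewrite ij -ltnS.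
  by have := shorter (j - i)%N _ jik (walk_shift ijk wf); rewrite add0n subnK.
Qed.

End Walks.

(** * Determinants under a change of the corner entries *)

Section Corner.
Variables (R : realType).

Lemma det_add_delta n (A : 'M[R]_n) i j h :
  \det (A + h *: delta_mx i j) = \det A + h * cofactor A i j.
Proof.
rewrite (expand_det_row _ i) [in RHS](expand_det_row _ i).
have cE k : cofactor (A + h *: delta_mx i j) i k = cofactor A i k.
  congr (_ * \det _); apply/matrixP => a b.
  by rewrite !mxE eq_sym (negbTE (neq_lift _ _))/= mulr0 addr0.
under eq_bigr do rewrite cE mxE mulrDl.
rewrite big_split/=; congr (_ + _).
rewrite (bigD1 j)//= big1 ?addr0; first by rewrite !mxE !eqxx mulr1.
by move=> k kj; rewrite !mxE eqxx (negbTE kj) mulr0 mul0r.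
Qed.

(** The two corner entries are changed one after the other; the second cofactor is affine in h,
    which produces the square. The coefficient c can stay anonymous: the uses compare h with - h or
    read off the linear term. *)
Lemma det_corner_quadratic n (T : 'M[R]_n.+2) : exists c, forall h,
  \det (T + h *: (delta_mx ord0 ord_max + delta_mx ord_max ord0)) =
    \det T + h * (cofactor T ord0 ord_max + cofactor T ord_max ord0) + h ^+ 2 * c.
Proof.
pose S := row' ord_max (col' ord0 T).
exists ((-1) ^+ (n.+1 + 0) * cofactor S ord0 ord_max) => h.
rewrite scalerDr addrA !det_add_delta mulrDr -!addrA; congr (_ + (_ + _)).
rewrite expr2 -!mulrA -mulrDr; congr (_ * _).
rewrite /cofactor -/S.
have -> : row' ord_max (col' ord0 (T + h *: delta_mx ord0 ord_max)) =
    S + h *: delta_mx ord0 ord_max.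
  apply/matrixP => a b; rewrite !mxE; congr (_ + _ * (_ && _)%:R).
  - by rewrite -!val_eqE /= /bump; have := ltn_ord a; lia.
rewrite det_add_delta /cofactor /=; ring.
Qed.

(** Deleting the last row and the first column turns the superdiagonal into the diagonal of a lower
    triangular matrix. *)
Lemma tridiag_cofactor n (T : 'M[R]_n.+1) :
  (forall i j : 'I_n.+1, (i.+1 < j)%N -> T i j = 0) ->
  (forall i j : 'I_n.+1, j = i.+1 :> nat -> T i j != 0) ->
  cofactor T ord_max ord0 != 0.
Proof.
move=> T0 T1; rewrite /cofactor mulf_neq0 ?signr_eq0// det_trig; last first.
  apply/is_trig_mxP => i j ij; rewrite !mxE T0//= /bump.
  have iN : (i < n)%N := ltn_ord i.
  have -> : (n <= i)%N = false by rewrite leqNgt iN.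
  by rewrite add0n leq0n add1n ltnS.
apply/prodf_neq0 => i _; rewrite !mxE T1//= /bump.
have iN : (i < n)%N := ltn_ord i.
by have -> : (n <= i)%N = false by rewrite leqNgt iN.
Qed.

Lemma cofactor_symm n (T : 'M[R]_n) i j : T^T = T ->
  cofactor T i j = cofactor T j i.
Proof.
move=> sT; rewrite /cofactor addnC; congr (_ * _).
rewrite -det_tr; congr (\det _); apply/matrixP => a b.
by rewrite !mxE -[in LHS]sT mxE.
Qed.

Lemma det_principal_image N k (w : 'I_k -> 'I_N) (L : 'M[R]_N) : injective w ->
  \det (principal_submx L [set w i | i in 'I_k]%SET) = \det (mxsub w w L).
Proof.
move=> winj; set J := [set w i | i in 'I_k]%SET.
have wJ i : w i \in J by apply: imset_f.
pose f i : 'I_#|J| := enum_rank_in (wJ i) (w i).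
have fE i : enum_val (f i) = w i by rewrite enum_rankK_in.
rewrite -(@det_mxsub_bij _ _ _ f).
  by congr (\det _); apply/matrixP => i j; rewrite !mxE !fE.
apply: inj_card_bij; last by rewrite !card_ord card_imset ?card_ord.
by move=> i j /(congr1 enum_val); rewrite !fE => /winj.
Qed.

End Corner.

(** * Connectivity and the information contained in principal minors *)

Section Graph.
Variables (R : realType) (N : nat).
Implicit Types (L H A B : 'M[R]_N).

(** Connectedness by cuts: a set without outgoing edges is what the count of sign conjugates
    excludes, and a cut edge is what the maximality argument of [principal_minors_identify]
    consumes. *)
Definition connected_mx L : Prop := forall S : {set 'I_N},
  S != finset.set0 -> S != [set: 'I_N]%SET ->
  exists i j, [/\ i \in S, j \notin S & L i j != 0].

Lemma connected_connect L (e : rel 'I_N) x y : connected_mx L ->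
  (forall i j, L i j != 0 -> e i j) -> connect e x y.
Proof.
move=> cL Le; pose S := [set z | connect e x z]%SET.
have [ST|ST] := eqVneq S [set: 'I_N]%SET.
  by have : y \in S by [rewrite ST inE]; rewrite inE.
have [|i [j [iS jS ij]]] := cL S _ ST.
  by apply/finset.set0Pn; exists x; rewrite inE.
move: jS iS; rewrite !inE => /negP jS iS; exfalso; apply: jS.
exact: connect_trans iS (connect1 (Le _ _ ij)).
Qed.

(** If no edge leaves [S], signs can be flipped independently on [S] and on its complement. Every
    conjugate then comes from a sign pattern that is trivial at one point of each side, which leaves
    at most 2 ^ (N - 2) conjugates. *)
Lemma irreducible_connected L : L \in posdefmx -> irreducible_mx L ->
  connected_mx L.
Proof.
move=> pL iL S /finset.set0Pn[i0 i0S] ST.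
have [j0 j0S] : exists j0, j0 \notin S.
  apply/existsP; rewrite -negb_forall; apply: contra ST => /forallP h.
  by apply/eqP/setP => i; rewrite h inE.
apply: contrapT => nex.
have sL i j : L i j = L j i.
  by have /posdefP[e _] := pL; rewrite -[in LHS]e mxE.
have L0 i j : (i \in S) != (j \in S) -> L i j = 0.
  move=> ij; apply/eqP/negPn/negP => Lij; apply: nex.
  case: (boolP (i \in S)) ij => iS; case: (boolP (j \in S)) => jS //= _.
    by exists i, j.
  by exists j, i; rewrite sL.
have /card_set_bijP[f [fS finj fsurj]] : (`I_(2 ^ N.-1) #= [set D *m L *m D | D in signmx])%card.
  by rewrite card_eq_sym.
have hU k : exists U : {set 'I_N}, (k < 2 ^ N.-1)%N ->
    U \subset ~: [set i0; j0]%SET /\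
    f k = sgnmx R (fun i => i \in U) *m L *m sgnmx R (fun i => i \in U).
  have [kN|] := boolP (k < 2 ^ N.-1)%N; last by exists finset.set0.
  have [D /mem_set/sgnmxP[e ->] <-] := fS k kN.
  (* The pattern is normalized by its sign at [i0] inside [S] and by its sign at [j0] outside; the
     entries across the cut vanish and do not see the change. *)
  exists [set i | e i (+) (if i \in S then e i0 else e j0)]%SET => _; split.
    apply/fintype.subsetP => i; rewrite !inE; apply: contraL.
    by move=> /orP[] /eqP ->; rewrite ?i0S ?(negbTE j0S) addbb.
  apply/matrixP => i j; rewrite !sgnmx_conjE !inE.
  have [ij|ij] := eqVneq (i \in S) (j \in S); last by rewrite L0// !mulr0.
  by rewrite ij; case: ifP => _; rewrite addbACA addbb addbF.
have [U hUk] := choice hU.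
have : (#|[set U k | k : 'I_(2 ^ N.-1)]%SET| <= #|powerset (~: [set i0; j0]%SET)|)%N.
  apply: subset_leq_card; apply/fintype.subsetP => V /imsetP[k _ ->].
  by rewrite powersetE; have [] := hUk k (ltn_ord k).
rewrite card_imset; last first.
  move=> k l kl; apply/val_inj; apply: finj; rewrite ?inE/=; try exact: ltn_ord.
  have [_ ->] := hUk k (ltn_ord k); have [_ ->] := hUk l (ltn_ord l).
  by rewrite kl.
rewrite card_powerset card_ord leq_exp2l//.
have := finset.cardsC [set i0; j0]%SET; rewrite cards2 card_ord.
have -> : i0 != j0 by apply: contraNneq j0S => <-.
lia.
Qed.

(* A shortest walk joining a mismatched pair induces T + h E against T - h E
   with T tridiagonal and E the symmetric corner matrix; the coefficient of h
   in the determinant is a nonzero product of path edges. *)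
Lemma mismatch_disconnected A B : A^T = A -> B^T = B ->
  (forall i j, B i j = A i j \/ B i j = - A i j) -> (forall i, B i i = A i i) ->
  (forall J, \det (principal_submx A J) = \det (principal_submx B J)) ->
  forall x y, connect (fun i j => (A i j != 0) && (A i j == B i j)) x y ->
    B x y = A x y.
Proof.
move=> sA sB AB ABd dAB x y cxy; apply/eqP/negPn/negP => xy.
have [k [w [winj we wbad wne wnb]]] :=
  minimal_bad_walk (bad := fun i j => B i j != A i j) cxy xy.
have := dAB [set w i | i in 'I_k.+1]%SET; rewrite !det_principal_image//.
(* A walk with one vertex would make a diagonal entry disagree. *)
case: k => [|k] in w winj we wbad wne wnb *.
  by move: wbad; rewrite [ord_max]ord1 ABd eqxx.
pose a := A (w ord0) (w ord_max).
have sA' i j : A i j = A j i by rewrite -[in LHS]sA mxE.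
have sB' i j : B i j = B j i by rewrite -[in LHS]sB mxE.
have Ba : B (w ord0) (w ord_max) = - a.
  by case: (AB (w ord0) (w ord_max)) => // e; move: wbad; rewrite e eqxx.
have a0 : a != 0.
  by apply: contraNneq wbad => a0; rewrite Ba a0 oppr0 -/a a0.
pose E : 'M[R]_k.+2 := delta_mx ord0 ord_max + delta_mx ord_max ord0.
pose cor (i j : 'I_k.+2) := (i == ord0) && (j == ord_max) || (i == ord_max) && (j == ord0).
have EE i j : E i j = (cor i j)%:R.
  rewrite !mxE /cor; case: (eqVneq i ord0) => [->|_] /=; last by rewrite add0r.
  by rewrite addr0 orbF.
pose T : 'M[R]_k.+2 := \matrix_(i, j) if cor i j then 0 else A (w i) (w j).
have nb (i j : 'I_k.+2) : (i <= j)%N -> ~~ cor i j -> B (w i) (w j) = A (w i) (w j).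
  move=> ij cij; apply/eqP/negPn; apply: wnb => //.
  move: cij; rewrite /cor -!val_eqE /= negb_or => /andP[]; move: (ltn_ord i) (ltn_ord j); lia.
have corC i j : cor i j = cor j i by rewrite /cor orbC andbC [X in _ || X]andbC.
have corA i j : cor i j -> A (w i) (w j) = a /\ B (w i) (w j) = - a.
  by rewrite /cor => /orP[] /andP[/eqP -> /eqP ->]; rewrite ?Ba// sA' sB' Ba.
have -> : mxsub w w A = T + a *: E.
  apply/matrixP => i j; rewrite mxE [RHS]mxE [in RHS]mxE [(a *: E) _ _]mxE EE.
  case: (boolP (cor i j)) => [/corA[-> _]|_]; first by rewrite mulr1 add0r.
  by rewrite mulr0 addr0.
have -> : mxsub w w B = T + (- a) *: E.
  apply/matrixP => i j; rewrite mxE [RHS]mxE [in RHS]mxE [(_ *: E) _ _]mxE EE.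
  case: (boolP (cor i j)) => [/corA[_ ->]|cij]; first by rewrite mulr1 add0r.
  rewrite mulr0 addr0; have [ij|/ltnW ji] := leqP i j; first exact: nb.
  by rewrite sA' sB' nb// corC.
have [c Tc] := det_corner_quadratic T; rewrite !Tc -/E.
have sT : T^T = T.
  by apply/matrixP => i j; rewrite !mxE corC sA'.
rewrite (cofactor_symm ord0 ord_max sT) => h.
suff /eqP T0 : cofactor T ord_max ord0 == 0.
  move/eqP: T0; apply/negP; apply: tridiag_cofactor.
- move=> i j ij; rewrite mxE; case: ifP => // /negbT cij.
  have := wne _ _ ij; rewrite nb ?eqxx ?andbT ?negbK; last 2 first.
    by apply: ltnW; exact: ltnW.
    by [].
  by move/eqP.
- move=> i j ij; have /andP[Ane /eqP AB'] := we _ _ ij; rewrite mxE.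
  (* A corner lies on the superdiagonal only if the walk has one edge; as an agreement edge it
     forces a = - a. *)
  case: (boolP (cor i j)) => // /corA[e1 e2].
  move: AB'; rewrite e1 e2 => aa; move: a0; suff -> : a = 0 by rewrite eqxx.
  lra.
- have : a * cofactor T ord_max ord0 = 0 by move: h; rewrite sqrrN; lra.
  by move/eqP; rewrite mulf_eq0 (negbTE a0).
Qed.

(** The hypothesis avoids derivatives by speaking only of minors that are exactly quadratic along
    [A + s *: H]. On a shortest walk joining the indices of a nonzero entry of [H], the restriction
    of [H] is a corner matrix, and the linear coefficient is, up to sign, twice that entry times a
    product of path edges. *)
Lemma quadratic_score_injective A H : A^T = A -> H^T = H -> connected_mx A ->
  (forall J c1 c2, (forall s : R, \det (principal_submx (A + s *: H) J) =
     \det (principal_submx A J) + s * c1 + s ^+ 2 * c2) -> c1 = 0) ->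
  H = 0.
Proof.
move=> sA sH cA h1; apply/matrixP => x y; rewrite mxE.
apply/eqP/negPn/negP => xy.
have cxy : connect (fun i j => A i j != 0) x y by apply: connected_connect cA _.
have [k [w [winj we wbad wne wnb]]] :=
  minimal_bad_walk (bad := fun i j => H i j != 0) cxy xy.
have sA' i j : A i j = A j i by rewrite -[in LHS]sA mxE.
have sH' i j : H i j = H j i by rewrite -[in LHS]sH mxE.
(* With one vertex, the 1 x 1 minor reads off the diagonal entry of [H]. *)
case: k => [|k] in w winj we wbad wne wnb *.
  move: wbad; rewrite [ord_max]ord1 => /eqP; apply.
  apply: (h1 [set w i | i in 'I_1]%SET _ 0) => s.
  by rewrite !det_principal_image// !det_mx11 !mxE mulr0 addr0.
pose E : 'M[R]_k.+2 := delta_mx ord0 ord_max + delta_mx ord_max ord0.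
pose T := mxsub w w A; pose a := H (w ord0) (w ord_max).
have [c Tc] := det_corner_quadratic T.
have sT : T^T = T by apply/matrixP => i j; rewrite !mxE sA'.
have HE : mxsub w w H = a *: E.
  have H0 (i j : 'I_k.+2) : (i <= j)%N -> (j - i < k.+1)%N -> H (w i) (w j) = 0.
    by move=> ij ijk; apply/eqP/negPn/(wnb _ _ ij ijk).
  apply/matrixP => i j; rewrite !mxE.
  have [->|i0] := eqVneq i ord0.
    have [->|jm] := eqVneq j ord_max; first by rewrite addr0 mulr1.
    rewrite add0r mulr0 H0//=.
    by move: jm; rewrite -val_eqE/= => /eqP; move: (ltn_ord j); lia.
  have [->|im] := eqVneq i ord_max.
    have [->|j0] := eqVneq j ord0; first by rewrite add0r mulr1 sH'.
    rewrite addr0 mulr0 sH' H0//=; first by rewrite -ltnS.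
    by move: j0; rewrite -val_eqE/= => /eqP; move: (ltn_ord j); lia.
  rewrite addr0 mulr0; move: i0 im; rewrite -!val_eqE/= => /eqP i0 /eqP im.
  move: (ltn_ord i) (ltn_ord j) => ik jk.
  have [ij|ij] := leqP i j; first by rewrite H0//; lia.
  by rewrite sH' H0//; lia.
have := h1 [set w i | i in 'I_k.+2]%SET
  (a * (cofactor T ord0 ord_max + cofactor T ord_max ord0)) (a ^+ 2 * c).
rewrite (cofactor_symm ord0 ord_max sT) => /(_ _)/eqP; rewrite mulf_eq0 (negbTE wbad)/=.
have c0 : cofactor T ord_max ord0 != 0.
  apply: tridiag_cofactor => i j ij; rewrite mxE; last exact: we.
  by apply/eqP/negPn/wne.
rewrite -mulr2n mulrn_eq0/= (negbTE c0) => h2; apply/(elimF idP erefl)/h2 => s.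
rewrite !det_principal_image//.
have -> : mxsub w w (A + s *: H) = T + (s * a) *: E.
  by rewrite -scalerA -HE; apply/matrixP => i j; rewrite !mxE.
rewrite Tc (cofactor_symm ord0 ord_max sT) -mulr2n; ring.
Qed.

(** The 1 x 1 minors give the diagonal, the 2 x 2 minors the squares of the other entries. *)
Lemma minors_entries A B : A^T = A -> B^T = B ->
  (forall J, \det (principal_submx A J) = \det (principal_submx B J)) ->
  (forall i, B i i = A i i) /\ (forall i j, B i j = A i j \/ B i j = - A i j).
Proof.
move=> sA sB dAB.
have dg i : B i i = A i i.
  have := dAB [set (fun _ : 'I_1 => i) k | k in 'I_1]%SET.
  by rewrite !det_principal_image ?det_mx11 ?mxE// => k l; rewrite !ord1.
split=> // i j; have [->|ij] := eqVneq i j; first by left.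
pose w (k : 'I_2) := if k == ord0 then i else j.
have wi : injective w.
  by move=> [[|[|//]] p] [[|[|//]] q] //=; rewrite /w/= => e; apply/val_inj => //=; move: ij; rewrite e eqxx.
have := dAB [set w k | k in 'I_2]%SET.
rewrite !det_principal_image// !(expand_det_row _ ord0) !big_ord_recl !big_ord0.
rewrite /cofactor !det_mx11 !mxE /w /= !dg.
have -> : A j i = A i j by rewrite -[in LHS]sA mxE.
have -> : B j i = B i j by rewrite -[in LHS]sB mxE.
rewrite /bump/= !addr0 !addn0 expr0 expr1 !mul1r => h.
have /eqP : (B i j - A i j) * (B i j + A i j) = 0 by lra.
by rewrite mulf_eq0 subr_eq0 addr_eq0 => /orP[]/eqP ->; [left|right].
Qed.

(* Among the sign conjugates of B, one agreeing with A in the largest number of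
   entries has a connected agreement graph, otherwise flipping the signs on one
   component would gain entries. *)
Lemma principal_minors_identify A B : A^T = A -> B^T = B -> connected_mx A ->
  (forall J, \det (principal_submx A J) = \det (principal_submx B J)) ->
  exists2 D, D \in signmx & A = D *m B *m D.
Proof.
move=> sA sB cA dAB.
have sA' i j : A i j = A j i by rewrite -[in LHS]sA mxE.
pose C (e : {ffun 'I_N -> bool}) := sgnmx R e *m B *m sgnmx R e.
pose agree e := [set ij : 'I_N * 'I_N | A ij.1 ij.2 == C e ij.1 ij.2]%SET.
pose e := [arg max_(e > [ffun=> false]) #|agree e|].
have emax f : (#|agree f| <= #|agree e|)%N.
  by rewrite /e; case: arg_maxnP => //= e' _ h; exact: h.
have sD : sgnmx R e \in signmx by apply/sgnmxP; exists e.
exists (sgnmx R e) => //; rewrite -/(C e).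
have sC : (C e)^T = C e by rewrite /C !trmx_mul sgnmx_tr sB mulmxA.
have dAC J : \det (principal_submx A J) = \det (principal_submx (C e) J).
  by rewrite det_principal_conj.
have [dg AC] := minors_entries sA sC dAC.
apply/matrixP => x y; symmetry.
apply: (mismatch_disconnected sA sC AC dg dAC).
set r := fun i j => _.
pose S := [set z | connect r x z]%SET.
suff : S = [set: 'I_N]%SET by move/setP => /(_ y); rewrite !inE.
apply/eqP/negPn/negP => ST.
have [|i [j [iS jS ij]]] := cA S _ ST.
  by apply/finset.set0Pn; exists x; rewrite inE.
(* A nonzero agreeing entry from [S] to its complement would enlarge the component [S]. *)
have cross a b : a \in S -> b \notin S -> C e a b = - A a b.
  rewrite !inE => aS bS; case: (AC a b) => // h; rewrite h.
  have [->|Ane] := eqVneq (A a b) 0; first by rewrite oppr0.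
  case/negP: bS; apply: connect_trans aS (connect1 _).
  by rewrite /r Ane h eqxx.
pose f : {ffun 'I_N -> bool} := [ffun z => e z (+) (z \in S)].
have CfE a b : C f a b = (-1) ^+ ((a \in S) (+) (b \in S)) * C e a b.
  by rewrite !sgnmx_conjE !ffunE addbACA signr_addb mulrA [X in X * _]mulrC.
have : (#|agree e| < #|agree f|)%N.
  apply: proper_card; apply/properP; split.
    apply/fintype.subsetP => -[a b]; rewrite !inE/= CfE.
    case: (boolP (a \in S)) => aS; case: (boolP (b \in S)) => bS /=; rewrite ?mul1r// expr1 mulN1r.
      by rewrite cross// opprK eqxx.
    by rewrite -[in C e a b]sC mxE cross// opprK sA' eqxx.
  exists (i, j); rewrite inE/= ?CfE ?iS ?(negbTE jS)/= cross//.
    by rewrite expr1 mulN1r opprK.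
  by apply/negP => /eqP h; move: ij; suff -> : A i j = 0 by [rewrite eqxx]; lra.
by rewrite ltnNge emax.
Qed.

End Graph.

(** * Differentiability of the likelihood *)

Section C1.
Variables (R : realType) (V : normedModType R).
Implicit Types (f g : V -> R) (x h : V).

(** Continuity is asked at x only and direction by direction, which is stable under the operations
    below and yields the continuity of the scores. *)
Definition C1 f x := (\forall y \near x, differentiable f y) /\
  forall h, {for x, continuous (fun y => 'd f y h)}.

Lemma C1_diff f x : C1 f x -> differentiable f x.
Proof. by move=> [/nbhs_singleton]. Qed.

Lemma C1_cvg f x : C1 f x -> f y @[y --> x] --> f x.
Proof. by move/C1_diff/differentiable_continuous. Qed.

Lemma near_cvg_eq (f g : V -> R) x (l : R) : (\forall y \near x, f y = g y) ->
  f y @[y --> x] --> l -> g y @[y --> x] --> l.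
Proof. by move=> fg; apply: cvg_trans; exact: near_eq_cvg. Qed.

Lemma cvgr_bigsum (I T : Type) (r : seq I) (f : I -> T -> R) (l : I -> R)
    (F : set_system T) {FF : Filter F} : (forall i, f i y @[y --> F] --> l i) ->
  \sum_(i <- r) f i y @[y --> F] --> \sum_(i <- r) l i.
Proof.
move=> fl; elim: r => [|i r IH].
  by under eq_fun do rewrite big_nil; rewrite big_nil; exact: cvg_cst.
by under eq_fun do rewrite big_cons; rewrite big_cons; exact: (cvgD (fl i) IH).
Qed.

Lemma C1_cst a x : C1 (cst a) x.
Proof.
split; first by near=> y; exact: differentiable_cst.
move=> h; apply: (@near_cvg_eq (cst 0)); first by near=> y; rewrite diff_cst.
by rewrite diff_cst; exact: cvg_cst.
Unshelve. all: by end_near. Qed.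

Lemma C1_lin (f : {linear V -> R}) x : continuous f -> C1 f x.
Proof.
move=> cf; split; first by near=> y; exact: linear_differentiable.
move=> h; apply: (@near_cvg_eq (cst (f h))); first by near=> y; rewrite diff_lin.
by rewrite diff_lin//; exact: cvg_cst.
Unshelve. all: by end_near. Qed.

Lemma C1D f g x : C1 f x -> C1 g x -> C1 (fun y => f y + g y) x.
Proof.
move=> [df cf] [dg cg]; split; first by near=> y; apply: differentiableD; near: y.
have dD y h : differentiable f y -> differentiable g y ->
    'd (fun y => f y + g y) y h = 'd f y h + 'd g y h.
  by move=> dfy dgy; rewrite [LHS](_ : _ = 'd (f + g) y h)// diffD.
move=> h; rewrite /continuous_at.
apply: (@near_cvg_eq (fun y => 'd f y h + 'd g y h)).
  by near=> y; rewrite dD//; near: y.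
by rewrite dD; [exact: (cvgD (cf h) (cg h))|exact: nbhs_singleton df|exact: nbhs_singleton dg].
Unshelve. all: by end_near. Qed.

Lemma diff_mul f g y h : differentiable f y -> differentiable g y ->
  differentiable (fun z => f z * g z) y /\
  'd (fun z => f z * g z) y h = f y * 'd g y h + g y * 'd f y h.
Proof.
move=> df dg; split; first exact: differentiableM.
by rewrite [LHS](_ : _ = 'd (f * g) y h)// diffM.
Qed.

Lemma C1M f g x : C1 f x -> C1 g x -> C1 (fun y => f y * g y) x.
Proof.
move=> Cf Cg; have [[df cf] [dg cg]] := (Cf, Cg).
split; first by near=> y; apply: differentiableM; near: y.
move=> h; rewrite /continuous_at.
apply: (@near_cvg_eq (fun y => f y * 'd g y h + g y * 'd f y h)).
  near=> y; have dfy : differentiable f y by near: y.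
  have dgy : differentiable g y by near: y.
  by have [_ ->] := diff_mul h dfy dgy.
have [_ ->] := diff_mul h (C1_diff Cf) (C1_diff Cg).
apply: cvgD; apply: cvgM; [exact: C1_cvg|exact: cg|exact: C1_cvg|exact: cf].
Unshelve. all: by end_near. Qed.

Lemma C1_comp (u : R -> R) (u' : R -> R) f x :
  (\forall t \near f x, is_derive t (1 : R) u (u' t)) -> {for f x, continuous u'} ->
  C1 f x -> C1 (u \o f) x /\
  (\forall y \near x, forall h, 'd (u \o f) y h = u' (f y) * 'd f y h).
Proof.
move=> du cu Cf; have [df cf] := Cf.
have duf : \forall y \near x, is_derive (f y) (1 : R) u (u' (f y)).
  by have := C1_cvg Cf => /(_ _ du).
have dE : \forall y \near x, forall h, 'd (u \o f) y h = u' (f y) * 'd f y h.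
  near=> y => h; have duy : is_derive (f y) (1 : R) u (u' (f y)) by near: y.
  have dfy : differentiable f y by near: y.
  have ddu : differentiable u (f y) by apply/derivable1_diffP.
  have E v : 'd u (f y) v = u' (f y) * v.
    case: duy => _ <-; rewrite deriveE// -[v in LHS]mulr1.
    by rewrite [LHS](linearZ_LR ('d u (f y)) v) [LHS]mulrC.
  by rewrite diff_comp//= E.
split; last exact: dE.
split.
  near=> y; apply: differentiable_comp; first by near: y.
  have duy : is_derive (f y) (1 : R) u (u' (f y)) by near: y.
  by apply/derivable1_diffP.
move=> h; rewrite /continuous_at.
apply: (@near_cvg_eq (fun y => u' (f y) * 'd f y h)).
  by near=> y; rewrite (near dE y).
have -> : 'd (u \o f) x h = u' (f x) * 'd f x h by rewrite (nbhs_singleton dE).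
apply: cvgM; last exact: cf.
by apply: (cvg_comp _ u' (C1_cvg Cf)); exact: cu.
Unshelve. all: by end_near. Qed.

Lemma C1_sum (I : Type) (r : seq I) (F : I -> V -> R) x :
  (forall i, C1 (F i) x) -> C1 (fun y => \sum_(i <- r) F i y) x.
Proof.
move=> CF; elim: r => [|i r IH].
  by under [X in C1 X _]eq_fun do rewrite big_nil; exact: C1_cst.
have -> : (fun y => \sum_(j <- i :: r) F j y) = fun y => F i y + (\sum_(j <- r) F j y).
  by apply/funext => y; rewrite big_cons.
exact: (C1D (CF i) IH).
Qed.

Lemma C1_prod (I : Type) (r : seq I) (F : I -> V -> R) x :
  (forall i, C1 (F i) x) -> C1 (fun y => \prod_(i <- r) F i y) x.
Proof.
move=> CF; elim: r => [|i r IH].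
  by under [X in C1 X _]eq_fun do rewrite big_nil; exact: C1_cst.
have -> : (fun y => \prod_(j <- i :: r) F j y) = fun y => F i y * (\prod_(j <- r) F j y).
  by apply/funext => y; rewrite big_cons.
exact: (C1M (CF i) IH).
Qed.

Lemma C1V f x : f x != 0 -> C1 f x -> C1 (fun y => (f y)^-1) x.
Proof.
move=> fx0 Cf.
have [|| //] := @C1_comp (fun t => t^-1) (fun t => - t ^- 2) f x _ _ Cf.
- near=> t.
  have t0 : t != 0.
    near: t; exact: (cvgr_neq0 _ (@cvg_id _ (nbhs (f x)))).
  by apply: DeriveDef; [exact: derivableV|rewrite deriveV// derive_id /GRing.scale/= mulr1].
- apply: cvgN; apply: cvgV; first by rewrite expf_neq0.
  exact: (@exprn_continuous _ 2).
Unshelve. all: by end_near. Qed.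

Lemma C1_ln f x : 0 < f x -> C1 f x -> C1 (fun y => ln (f y)) x /\
  (\forall y \near x, forall h, 'd (fun y => ln (f y)) y h = (f y)^-1 * 'd f y h).
Proof.
move=> fx0 Cf.
apply: (@C1_comp (@ln R) (fun t => t^-1) f x _ _ Cf).
- near=> t; apply: is_derive1_ln; near: t.
  exact: lt_nbhsr.
- by apply: cvgV; [rewrite gt_eqF|exact: cvg_id].
Unshelve. all: by end_near. Qed.

End C1.

(** * Scores of the determinantal law and the Hessian of the expected log-likelihood *)

Section DetC1.
Variables (R : realType) (N : nat).
Notation V := 'M[R]_N.
Implicit Types (L H K : 'M[R]_N) (J : {set 'I_N}).

Lemma coord_cont (i j : 'I_N) : continuous (fun L : V => L i j).
Proof. exact: coord_continuous. Qed.

Lemma C1_coord i j L : C1 (fun K : V => K i j) L.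
Proof.
have lin : linear (fun K : V => K i j) by move=> a u v; rewrite !mxE.
pose f : {linear V -> R} := HB.pack (fun K : V => K i j) (GRing.isLinear.Build _ _ _ _ _ lin).
exact: (@C1_lin R V f L (@coord_cont i j)).
Qed.

Lemma C1_det_affine n (F : 'I_n -> 'I_n -> V -> R) L :
  (forall i j, C1 (F i j) L) -> C1 (fun K => \det (\matrix_(i, j) F i j K)) L.
Proof.
move=> CF; rewrite /determinant; apply: C1_sum => s.
apply: C1M; first exact: C1_cst.
apply: C1_prod => i; under [X in C1 X _]eq_fun do rewrite mxE.
exact: CF.
Qed.

Lemma C1_principal J L : C1 (fun K => \det (principal_submx K J)) L.
Proof. by apply: C1_det_affine => i j; exact: C1_coord. Qed.

Lemma C1_det1D L : C1 (fun K : V => \det (1%:M + K)) L.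
Proof.
have -> : (fun K : V => \det (1%:M + K)) =
    fun K : V => \det (\matrix_(i, j) (cst (1%:M i j) K + K i j)).
  by apply/funext => K; congr (\det _); apply/matrixP => i j; rewrite !mxE.
apply: (@C1_det_affine _ (fun i j K => cst (1%:M i j) K + K i j)) => i j.
by apply: C1D; [exact: C1_cst|exact: C1_coord].
Qed.

(** An open substitute for positive definiteness: it allows nonsymmetric matrices near a positive
    definite one while keeping every logarithm differentiable. *)
Definition good L := 0 < \det (1%:M + L) /\ forall J, 0 < \det (principal_submx L J).

Lemma posdef_good L : L \in posdefmx -> good L.
Proof. by move=> pL; split=> [|J]; [exact: det1D_gt0|exact: principal_gt0]. Qed.

Lemma near_good L : good L -> \forall K \near L, good K.
Proof.
move=> [g1 gJ].
have h1 : \forall K \near L, 0 < \det (1%:M + K).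
  exact: (cvgr_gt _ (C1_cvg (C1_det1D L))).
have hJ : \forall K \near L, forall J, 0 < \det (principal_submx K J).
  apply: (@filter_forall V {set 'I_N} (fun J K => 0 < \det (principal_submx K J)) (nbhs L)) => J.
  exact: (cvgr_gt _ (C1_cvg (C1_principal J L)) _ (gJ J)).
by near=> K; split; near: K.
Unshelve. all: by end_near. Qed.

Lemma good_dpp_gt0 L J : good L -> 0 < dpp_pmf L J.
Proof. by move=> [g1 gJ]; rewrite divr_gt0. Qed.

Lemma good_dpp_sum L : good L -> \sum_J dpp_pmf L J = 1.
Proof.
by move=> [g1 _]; rewrite -mulr_suml sum_det_principal divff// gt_eqF.
Qed.

Lemma C1_dpp L J : good L -> C1 (fun K : V => dpp_pmf K J) L.
Proof.
move=> [g1 gJ].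
have -> : (fun K : V => dpp_pmf K J) = (fun K => \det (principal_submx K J) * (\det (1%:M + K))^-1) by [].
apply: C1M; first exact: C1_principal.
by apply: C1V; [rewrite gt_eqF|exact: C1_det1D].
Qed.

Definition score L J H := 'd (fun K : V => ln (dpp_pmf K J)) L H.

Lemma C1_ln_dpp L J : good L -> C1 (fun K : V => ln (dpp_pmf K J)) L.
Proof. by move=> gL; have [] := C1_ln (f := fun K : V => dpp_pmf K J) (good_dpp_gt0 J gL) (C1_dpp J gL). Qed.

Lemma diff_dpp L J H : good L ->
  'd (fun K : V => dpp_pmf K J) L H = dpp_pmf L J * score L J H.
Proof.
move=> gL; have [_ /nbhs_singleton/(_ H)] := C1_ln (f := fun K : V => dpp_pmf K J) (good_dpp_gt0 J gL) (C1_dpp J gL).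
by rewrite -/(score L J H) => ->; rewrite mulVKf// gt_eqF// good_dpp_gt0.
Qed.

Lemma score_linear L J a H K : score L J (a *: H + K) = a * score L J H + score L J K.
Proof. by rewrite /score linearP. Qed.

Lemma diff_sum (I : Type) (r : seq I) (F : I -> V -> R) L H :
  (forall i, differentiable (F i) L) ->
  differentiable (fun K => \sum_(i <- r) F i K) L /\
  'd (fun K => \sum_(i <- r) F i K) L H = \sum_(i <- r) 'd (F i) L H.
Proof.
move=> dF; elim: r => [|i r [IH1 IH2]].
  have -> : (fun K => \sum_(i <- [::]) F i K) = cst 0.
    by apply/funext => K; rewrite big_nil.
  by rewrite big_nil diff_cst; split.
have -> : (fun y => \sum_(j <- i :: r) F j y) = F i + (fun y => \sum_(j <- r) F j y).
  by apply/funext => y; rewrite big_cons.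
by split; [exact: differentiableD|rewrite diffD//= big_cons -IH2].
Qed.

Lemma diff_ddir (f : V -> R) L H : differentiable f L ->
  h^-1 *: (f (h *: H + L) - f L) @[h --> 0^'] --> 'd f L H.
Proof.
by move=> df; rewrite -deriveE//; exact: (diff_derivable (v := H) df).
Qed.

Lemma near_diff_eq (f g : V -> R) L H : differentiable f L -> differentiable g L ->
  (\forall K \near L, f K = g K) -> 'd f L H = 'd g L H.
Proof. by move=> df dg fg; rewrite -!deriveE//; exact: near_eq_derive. Qed.

(** This is the derivative of the constant total mass. It holds at every good matrix, so it can be
    subtracted from the score equation at the estimator. *)
Lemma sum_dpp_score L H : good L -> \sum_J dpp_pmf L J * score L J H = 0.
Proof.
move=> gL; under eq_bigr do rewrite -diff_dpp//.
have dp J : differentiable (fun K : V => dpp_pmf K J) L by exact/C1_diff/C1_dpp.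
have [dS <-] := diff_sum (index_enum _) H dp.
rewrite (@near_diff_eq _ (cst 1))//; last first.
  by apply: filterS (near_good gL) => K; exact: good_dpp_sum.
by rewrite diff_cst.
Qed.

(** The log-likelihood as a function of the weights: empirical frequencies give [loglik], the true
    law gives [expected_loglik]. Randomness enters through q alone. *)
Definition entropy_loglik (q : {set 'I_N} -> R) L := \sum_J q J * ln (dpp_pmf L J).

Lemma diff_entropy q L H : good L -> differentiable (entropy_loglik q) L /\
  'd (entropy_loglik q) L H = \sum_J q J * score L J H.
Proof.
move=> gL; have dl J : differentiable (fun K : V => ln (dpp_pmf K J)) L.
  exact/C1_diff/C1_ln_dpp.
have dql J : differentiable (fun K : V => q J * ln (dpp_pmf K J)) L.
  exact: (differentiableZ (q J) (dl J)).
have [dS dSE] := diff_sum (index_enum _) H dql.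
split=> //; rewrite dSE; apply: eq_bigr => J _.
by rewrite [LHS](_ : _ = 'd (q J *: (fun K : V => ln (dpp_pmf K J))) L H)// diffZ.
Qed.

Lemma expected_loglikE Ls L : good L -> good Ls ->
  expected_loglik Ls L = entropy_loglik (dpp_pmf Ls) L.
Proof.
move=> [g1 gJ] gs; rewrite /expected_loglik /entropy_loglik.
rewrite -[X in _ - X]mul1r -[X in _ - X * _](good_dpp_sum gs) mulr_suml -sumrB.
by apply: eq_bigr => J _; rewrite ln_div ?posrE// mulrBr.
Qed.

Lemma score_cvg L J H : good L -> score K J H @[K --> L] --> score L J H.
Proof. by move=> gL; have [_ /(_ H)] := C1_ln_dpp J gL. Qed.

(** By [sum_dpp_score] at K, the first derivative at K is [psi], in which the factors p_J(K) -
    p_J(Ls) vanish at [Ls]. Differentiating again thus needs a derivative of p_J but only the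
    continuity of the score. *)
Lemma second_diff_expected Ls H H' : good Ls ->
  second_diff (expected_loglik Ls) Ls H H' =
  - \sum_J dpp_pmf Ls J * (score Ls J H * score Ls J H').
Proof.
move=> gs; rewrite /second_diff.
pose psi (K : V) := - \sum_J (dpp_pmf K J - dpp_pmf Ls J) * score K J H.
have near_psi : \forall K \near Ls, 'D_H (expected_loglik Ls) K = psi K.
  have ngs := near_good gs; near=> K.
  have gK : good K by near: K.
  have [de dE] := diff_entropy (dpp_pmf Ls) H gK.
  have nE : \forall K' \near K, expected_loglik Ls K' = entropy_loglik (dpp_pmf Ls) K'.
    by apply: filterS (near_good gK) => K' gK'; exact: expected_loglikE.
  rewrite (near_eq_derive H nE) deriveE// dE /psi.
  under [in RHS]eq_bigr do rewrite mulrBl.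
  by rewrite sumrB (sum_dpp_score H gK) sub0r opprK.
rewrite (near_eq_derive H' near_psi); apply/cvg_lim => //.
have psi0 : psi Ls = 0.
  by rewrite /psi big1 ?oppr0// => J _; rewrite subrr mul0r.
rewrite psi0.
have -> : (fun h => h^-1 *: ((psi \o shift Ls) (h *: H') - 0)) =
    fun h => - \sum_J (h^-1 *: (dpp_pmf (h *: H' + Ls) J - dpp_pmf Ls J)) *
       score (h *: H' + Ls) J H.
  apply/funext => h; rewrite subr0 /psi/= scalerN scaler_sumr; congr (- _).
  by apply: eq_bigr => J _; rewrite scalerAl.
have lim0 : h *: H' + Ls @[h --> (0:R)^'] --> Ls.
  have -> : nbhs Ls = nbhs (0 *: H' + Ls) by rewrite scale0r add0r.
  apply: cvgD; last exact: cvg_cst.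
  by apply: cvgZl; apply: cvg_within_filter; exact: cvg_id.
apply: cvgN; apply: cvgr_bigsum => J; rewrite mulrA mulrAC; apply: cvgM.
  rewrite -diff_dpp//; apply: diff_ddir.
  exact/C1_diff/C1_dpp.
exact: (@cvg_comp _ _ _ (fun h => h *: H' + Ls) (fun K => score K J H) _ _ _ lim0
  (score_cvg (J := J) (H := H) gs)).
Unshelve. all: by end_near. Qed.

(** If the scores vanish, the derivative of the J-th minor is p_J times that of det(I + L). The
    empty minor is constant, so the latter is zero and all minors are stationary. *)
Lemma score_injective Ls H : Ls \in posdefmx -> irreducible_mx Ls -> H^T = H ->
  (forall J, score Ls J H = 0) -> H = 0.
Proof.
move=> pL iL sH s0; have [sL _] := (posdefP Ls).1 pL.
have gL := posdef_good pL; have [g1 gJ] := gL.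
apply: (quadratic_score_injective sL sH (irreducible_connected pL iL)) => J c1 c2 hq.
pose dJ J (K : V) := \det (principal_submx K J); pose dI (K : V) := \det (1%:M + K).
have ddJ J' : differentiable (dJ J') Ls by exact/C1_diff/C1_principal.
have ddI : differentiable dI Ls by exact/C1_diff/C1_det1D.
have ddp J' : differentiable (fun K : V => dpp_pmf K J') Ls by exact/C1_diff/C1_dpp.
have dE J' : 'd (dJ J') Ls H = dpp_pmf Ls J' * 'd dI Ls H.
  have [dpI dM] := diff_mul H (ddp J') ddI.
  have nE : \forall K \near Ls, dJ J' K = dpp_pmf K J' * dI K.
    apply: filterS (near_good gL) => K [gK _].
    by rewrite /dJ /dI /dpp_pmf divfK// gt_eqF.
  apply: (eq_trans (near_diff_eq H (ddJ J') dpI nE)); rewrite dM.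
  by rewrite (diff_dpp _ _ gL) s0 !mulr0 addr0.
have dI0 : 'd dI Ls H = 0.
  have := dE finset.set0.
  have -> : dJ finset.set0 = cst 1 by apply/funext => K; rewrite /dJ principal_set0.
  rewrite diff_cst => /esym/eqP; rewrite mulf_eq0 (gt_eqF (good_dpp_gt0 _ gL))/=.
  by move/eqP.
have lim0 := diff_ddir (ddJ J) (H := H); rewrite dE dI0 mulr0 in lim0.
have lim1 : h^-1 *: (dJ J (h *: H + Ls) - dJ J Ls) @[h --> (0 : R)^'] --> c1 + 0 * c2.
  apply: (@cvg_trans _ ((fun h : R => c1 + h * c2) @ 0^')).
    apply: near_eq_cvg; near=> h.
    have h0 : h != 0 by near: h; exact: nbhs_dnbhs_neq.
    rewrite /dJ [h *: H + Ls]addrC hq [LHS](_ : _ = h^-1 * (\det (principal_submx Ls J) + h * c1 + h ^+ 2 * c2 - \det (principal_submx Ls J)))//.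
    by field.
  apply: cvgD; first exact: cvg_cst.
  by apply: cvgM; [apply: cvg_within_filter; exact: cvg_id|exact: cvg_cst].
have := cvg_unique _ lim0 lim1.
by rewrite mul0r addr0 => <-.
Unshelve. all: by end_near. Qed.

End DetC1.

(** * Positive definite matrices: compactness and perturbation *)

Section MatrixTopology.
Variable (R : realType).

Lemma ler_sum_entries m n (F : 'I_m -> 'I_n -> R) i j :
  (forall i j, 0 <= F i j) -> F i j <= \sum_i \sum_j F i j.
Proof.
move=> F0; rewrite (bigD1 i)//= (bigD1 j)//= -addrA lerDl addr_ge0//.
  by apply: sumr_ge0.
by apply: sumr_ge0 => k _; apply: sumr_ge0.
Qed.

Lemma mx_norm_leP m n (A : 'M[R]_(m, n)) e : 0 <= e ->
  `|A| <= e <-> forall i j, `|A i j| <= e.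
Proof.
move=> e0; rewrite [`|A|](_ : _ = mx_norm A)// mx_normrE; split.
  by move=> /bigmax_leP[_ h] i j; exact: (h (i, j)).
by move=> h; apply/bigmax_leP; split => // -[i j] _; exact: h.
Qed.

Lemma mx_entry_le m n (A : 'M[R]_(m, n)) i j : `|A i j| <= `|A|.
Proof. by move: i j; apply/mx_norm_leP. Qed.

Lemma vec_mx_continuous m n : continuous (@vec_mx R m n).
Proof.
move=> v; apply/(@cvgrPdist_le _ _ _ (nbhs v)) => e e0.
have : \forall u \near v, `|v - u| <= e by apply: filterS (nbhsx_ballx v e e0) => u; rewrite -ball_normE => /ltW.
apply: filterS => u vu; apply/mx_norm_leP; first exact: ltW.
move=> i j; rewrite -linearB mxE.
exact: le_trans (mx_entry_le _ _ _) vu.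
Qed.

(** Compactness of closed bounded sets is transported from row vectors through [vec_mx]. *)
Lemma compact_mx m n (A : set 'M[R]_(m, n)) C : closed A ->
  (forall L, A L -> forall i j, `|L i j| <= C) -> compact A.
Proof.
move=> cA bA; have -> : A = @vec_mx R m n @` (@vec_mx R m n @^-1` A).
  apply/seteqP; split=> [L AL|L [v Av <-]]//.
  by exists (mxvec L); rewrite ?mxvecK//= mxvecK.
apply: continuous_compact.
  by apply: continuous_subspaceT; exact: vec_mx_continuous.
apply: bounded_closed_compact; last first.
  by apply: preimage_closed => // v _; exact: vec_mx_continuous.
exists `|C|; split; first exact: num_real.
move=> M /ltW CM v Av /=.
apply/mx_norm_leP => [|i j]; first exact: le_trans CM.
rewrite ord1; case/mxvec_indexP: j => a b; rewrite -(vec_mxK v) mxvecE.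
by apply: le_trans (bA _ Av a b) (le_trans (ler_norm _) CM).
Qed.

Lemma closed_ge_fun (T : topologicalType) (f : T -> R) c : continuous f ->
  closed [set x | c <= f x].
Proof.
move=> cf; apply: (@preimage_closed _ _ f [set y | c <= y]) => [x _|]; first exact: cf.
exact: closed_ge.
Qed.

Lemma closed_forall (T : topologicalType) (I : Type) (F : I -> set T) :
  (forall i, closed (F i)) -> closed [set x | forall i, F i x].
Proof.
move=> cF; rewrite (_ : [set _ | _] = \bigcap_i F i); first exact: closed_bigI.
by apply/seteqP; split=> x h i; [move=> _; exact: h|exact: h].
Qed.

End MatrixTopology.

(** * A compact region of positive definite matrices, and the score equation *)

Section PSD.
Variables (R : realType) (N : nat).
Notation V := 'M[R]_N.
Implicit Types (L H : V) (x y : 'cV[R]_N).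

Lemma qform_add L x y t : qform L (x + t *: y) (x + t *: y) =
  qform L x x + t * (qform L x y + qform L y x) + t ^+ 2 * qform L y y.
Proof.
have -> : qform L (x + t *: y) (x + t *: y) = ((x^T + t *: y^T) *m L *m (x + t *: y)) 0 0.
  by rewrite /qform; congr ((_ *m _ *m _) _ _); rewrite linearD linearZ.
rewrite /qform !mulmxDl !mulmxDr -!scalemxAr -!scalemxAl.
move: (x^T *m L *m x) (x^T *m L *m y) (y^T *m L *m x) (y^T *m L *m y) => A B C D.
by rewrite !mxE; ring.
Qed.

Lemma qform_delta L i j : qform L (delta_mx i 0) (delta_mx j 0) = L i j.
Proof.
by rewrite /qform trmx_delta -rowE -colE !mxE.
Qed.

Lemma psd_kernel L x : L^T = L -> (forall y, 0 <= qform L y y) ->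
  qform L x x = 0 -> x^T *m L = 0.
Proof.
move=> sL pL x0; suff q0 y : qform L x y = 0.
  apply/rowP => j; have := q0 (delta_mx j 0).
  by rewrite /qform -colE mxE => ->; rewrite mxE.
(* This is nearly the minimizing multiple of y; the added 1 keeps the denominator positive even if
   the form vanishes at y. *)
have := pL (x + (- qform L x y / (qform L y y + 1)) *: y).
rewrite qform_add x0 add0r (qformC y x sL); have := pL y.
set a := qform L y y; set b := qform L x y => a0.
have a1 : 0 < a + 1 by rewrite ltr_wpDl.
have -> : - b / (a + 1) * (b + b) + (- b / (a + 1)) ^+ 2 * a =
    - (b ^+ 2 * ((a + 2) / (a + 1) ^+ 2)).
  by field; rewrite gt_eqF.
rewrite oppr_ge0 => h; apply/eqP; rewrite -sqrf_eq0; apply/eqP/le_anti.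
rewrite sqr_ge0 andbT; move: h; rewrite pmulr_lle0// divr_gt0 ?exprn_gt0//.
by rewrite ltr_wpDl.
Qed.

(** A compact subset of the positive definite cone: semidefiniteness is a closed condition, and the
    lower bound on the determinant restores definiteness. *)
Definition spd_region (c : R) : set V := [set L | [/\ L^T = L,
  forall x, 0 <= qform L x x, forall i j, `|L i j| <= c^-1 & c <= \det L]].

Lemma spd_region_posdef c L : 0 < c -> spd_region c L -> L \in posdefmx.
Proof.
move=> c0 [sL pL _ dL]; apply/posdefP; split=> // x x0.
rewrite lt_neqAle pL andbT eq_sym; apply/negP => /eqP/(psd_kernel sL pL) xL.
have /det0P d0 : exists2 v : 'rV[R]_N, v != 0 & v *m L = 0.
  by exists x^T => //; rewrite trmx_eq0.
by move: dL; rewrite (eqP d0) leNgt c0.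
Qed.

Lemma cont_C1 (f : V -> R) : (forall L, C1 f L) -> continuous f.
Proof. by move=> Cf L; exact: C1_cvg. Qed.

Lemma C1_det L : C1 (fun K : V => \det K) L.
Proof.
have -> : (fun K : V => \det K) = fun K : V => \det (\matrix_(i, j) K i j).
  by apply/funext => K; congr (\det _); apply/matrixP => i j; rewrite mxE.
by apply: C1_det_affine => i j; exact: C1_coord.
Qed.

Lemma C1_qform x L : C1 (fun K : V => qform K x x) L.
Proof.
have -> : (fun K : V => qform K x x) = fun K : V =>
    \sum_i \sum_j cst (x i 0 * x j 0) K * K i j.
  apply/funext => K; rewrite qformE; apply: eq_bigr => i _.
  by apply: eq_bigr => j _ /=; rewrite mulrAC.
apply: C1_sum => i; apply: C1_sum => j.
by apply: C1M; [exact: C1_cst|exact: C1_coord].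
Qed.

Lemma closed_spd_region c : closed (spd_region c).
Proof.
have -> : spd_region c =
   [set L : V | forall i j, 0 <= L i j - L j i] `&`
   ([set L : V | forall x, 0 <= qform L x x] `&`
   ([set L : V | forall i j, - c^-1 <= L i j] `&`
   ([set L : V | forall i j, - c^-1 <= - L i j] `&` [set L : V | c <= \det L]))).
  apply/seteqP; split=> [L [sL pL bL dL]|L [/= sL [pL [bL [bL' dL]]]]].
    split; [|split; [|split; [|split]]] => //= i j.
    - by rewrite -[in X in _ - X]sL mxE subrr.
    - by have := bL i j; rewrite ler_norml => /andP[].
    - by have := bL i j; rewrite ler_norml lerN2 => /andP[].
  split=> //.
  - apply/matrixP => i j; rewrite mxE; apply/le_anti.
    by rewrite -subr_ge0 sL -subr_ge0 sL.
  - by move=> i j; rewrite ler_norml bL -lerN2 bL'.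
have cc i j : continuous (fun L : V => L i j) by exact: coord_cont.
apply: closedI; [|apply: closedI; [|apply: closedI; [|apply: closedI]]].
- apply: closed_forall => i; apply: closed_forall => j; apply: closed_ge_fun.
  by move=> L; exact: (cvgB (cc i j L) (cc j i L)).
- apply: closed_forall => x; apply: closed_ge_fun; apply: cont_C1 => L.
  exact: C1_qform.
- by apply: closed_forall => i; apply: closed_forall => j; exact: closed_ge_fun.
- apply: closed_forall => i; apply: closed_forall => j; apply: closed_ge_fun.
  by move=> L; exact: (cvgN (cc i j L)).
- by apply: closed_ge_fun; apply: cont_C1 => L; exact: C1_det.
Qed.

Lemma compact_spd_region c (A : set V) : closed A -> compact (spd_region c `&` A).
Proof.
move=> cA; apply: (@compact_mx _ _ _ _ c^-1).
  by apply: closedI => //; exact: closed_spd_region.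
by move=> L [[_ _ h _] _].
Qed.

(** A diagonal entry is the probability of a singleton divided by that of the empty set, hence at
    most 1 / c; the form at sums and differences of basis vectors bounds the other entries. The
    determinant is at least the probability of the full set, since the empty set has probability at
    most 1. *)
Lemma posdef_spd_region c L : L \in posdefmx -> 0 < c ->
  (forall J, c <= dpp_pmf L J) -> spd_region c L.
Proof.
move=> pL c0 cL; have [sL qL] := (posdefP L).1 pL.
have q0 x : 0 <= qform L x x.
  have [->|/qL/ltW//] := eqVneq x 0.
  by rewrite /qform mulmx0 mxE.
have dE J : \det (principal_submx L J) = dpp_pmf L J / dpp_pmf L finset.set0.
  by apply: principal_dpp; rewrite gt_eqF// det1D_gt0.
have p0 := dpp_gt0 finset.set0 pL.
have dg i : L i i <= c^-1.
  have := dE [set (fun _ : 'I_1 => i) k | k in 'I_1]%SET.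
  rewrite det_principal_image ?det_mx11 ?mxE; last by move=> k l; rewrite !ord1.
  move=> ->; rewrite -[c^-1]mul1r; apply: ler_pM.
  - exact/ltW/dpp_gt0.
  - by rewrite invr_ge0 ltW.
  - exact: dpp_le1.
  - by rewrite lef_pV2 ?posrE.
split=> //.
- move=> i j; have hp s : 0 <= L i i + s * (L i j + L j i) + s ^+ 2 * L j j.
    have := q0 (delta_mx i 0 + s *: delta_mx j 0).
    by rewrite qform_add !qform_delta.
  have sij : L j i = L i j by rewrite -[in LHS]sL mxE.
  have := hp 1; have := hp (-1); rewrite sij => h1 h2.
  have := dg i; have := dg j => d1 d2.
  by rewrite ler_norml; apply/andP; split; lra.
- rewrite -principal_setT dE; apply: le_trans (cL [set: 'I_N]%SET) _.
  rewrite ler_peMr ?(ltW (dpp_gt0 _ pL))// invf_ge1//.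
  exact: dpp_le1.
Qed.

(* Cauchy-Schwarz for the form L gives x_i ^ 2 <= (L^-1)_ii * x^T L x, so that a
   small multiple of H is dominated by L. *)
Lemma posdef_perturb L H : L \in posdefmx -> H^T = H ->
  exists2 r, 0 < r & forall s, `|s| < r -> L + s *: H \in posdefmx.
Proof.
move=> pL sH; have [sL qL] := (posdefP L).1 pL.
have Lu : L \in unitmx by rewrite unitmxE unitfE posdef_unit.
(* The constant has to be independent of i; it dominates each diagonal entry a of the inverse
   because a <= 1 + a ^ 2. *)
have cs (x : 'cV[R]_N) (i : 'I_N) :
    x i 0 ^+ 2 <= (1 + \sum_k (invmx L k k) ^+ 2) * qform L x x.
  pose u : 'cV[R]_N := invmx L *m delta_mx i 0.
  have Lue : L *m u = delta_mx i 0 by rewrite mulmxA mulmxV// mul1mx.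
  have qxu : qform L x u = x i 0.
    by rewrite /qform -mulmxA Lue -colE !mxE.
  have quu : qform L u u = invmx L i i.
    rewrite /qform -mulmxA Lue -colE mxE mxE /u -colE mxE//.
  have a0 : 0 < invmx L i i.
    rewrite -quu qL//; apply/negP => /eqP u0; move: Lue; rewrite u0 mulmx0.
    move/colP/(_ i); rewrite !mxE !eqxx => /eqP; rewrite eq_sym oner_eq0//.
  have q0 y : 0 <= qform L y y.
    have [->|/qL/ltW//] := eqVneq y 0.
    by rewrite /qform mulmx0 mxE.
  have := q0 (x + (- x i 0 / invmx L i i) *: u).
  rewrite qform_add (qformC u x sL) qxu quu.
  set a := invmx L i i in a0 *; set b := x i 0; set Q := qform L x x.
  have -> : Q + - b / a * (b + b) + (- b / a) ^+ 2 * a = Q - b ^+ 2 / a by field; rewrite gt_eqF.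
  rewrite subr_ge0 ler_pdivrMr// => h; apply: (le_trans h).
  rewrite [leLHS]mulrC ler_wpM2r ?q0//.
  rewrite (bigD1 i)//= -/a; have : 0 <= \sum_(k | k != i) (invmx L k k) ^+ 2.
    by apply: sumr_ge0 => k _; exact: sqr_ge0.
  by have := sqr_ge0 (a - 1); nra.
set c := 1 + _ in cs.
have c0 : 0 < c by rewrite ltr_pwDl// sumr_ge0// => k _; exact: sqr_ge0.
pose h := 1 + \sum_i \sum_j `|H i j|.
have h0 : 0 < h by rewrite ltr_pwDl// sumr_ge0// => i _; rewrite sumr_ge0.
exists (c * h)^-1; first by rewrite invr_gt0 mulr_gt0.
move=> s sr; apply/posdefP; split.
  by rewrite linearD linearZ/= sL sH.
move=> x x0; have Q0 := qL x x0.
have -> : qform (L + s *: H) x x = qform L x x + s * qform H x x.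
  by have := qform_lin 1 s L H x; rewrite scale1r mul1r.
have bH : `|qform H x x| <= (h - 1) * (c * qform L x x).
  rewrite qformE; apply: le_trans (ler_norm_sum _ _ _) _.
  rewrite addrAC subrr add0r mulr_suml; apply: ler_sum => i _.
  apply: le_trans (ler_norm_sum _ _ _) _.
  rewrite mulr_suml; apply: ler_sum => j _.
  rewrite !normrM mulrAC [_ * `|H i j|]mulrC ler_wpM2l//.
  have := cs x i; have := cs x j; rewrite -![x _ 0 ^+ 2]real_normK ?num_real//.
  set A := `|x i 0|; set B := `|x j 0| => h1 h2.
  by have := sqr_ge0 (A - B); nra.
have : `|s| * `|qform H x x| < qform L x x.
  apply: (@le_lt_trans _ _ (`|s| * ((h - 1) * (c * qform L x x)))).
    by rewrite ler_wpM2l.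
  have sh : `|s| * (c * h) < 1 by rewrite -ltr_pdivlMr ?mulr_gt0// div1r.
  have -> : `|s| * ((h - 1) * (c * qform L x x)) = (`|s| * (c * h) - `|s| * c) * qform L x x by ring.
  rewrite -[ltRHS]mul1r ltr_pM2r//.
  by apply: le_lt_trans sh; rewrite gerBl mulr_ge0// ltW.
rewrite -normrM => hs; have := ler_norm (- (s * qform H x x)); rewrite normrN.
by move=> hn; rewrite -subr_gt0 in hs; clear -hs hn; lra.
Qed.

(** Symmetric directions keep [L + s *: H] in the cone for small s, so the likelihood along them has
    an interior maximum at s = 0. *)
Lemma max_score (q : {set 'I_N} -> R) L H :
  maximizer_on posdefmx (entropy_loglik q) L -> H^T = H ->
  \sum_J q J * score L J H = 0.
Proof.
move=> [pL mL] sH; have [r r0 hr] := posdef_perturb pL sH.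
have [dL <-] := diff_entropy q H (posdef_good pL).
pose f (s : R) := entropy_loglik q (L + s *: H).
have fd s : `|s| < r -> differentiable (entropy_loglik q) (L + s *: H).
  by move=> sr; have [] := diff_entropy q H (posdef_good (hr s sr)).
have fD s : `|s| < r -> is_derive s (1 : R) f ('d (entropy_loglik q) (L + s *: H) H).
  move=> sr; have df := fd s sr.
  have dg : is_derive (L + s *: H) H (entropy_loglik q) ('d (entropy_loglik q) (L + s *: H) H).
    apply: DeriveDef; first exact: diff_derivable.
    by rewrite deriveE.
  have E : (fun h : R => h^-1 *: ((f \o shift s) (h *: (1 : R)) - f s)) =
      (fun h : R => h^-1 *: ((entropy_loglik q \o shift (L + s *: H)) (h *: H) - entropy_loglik q (L + s *: H))).
    apply/funext => h; congr (_ *: (_ - _)); rewrite /f /= [h *: 1]mulr1.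
    by congr entropy_loglik; rewrite scalerDl addrCA.
  case: dg => dg1 dg2; apply: DeriveDef.
    by rewrite /derivable E.
  by rewrite /derive E.
have fmax : is_derive (0 : R) (1 : R) f 0.
  apply: (@derive1_at_max _ f (- r) r).
  - by rewrite lerNl (le_trans _ (ltW r0))// oppr_le0 ltW.
  - move=> t; rewrite in_itv/= -ltr_norml => tr.
    by have [] := fD t tr.
  - by rewrite in_itv/= r0 oppr_lt0 r0.
  - move=> t; rewrite in_itv/= -ltr_norml => tr.
    by rewrite /f scale0r addr0; apply: mL; exact: hr.
have [_] := fD 0 (ltac:(by rewrite normr0)).
by case: fmax => _ ->; rewrite scale0r addr0.
Qed.

End PSD.

(** * Consistency of the maximum likelihood estimator *)

Section Consistency.
Variables (R : realType) (N : nat).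
Notation V := 'M[R]_N.
Variables (Ls : V) (pL : Ls \in posdefmx) (iL : irreducible_mx Ls).
Implicit Types (L H K : V) (J : {set 'I_N}).

Lemma ln_le_sub1 (x : R) : 0 < x -> ln x <= x - 1.
Proof.
by move=> x0; rewrite lerBrDl -{2}(lnK x0) expR_ge1Dx.
Qed.

Lemma ln_eq_sub1 (x : R) : 0 < x -> ln x = x - 1 -> x = 1.
Proof.
move=> x0 e; apply/eqP/negPn/negP => x1.
have lx : ln x != 0 by rewrite ln_eq0.
by have := expR_gt1Dx lx; rewrite lnK// e addrC subrK ltxx.
Qed.

(** The terms p_J (r_J - 1 - ln r_J) are nonnegative and sum to the gap because both laws have mass
    1. The equality case is what feeds identifiability. *)
Lemma entropy_max L : L \in posdefmx ->
  entropy_loglik (dpp_pmf Ls) L <= entropy_loglik (dpp_pmf Ls) Ls /\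
  (entropy_loglik (dpp_pmf Ls) L = entropy_loglik (dpp_pmf Ls) Ls ->
   forall J, dpp_pmf L J = dpp_pmf Ls J).
Proof.
move=> pK; pose r J := dpp_pmf L J / dpp_pmf Ls J.
have r0 J : 0 < r J by rewrite divr_gt0 ?dpp_gt0.
pose t J := dpp_pmf Ls J * (r J - 1 - ln (r J)).
have t0 J : 0 <= t J.
  by rewrite mulr_ge0 ?(ltW (dpp_gt0 _ _))// subr_ge0 ln_le_sub1.
have sE : \sum_J t J = entropy_loglik (dpp_pmf Ls) Ls - entropy_loglik (dpp_pmf Ls) L.
  rewrite /entropy_loglik -sumrB.
  have -> : \sum_J t J = \sum_J (dpp_pmf L J - dpp_pmf Ls J) +
     \sum_J (dpp_pmf Ls J * ln (dpp_pmf Ls J) - dpp_pmf Ls J * ln (dpp_pmf L J)).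
    rewrite -big_split/=; apply: eq_bigr => J _.
    rewrite /t /r ln_div ?posrE ?dpp_gt0//; field.
    by rewrite gt_eqF// dpp_gt0.
  by rewrite [X in X + _]sumrB !dpp_sum// subrr add0r.
split; first by rewrite -subr_ge0 -sE sumr_ge0.
move=> e J; move: sE; rewrite e subrr => /eqP; rewrite psumr_eq0// => /allP h.
have := h J (mem_index_enum _); rewrite /= mulf_eq0 gt_eqF ?dpp_gt0//= subr_eq0 => /eqP/esym.
move/(ln_eq_sub1 (r0 J)) => rJ.
by rewrite -[LHS](divfK (lt0r_neq0 (dpp_gt0 J pL))) -/(r J) rJ mul1r.
Qed.

Lemma entropy_continuous q L : L \in posdefmx ->
  {for L, continuous (entropy_loglik q)}.
Proof.
move=> pK; have [d _] := diff_entropy q (0 : V) (posdef_good pK).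
exact: differentiable_continuous.
Qed.

Lemma dpp_eq_conj L : L \in posdefmx -> (forall J, dpp_pmf L J = dpp_pmf Ls J) ->
  exists2 D, D \in signmx & Ls = D *m L *m D.
Proof.
move=> pK e; have [sL _] := (posdefP _).1 pL; have [sK _] := (posdefP _).1 pK.
apply: principal_minors_identify => // [|J]; first exact: irreducible_connected.
by rewrite !principal_dpp ?gt_eqF ?det1D_gt0// !e.
Qed.

Lemma frobenius_continuous (e : 'I_N -> bool) :
  continuous (fun L : V => frobenius_norm (sgnmx R e *m L *m sgnmx R e - Ls)).
Proof.
move=> L; apply: (@cvg_comp _ _ _ _ (@Num.sqrt R)); last exact: sqrt_continuous.
pose G (x : V) := \sum_i \sum_j
     (cst ((-1) ^+ (e i (+) e j)) x * x i j + cst (- Ls i j) x) *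
     (cst ((-1) ^+ (e i (+) e j)) x * x i j + cst (- Ls i j) x).
have E (x : V) : \sum_i \sum_j (sgnmx R e *m x *m sgnmx R e - Ls) i j ^+ 2 = G x.
  apply: eq_bigr => i _; apply: eq_bigr => j _ /=.
  by rewrite -expr2 -sgnmx_conjE [X in X ^+ 2]mxE [X in _ + X]mxE.
suff GL : G x @[x --> L] --> G L.
  by rewrite E (_ : (fun x => _) = G); [exact: GL|exact/funext/E].
apply: C1_cvg; apply: C1_sum => i; apply: C1_sum => j.
have C : C1 (fun x : V => cst ((-1) ^+ (e i (+) e j)) x * x i j + cst (- Ls i j) x) L.
  apply: C1D; last exact: C1_cst.
  by apply: C1M; [exact: C1_cst|exact: C1_coord].
exact: C1M.
Qed.

(** All terms q_K ln p_K are nonpositive, so each single one is at least the whole sum. *)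
Lemma entropy_bound q L J c C : L \in posdefmx -> (forall J, 0 <= q J <= 1) ->
  0 < c -> c <= q J -> - C <= entropy_loglik q L -> expR (- C / c) <= dpp_pmf L J.
Proof.
move=> pK q01 c0 cq CL; rewrite -[leRHS]lnK ?posrE ?dpp_gt0// ler_expR.
have lp (K : {set 'I_N}) : ln (dpp_pmf L K) <= 0 by rewrite ln_le0// dpp_le1.
rewrite ler_pdivrMr//; apply: (le_trans CL).
rewrite /entropy_loglik (bigD1 J)//= (le_trans (y := q J * ln (dpp_pmf L J)))//.
  rewrite gerDl; apply: sumr_le0 => K _.
  by rewrite mulr_ge0_le0//; have /andP[] := q01 K.
by rewrite mulrC ler_wnM2l.
Qed.

Lemma mle_consistent (eps : R) : 0 < eps ->
  exists2 del, 0 < del & forall q : {set 'I_N} -> R,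
    (forall J, 0 <= q J <= 1) -> (forall J, `|q J - dpp_pmf Ls J| <= del) ->
    (exists L, maximizer_on posdefmx (entropy_loglik q) L) /\
    forall L, maximizer_on posdefmx (entropy_loglik q) L ->
      exists2 D, D \in signmx & frobenius_norm (D *m L *m D - Ls) < eps.
Proof.
move=> e0; pose p := dpp_pmf Ls.
have p0 J : 0 < p J by exact: dpp_gt0.
have [m m0 mp] : exists2 m, 0 < m & forall J, m <= p J.
  exists (\big[Order.min/1]_J p J).
    by apply: lt_bigmin => // J _.
  by move=> J; exact: bigmin_le_cond.
pose C := \sum_J - ln (p J).
have lp0 J : 0 <= - ln (p J) by rewrite oppr_ge0 ln_le0// dpp_le1.
have C0 : 0 <= C by apply: sumr_ge0.
(* Weights within m / 2 of p stay above m / 2, and the likelihood of [Ls] is at least - C;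
   [entropy_bound] turns this into the lower bound c on probabilities. *)
pose c := expR (- C / (m / 2)).
have m20 : 0 < m / 2 by rewrite divr_gt0.
have c0 : 0 < c by exact: expR_gt0.
(* Candidate maximizers dominate the true parameter, hence lie in a compact region. *)
have CL q : (forall J, 0 <= q J <= 1) -> - C <= entropy_loglik q Ls.
  move=> q01; rewrite /C -sumrN /entropy_loglik; apply: ler_sum => J _.
  have /andP[q0 q1] := q01 J; rewrite opprK -[leLHS]mul1r.
  by rewrite ler_wnM2r// -oppr_ge0.
have reg q L : (forall J, 0 <= q J <= 1) -> (forall J, `|q J - p J| <= m / 2) ->
    L \in posdefmx -> entropy_loglik q Ls <= entropy_loglik q L ->
    forall J, c <= dpp_pmf L J.
  move=> q01 qp pK qL J; apply: (@entropy_bound q) => //.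
    have := qp J; rewrite ler_distl => /andP[h _]; apply: le_trans h.
    by have := mp J; lra.
  exact: le_trans (CL q q01) qL.
have regL : spd_region c Ls.
  apply: posdef_spd_region => //; apply: (reg p) => // J.
    by rewrite ltW//= dpp_le1.
  by rewrite subrr normr0 ltW.
have cont_reg (A : set V) (q : {set 'I_N} -> R) : A `<=` spd_region c -> {within A, continuous (entropy_loglik q)}.
  move=> AK; apply: continuous_in_subspaceT => L /set_mem/AK/(spd_region_posdef c0).
  exact: entropy_continuous.
pose far := [set L : V | forall e : 'I_N -> bool,
  eps <= frobenius_norm (sgnmx R e *m L *m sgnmx R e - Ls)].
have cfar : closed far.
  apply: closed_forall => e; apply: closed_ge_fun; exact: frobenius_continuous.
(* The maximum over this compact set is attained, and there equality with the value at [Ls] would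
   produce a conjugate equal to [Ls]. *)
have [eta eta0 gap] : exists2 eta, 0 < eta & forall L, (spd_region c `&` far) L ->
    entropy_loglik p L <= entropy_loglik p Ls - eta.
  have [->|/set0P ne] := eqVneq (spd_region c `&` far) set0; first by exists 1.
  have [M /set_mem[KM farM] Mmax] := compact_EVT_max ne (compact_spd_region cfar)
    (cont_reg _ p (@subIsetl _ _ _)).
  exists (entropy_loglik p Ls - entropy_loglik p M); last first.
    by move=> L LK; rewrite opprB addrC subrK; apply: Mmax; apply/mem_set.
  have pM := spd_region_posdef c0 KM; have [le_ eq_] := entropy_max pM.
  rewrite subr_gt0 lt_neqAle le_ andbT; apply/negP => /eqP/eq_ hM.
  have [D /sgnmxP[e ->] DM] := dpp_eq_conj pM hM.
  have := farM e; rewrite -DM subrr /frobenius_norm big1.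
    by rewrite sqrtr0 leNgt e0.
  by move=> i _; rewrite big1// => j _; rewrite mxE expr0n.
(* On the region, ln p_J(L) differs from ln p_J(Ls) by at most the J-th term; the final 1 makes B
   positive. *)
pose B := \sum_J (C / (m / 2) + - ln (p J)) + 1.
have B0 : 0 < B.
  rewrite ltr_wpDl// sumr_ge0// => J _; rewrite addr_ge0// divr_ge0// ltW//.
(* The second bound lets passing from p to q change likelihood differences by at most eta / 2, half
   of the gap. *)
exists (Num.min (m / 2) (eta / B / 2)).
  by rewrite lt_min m20 !divr_gt0.
move=> q q01 hq.
have qm J : `|q J - p J| <= m / 2.
  by apply: le_trans (hq J) _; rewrite ge_min lexx.
have qB J : `|q J - p J| <= eta / B / 2.
  by apply: le_trans (hq J) _; rewrite ge_min lexx orbT.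
split.
  (* A maximizer over the region is global: positive definite matrices outside it have a likelihood
     below that of [Ls]. *)
  have [M /set_mem KM Mmax] := compact_EVT_max (ex_intro _ _ regL)
    (ltac:(by rewrite -[X in compact X]setIT; exact: compact_spd_region closedT))
    (cont_reg _ q (@subset_refl _ _)).
  exists M; split; first exact: spd_region_posdef KM.
  move=> K pK; have [h|/ltW h] := leP (entropy_loglik q Ls) (entropy_loglik q K); last first.
    by apply: le_trans h _; apply: Mmax; exact/mem_set.
  by apply: Mmax; apply/mem_set/posdef_spd_region => // J; exact: (reg q).
move=> L [pK Lmax]; have qL := Lmax _ pL.
have cK := reg q L q01 qm pK qL.
have KL := posdef_spd_region pK c0 cK.
apply: contrapT => nD.
have farL : far L.
  move=> e; rewrite leNgt; apply/negP => h; apply: nD; exists (sgnmx R e) => //.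
  by apply/sgnmxP; exists e.
have hgap := gap L (conj KL farL).
have : `|\sum_J (q J - p J) * (ln (dpp_pmf L J) - ln (p J))| <= eta / B / 2 * B.
  apply: le_trans (ler_norm_sum _ _ _) _.
  apply: (@le_trans _ _ (\sum_J eta / B / 2 * (C / (m / 2) + - ln (p J)))).
    apply: ler_sum => J _; rewrite normrM ler_pM//.
    have h1 : - (C / (m / 2)) <= ln (dpp_pmf L J).
      have := cK J; rewrite -ler_ln ?posrE; [|exact: expR_gt0|exact: dpp_gt0].
      by rewrite /c expRK mulNr.
    have h2 : ln (dpp_pmf L J) <= 0 by rewrite ln_le0 ?dpp_le1.
    have h3 := lp0 J.
    by rewrite ler_norml; move: h1 h2 h3; clear; move: (C / (m / 2)) => C' *; apply/andP; split; lra.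
  rewrite -mulr_sumr /B mulrDr mulr1 lerDl; apply: ltW; rewrite !divr_gt0//.
have -> : eta / B / 2 * B = eta / 2 by field; rewrite gt_eqF.
have -> : \sum_J (q J - p J) * (ln (dpp_pmf L J) - ln (p J)) =
   (entropy_loglik q L - entropy_loglik q Ls) -
   (entropy_loglik p L - entropy_loglik p Ls).
  rewrite /entropy_loglik -!sumrB; apply: eq_bigr => J _; ring.
move=> /(le_trans (ler_norm _)) h.
by clear -hgap h qL eta0; lra.
Qed.

End Consistency.

(** * The Fisher operator *)

Section Fisher.
Variables (R : realType) (N : nat).
Notation V := 'M[R]_N.
Variables (Ls : V) (pL : Ls \in posdefmx) (iL : irreducible_mx Ls).
Implicit Types (L H K : V) (J : {set 'I_N}).

Let gL : good Ls := posdef_good pL.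

(** The score also acts on nonsymmetric directions; symmetrizing gives its gradient for the trace
    inner product on symmetric matrices. *)
Definition score_mx J : V :=
  \matrix_(i, j) ((score Ls J (delta_mx i j) + score Ls J (delta_mx j i)) / 2).

Lemma score_mx_sym J : (score_mx J)^T = score_mx J.
Proof. by apply/matrixP => i j; rewrite !mxE addrC. Qed.

Lemma tr_mul_sum (A B : V) : \tr (A *m B) = \sum_i \sum_j A i j * B j i.
Proof. by apply: eq_bigr => i _; rewrite mxE. Qed.

Lemma scoreD J H K : score Ls J (H + K) = score Ls J H + score Ls J K.
Proof. by rewrite /score linearD. Qed.

Lemma scoreZ J a H : score Ls J (a *: H) = a * score Ls J H.
Proof. by rewrite /score linearZ. Qed.

Lemma score_entries J H :
  score Ls J H = \sum_i \sum_j H i j * score Ls J (delta_mx i j).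
Proof.
rewrite {1}[H]matrix_sum_delta /score linear_sum; apply: eq_bigr => i _.
by rewrite linear_sum; apply: eq_bigr => j _; rewrite linearZ.
Qed.

Lemma score_tr J H : H^T = H -> score Ls J H = \tr (score_mx J *m H).
Proof.
move=> sH; have sH' i j : H i j = H j i by rewrite -[in LHS]sH mxE.
have eT : \sum_i \sum_j H i j * score Ls J (delta_mx j i) = score Ls J H.
  rewrite exchange_big/= [RHS]score_entries; apply: eq_bigr => i _.
  by apply: eq_bigr => j _; rewrite sH'.
have -> : score Ls J H = (score Ls J H + score Ls J H) / 2 by field.
rewrite -{1}eT [X in (_ + X) / _]score_entries -big_split/= mulr_suml tr_mul_sum.
apply: eq_bigr => i _; rewrite -big_split/= mulr_suml; apply: eq_bigr => j _.
by rewrite mxE (sH' j i); ring.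
Qed.

Lemma sum_score_mx : \sum_J dpp_pmf Ls J *: score_mx J = 0.
Proof.
apply/matrixP => i j; rewrite summxE mxE.
under eq_bigr do rewrite !mxE mulrA mulrDr mulrDl.
by rewrite big_split/= -!mulr_suml !sum_dpp_score// mul0r addr0.
Qed.

Definition fisher K : V := \sum_J (dpp_pmf Ls J * \tr (score_mx J *m K)) *: score_mx J.

(* The extra skew part makes the operator invertible on all square matrices. *)
Definition fisher_ext K : V := fisher K + (K - K^T).

Lemma fisher_ext_linear : linear fisher_ext.
Proof.
move=> a K H; have fl : fisher (a *: K + H) = a *: fisher K + fisher H.
  rewrite /fisher scaler_sumr -big_split/=; apply: eq_bigr => J _.
  rewrite mulmxDr -scalemxAr mxtraceD mxtraceZ scalerA -scalerDl; congr (_ *: _); ring.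
by rewrite /fisher_ext fl; apply/matrixP => i j; rewrite !mxE; ring.
Qed.

HB.instance Definition _ := GRing.isLinear.Build R V V _ fisher_ext fisher_ext_linear.

Lemma fisher_sym K : (fisher K)^T = fisher K.
Proof.
rewrite /fisher linear_sum/=; apply: eq_bigr => J _.
by rewrite linearZ/= score_mx_sym.
Qed.

Lemma tr_fisher K H : \tr (fisher K *m H) =
  \sum_J dpp_pmf Ls J * (\tr (score_mx J *m K) * \tr (score_mx J *m H)).
Proof.
rewrite mulmx_suml raddf_sum/=; apply: eq_bigr => J _.
by rewrite -scalemxAl mxtraceZ mulrA.
Qed.

(** Since [fisher K] is symmetric, a symmetric value forces the skew part of K to vanish. The
    inverse of [fisher_ext] thus restricts to an inverse of [fisher] on symmetric matrices. *)
Lemma fisher_ext_sym K : (fisher_ext K)^T = fisher_ext K -> K^T = K.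
Proof.
rewrite /fisher_ext linearD/= fisher_sym => /addrI /matrixP e.
apply/matrixP => i j; have := e i j; rewrite !mxE; lra.
Qed.

(** The quadratic form of [fisher] is the second moment of the score, so every score vanishes on the
    kernel. *)
Lemma fisher_ext_eq0 K : fisher_ext K = 0 -> K = 0.
Proof.
move=> f0; have sK : K^T = K by apply: fisher_ext_sym; rewrite f0 trmx0.
move: f0; rewrite /fisher_ext sK subrr addr0 => f0.
have := tr_fisher K K; rewrite f0 mul0mx mxtrace0 => /esym/eqP.
rewrite psumr_eq0 => [/allP s0|J _]; last first.
  by rewrite mulr_ge0 -?expr2 ?sqr_ge0// ltW// good_dpp_gt0.
apply: (score_injective pL iL sK) => J; rewrite score_tr//.
have := s0 J (mem_index_enum _); rewrite mulf_eq0 gt_eqF ?good_dpp_gt0//=.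
by rewrite mulf_eq0 orbb => /eqP.
Qed.

Definition fisher_inv K : V := vec_mx (mxvec K *m invmx (lin_mx fisher_ext)).

Lemma fisher_inv_linear : linear fisher_inv.
Proof.
by move=> a K H; rewrite /fisher_inv !linearP/= mulmxDl -scalemxAl linearP.
Qed.

HB.instance Definition _ := GRing.isLinear.Build R V V _ fisher_inv fisher_inv_linear.

Lemma fisher_ext_unit : lin_mx fisher_ext \in unitmx.
Proof.
rewrite unitmxE unitfE; apply/negP => /det0P[v v0 vF].
case/negP: v0; rewrite -[v]vec_mxK mul_vec_lin in vF *.
have /eqP := vF; rewrite mxvec_eq0 => /eqP/fisher_ext_eq0 ->.
by rewrite linear0.
Qed.

Lemma fisher_invK K : fisher_ext (fisher_inv K) = K.
Proof.
apply: (can_inj mxvecK); rewrite -mul_vec_lin vec_mxK -mulmxA mulVmx ?mulmx1//.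
exact: fisher_ext_unit.
Qed.

Lemma fisher_inv_sym K : K^T = K -> (fisher_inv K)^T = fisher_inv K.
Proof. by move=> sK; apply: fisher_ext_sym; rewrite fisher_invK. Qed.

Lemma fisher_inv_fisher K : K^T = K -> fisher (fisher_inv K) = K.
Proof.
move=> sK; have := fisher_invK K.
by rewrite /fisher_ext fisher_inv_sym// subrr addr0.
Qed.

Lemma fisherK K : K^T = K -> fisher_inv (fisher K) = K.
Proof.
move=> sK; apply/eqP; rewrite -subr_eq0; apply/eqP/fisher_ext_eq0.
rewrite linearB/= fisher_invK [in X in _ - X]/fisher_ext sK subrr addr0.
by rewrite subrr.
Qed.

Lemma tr_sqr_eq0 K : K^T = K -> \tr (K *m K) = 0 -> K = 0.
Proof.
move=> sK; rewrite tr_mul_sum => /eqP.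
have sK' i j : K j i = K i j by rewrite -[in LHS]sK mxE.
rewrite psumr_eq0 => [/allP h|i _]; last first.
  by apply: sumr_ge0 => j _; rewrite sK' -expr2 sqr_ge0.
apply/matrixP => i j; rewrite mxE; have := h i (mem_index_enum _).
rewrite /= psumr_eq0 => [/allP/(_ j (mem_index_enum _))|k _]; last first.
  by rewrite sK' -expr2 sqr_ge0.
by rewrite sK' /= mulf_eq0 orbb => /eqP.
Qed.

(** The influence function: the first-order effect on the estimator of an observation equal to
    [J]. *)
Definition influence J : V := fisher_inv (score_mx J).

Lemma influence_sym J : (influence J)^T = influence J.
Proof. exact: fisher_inv_sym (score_mx_sym J). Qed.

Lemma sum_influence : \sum_J dpp_pmf Ls J *: influence J = 0.
Proof.
have h := congr1 fisher_inv sum_score_mx; rewrite linear0 linear_sum/= in h.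
rewrite -[RHS]h; by apply: eq_bigr => J _; rewrite linearZ.
Qed.

(** Self-adjointness of the Fisher operator moves its inverse from H to the score, so the inverse
    form becomes the variance of the influence tested against H. *)
Lemma asymptotic_covarianceE H : H^T = H -> asymptotic_covariance Ls H H =
  \sum_J dpp_pmf Ls J * \tr (influence J *m H) ^+ 2.
Proof.
move=> sH; set B := fun H H' => - second_diff (expected_loglik Ls) Ls H H'.
have BE K K' : K^T = K -> K'^T = K' -> B K K' = \tr (fisher K *m K').
  move=> sK sK'; rewrite /B second_diff_expected// opprK tr_fisher.
  by apply: eq_bigr => J _; rewrite !score_tr.
have opE K : K^T = K -> form_operator B K = fisher K.
  move=> sK; rewrite /form_operator; set S := [set _ | _].
  have SF : S (fisher K).
    split=> [|K' /set_mem sK']; first by apply/mem_set; exact: fisher_sym.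
    by rewrite BE.
  (* [get] returns some matrix with the property; definiteness of the trace form on symmetric
     matrices shows that it is [fisher K]. *)
  have [/set_mem sG hG] := getPex (ex_intro _ _ SF); set G := get S in sG hG *.
  apply/eqP; rewrite -subr_eq0; apply/eqP/tr_sqr_eq0.
    by rewrite linearB/= fisher_sym sG.
  have sGF : (G - fisher K)^T = G - fisher K by rewrite linearB/= fisher_sym sG.
  have sGF' : G - fisher K \in symmx by apply/mem_set.
  by rewrite mulmxBl raddfB/= hG// BE// subrr.
rewrite /asymptotic_covariance -/B /inverse_form; set S := [set _ | _].
have SF : S (fisher_inv H).
  split; first by apply/mem_set; exact: fisher_inv_sym.
  by rewrite opE ?fisher_inv_fisher//; exact: fisher_inv_sym.
have [/set_mem sG hG] := getPex (ex_intro _ _ SF); set G := get S in sG hG *.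
have -> : G = fisher_inv H by rewrite -[in RHS]hG opE// fisherK.
rewrite mxtrace_mulC -{1}(fisher_inv_fisher sH) tr_fisher.
apply: eq_bigr => J _; rewrite -expr2; congr (_ * _ ^+ 2).
rewrite -(fisher_inv_fisher (score_mx_sym J)) -/(influence J) !tr_fisher.
rewrite -[in RHS](fisher_inv_fisher sH) mxtrace_mulC tr_fisher.
by apply: eq_bigr => K _; rewrite [X in _ * X]mulrC.
Qed.

End Fisher.

(** * Linearization of the estimator *)

Section Expansion.
Variables (R : realType) (N : nat).
Notation V := 'M[R]_N.
Variables (Ls : V) (pL : Ls \in posdefmx) (iL : irreducible_mx Ls).
Implicit Types (L H K : V) (J : {set 'I_N}).

Let gL : good Ls := posdef_good pL.
Let p J := dpp_pmf Ls J.

Lemma linear_mx_bound (f : V -> R) : linear f ->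
  forall H e, 0 <= e -> (forall i j, `|H i j| <= e) ->
    `|f H| <= e * \sum_i \sum_j `|f (delta_mx i j)|.
Proof.
move=> lf H e e0 He.
pose F : {linear V -> R} := HB.pack f (GRing.isLinear.Build _ _ _ _ f lf).
have -> : f H = \sum_i \sum_j H i j * f (delta_mx i j).
  rewrite {1}[H]matrix_sum_delta -[f]/(F : V -> R) linear_sum; apply: eq_bigr => i _.
  by rewrite linear_sum; apply: eq_bigr => j _; rewrite linearZ.
apply: le_trans (ler_norm_sum _ _ _) _; rewrite mulr_sumr; apply: ler_sum => i _.
apply: le_trans (ler_norm_sum _ _ _) _; rewrite mulr_sumr; apply: ler_sum => j _.
by rewrite normrM ler_wpM2r.
Qed.

Lemma score_linear' J K : linear (score K J).
Proof. by move=> a H1 H2; rewrite score_linear. Qed.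

Lemma fisher_inv_bound : exists2 C, 0 < C & forall (X : V) e, 0 <= e ->
  (forall i j, `|X i j| <= e) -> forall i j, `|fisher_inv Ls X i j| <= C * e.
Proof.
pose f i j X := fisher_inv Ls X i j.
have lf i j : linear (f i j).
  by move=> a X Y; rewrite /f linearP !mxE.
pose C := \sum_i \sum_j \sum_k \sum_l `|f i j (delta_mx k l)| + 1.
exists C; first by rewrite ltr_wpDl// !sumr_ge0// => *; rewrite !sumr_ge0// => *; rewrite !sumr_ge0// => *; rewrite !sumr_ge0.
move=> X e e0 Xe i j; apply: le_trans (linear_mx_bound (lf i j) e0 Xe) _.
rewrite mulrC ler_wpM2r// (@le_trans _ _ (C - 1)) ?gerBl// /C addrK.
apply: (@ler_sum_entries _ _ _ (fun i j => \sum_k \sum_l `|f i j (delta_mx k l)|)) => a b.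
by apply: sumr_ge0 => k _; apply: sumr_ge0.
Qed.

(** Entrywise radii are the form in which closeness is extracted from the Frobenius bound. *)
Lemma near_entries (P : V -> Prop) L : (\forall K \near L, P K) ->
  exists2 del, 0 < del & forall K, (forall i j, `|K i j - L i j| <= del) -> P K.
Proof.
move=> /nbhs_ballP[e /= e0 he]; exists (e / 2); first by rewrite divr_gt0.
move=> K KL; apply: he; rewrite -ball_normE/=.
apply: (@le_lt_trans _ _ (e / 2)); last by rewrite ltr_pdivrMr// ltr_pMr// ltr1n.
apply/mx_norm_leP => [|i j]; first by rewrite divr_ge0// ltW.
by rewrite !mxE distrC.
Qed.

Lemma dpp_expansion eps : 0 < eps -> exists2 del, 0 < del & forall L,
  (forall i j, `|L i j - Ls i j| <= del) -> forall J,
  `|dpp_pmf L J - p J - p J * score Ls J (L - Ls)| <= eps * `|L - Ls|.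
Proof.
move=> e0.
suff : \forall K \near Ls, forall J,
    `|dpp_pmf K J - p J - p J * score Ls J (K - Ls)| <= eps * `|K - Ls|.
  by move=> /near_entries.
apply: (@filter_forall V {set 'I_N} (fun J K => `|dpp_pmf K J - p J - p J * score Ls J (K - Ls)| <= eps * `|K - Ls|) (nbhs Ls)) => J.
have /diff_locally/eqaddoP/(_ _ e0) h : differentiable (fun K : V => dpp_pmf K J) Ls.
  exact/C1_diff/C1_dpp.
have : \forall K \near Ls, `|((fun K : V => dpp_pmf K J) \o shift Ls - (cst (dpp_pmf Ls J) + 'd (fun K : V => dpp_pmf K J) Ls)) (K - Ls)| <= eps * `|id (K - Ls)|.
  have c0 : K - Ls @[K --> Ls] --> (0 : V).
    rewrite -(subrr Ls); exact: (cvgB (@cvg_id _ (nbhs Ls)) (cvg_cst Ls)).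
  exact: (c0 _ h).
apply: filterS => K; rewrite /= !fctE /= subrK diff_dpp// opprD addrA.
by [].
Qed.

Lemma score_near eps : 0 < eps -> exists2 del, 0 < del & forall L,
  (forall i j, `|L i j - Ls i j| <= del) -> forall J i j,
  `|score L J (delta_mx i j) - score Ls J (delta_mx i j)| <= eps.
Proof.
move=> e0.
suff : \forall K \near Ls, forall J i j,
    `|score K J (delta_mx i j) - score Ls J (delta_mx i j)| <= eps.
  by move=> /near_entries.
apply: (@filter_forall V {set 'I_N} (fun J K => forall i j, `|score K J (delta_mx i j) - score Ls J (delta_mx i j)| <= eps) (nbhs Ls)) => J.
apply: (@filter_forall V 'I_N (fun i K => forall j, `|score K J (delta_mx i j) - score Ls J (delta_mx i j)| <= eps) (nbhs Ls)) => i.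
apply: (@filter_forall V 'I_N (fun j K => `|score K J (delta_mx i j) - score Ls J (delta_mx i j)| <= eps) (nbhs Ls)) => j.
have /cvgrPdist_le/(_ _ e0) h := score_cvg (J := J) (H := delta_mx i j) gL.
by near=> K; rewrite distrC; near: K; exact: h.
Unshelve. all: by end_near. Qed.

Definition closest_sign D L := D \in signmx /\ forall D', D' \in signmx ->
  frobenius_norm (D *m L *m D - Ls) <= frobenius_norm (D' *m L *m D' - Ls).

Lemma entry_le_frobenius (A : V) i j : `|A i j| <= frobenius_norm A.
Proof.
rewrite -sqrtr_sqr /frobenius_norm ler_wsqrtr//.
by apply: (@ler_sum_entries _ _ _ (fun i j => A i j ^+ 2)) => k l; exact: sqr_ge0.
Qed.

Lemma maximizer_conj q D L : D \in signmx ->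
  maximizer_on posdefmx (entropy_loglik q) L ->
  maximizer_on posdefmx (entropy_loglik q) (D *m L *m D).
Proof.
move=> sD [pK mK]; split; first exact: posdef_conj.
move=> K pK'; rewrite [leRHS](_ : _ = entropy_loglik q L); first exact: mK.
by apply: eq_bigr => J _; rewrite dpp_conj.
Qed.

(** The sums of q_J and of p_J(L) against the scores at L both vanish, so their difference can be
    inserted into an entry of X. Two products remain: the linearization error of p_J times a bounded
    score, and a first-order quantity times the variation of the score. *)
Lemma score_equation_remainder (eta B : R) q L (X := fisher Ls (L - Ls) -
    \sum_J (q J - p J) *: score_mx Ls J) :
  0 <= eta <= 1 -> B = \sum_J \sum_i \sum_j `|score Ls J (delta_mx i j)| ->
  maximizer_on posdefmx (entropy_loglik q) L ->
  (forall J, `|dpp_pmf L J - p J - p J * score Ls J (L - Ls)| <= eta * `|L - Ls|) ->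
  (forall J i j, `|score L J (delta_mx i j) - score Ls J (delta_mx i j)| <= eta) ->
  forall i j, `|X i j| <= eta * (#|{set 'I_N}|%:R * (B *+ 2 + 1) * `|L - Ls| +
     \sum_J `|q J - p J|).
Proof.
move=> /andP[eta0 eta1] BE mL hp hs i j.
have [pK _] := mL; have [sK _] := (posdefP _).1 pK; have [sL _] := (posdefP _).1 pL.
(* Tr(Y H) is the entry (i, j) of a symmetric Y, while H is an admissible direction for the score
   equation. *)
pose H : V := 2^-1 *: (delta_mx i j + delta_mx j i).
have sH : H^T = H by rewrite /H linearZ linearD/= !trmx_delta addrC.
have sD : (L - Ls)^T = L - Ls by rewrite linearB/= sK sL.
have trH (Y : V) : Y^T = Y -> Y i j = \tr (Y *m H).
  move=> sY; rewrite /H -scalemxAr mxtraceZ mulmxDr raddfD/=.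
  have trd a b : \tr (Y *m delta_mx a b) = Y b a.
    rewrite tr_mul_sum (bigD1 b)//= (bigD1 a)//= !mxE !eqxx mulr1.
    rewrite !big1 ?addr0// => k kb; last first.
      by rewrite mxE eqxx (negbTE kb) mulr0.
    by rewrite big1// => l _; rewrite mxE (negbTE kb) andbF mulr0.
  by rewrite !trd -[in Y j i]sY mxE; field.
have B0 J : `|score Ls J H| <= B /\ `|p J * score Ls J (L - Ls)| <= `|L - Ls| * B.
  have BJ : \sum_i \sum_j `|score Ls J (delta_mx i j)| <= B.
    rewrite BE (bigD1 J)//= lerDl sumr_ge0// => K _.
    by rewrite sumr_ge0// => k _; rewrite sumr_ge0.
  have p1 : `|p J| <= 1 by rewrite ger0_norm ?dpp_le1// ltW// dpp_gt0.
  split.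
    have := @linear_mx_bound (score Ls J) (score_linear' _ _) H 1 ler01.
    rewrite mul1r => h; apply: le_trans (h _) BJ => a b; rewrite !mxE.
    case: (_ && _); case: (_ && _); rewrite ?addr0 ?add0r ?mulr1 ?mulr0 ?normr0//.
    - by rewrite -mulr2n mulVf ?normr1 ?pnatr_eq0.
    - by rewrite ger0_norm ?invf_le1 ?ler1n.
    - by rewrite ger0_norm ?invf_le1 ?ler1n.
  rewrite normrM -[leRHS]mul1r ler_pM//.
  apply: le_trans (@linear_mx_bound (score Ls J) (score_linear' _ _) (L - Ls) `|L - Ls| _ _) _ => //.
    by move=> a b; exact: mx_entry_le.
  by rewrite ler_wpM2l.
have hsH J : `|score L J H - score Ls J H| <= eta.
  have E K : score K J H = (score K J (delta_mx i j) + score K J (delta_mx j i)) / 2.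
    by rewrite /H scoreZ scoreD mulrC.
  rewrite !E; have := hs J i j; have := hs J j i; rewrite !ler_norml.
  move: (score L J (delta_mx j i)) (score Ls J (delta_mx j i))
    (score L J (delta_mx i j)) (score Ls J (delta_mx i j)) => a b c d.
  by clear; move=> /andP[? ?] /andP[? ?]; apply/andP; split; lra.
have X0 : X i j = \sum_J ((p J * score Ls J (L - Ls) - (dpp_pmf L J - p J)) * score Ls J H +
   ((dpp_pmf L J - p J) - (q J - p J)) * (score Ls J H - score L J H)).
  have e1 := max_score mL sH.
  have e2 := sum_dpp_score H (posdef_good pK).
  have e3 : \sum_J ((dpp_pmf L J - p J) - (q J - p J)) * score L J H = 0.
    transitivity (\sum_J (dpp_pmf L J * score L J H - q J * score L J H)).
      by apply: eq_bigr => J _; move: (score L J H) => a; ring.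
    by rewrite sumrB e1 e2 subrr.
  rewrite trH; last first.
    rewrite /X linearB/= fisher_sym linear_sum/=; congr (_ - _).
    by apply: eq_bigr => J _; rewrite linearZ/= score_mx_sym.
  have e4 : \tr ((\sum_J (q J - p J) *: score_mx Ls J) *m H) =
      \sum_J (q J - p J) * score Ls J H.
    rewrite mulmx_suml raddf_sum/=; apply: eq_bigr => J _.
    by rewrite -scalemxAl mxtraceZ -score_tr.
  have tB (U W : V) : \tr (U - W) = \tr U - \tr W by rewrite raddfB.
  rewrite /X mulmxBl tB tr_fisher e4 -[LHS]subr0 -[X in _ - X = _]e3 -!sumrB.
  apply: eq_bigr => J _; rewrite -!score_tr// -/(p J).
  move: (score Ls J (L - Ls)) (score Ls J H) (score L J H) => a b c; ring.
rewrite X0; apply: le_trans (ler_norm_sum _ _ _) _.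
have -> : eta * (#|{set 'I_N}|%:R * (B *+ 2 + 1) * `|L - Ls| + \sum_J `|q J - p J|) =
   \sum_(J : {set 'I_N}) eta * ((B *+ 2 + 1) * `|L - Ls| + `|q J - p J|).
  rewrite -mulr_sumr big_split/= sumr_const; congr (_ * (_ + _)).
  by rewrite -[RHS]mulr_natl mulrA.
apply: ler_sum => J _; have [b1 b2] := B0 J; have b3 := hsH J; have b4 := hp J.
have Bp : 0 <= B by exact: le_trans b1.
have d0 : 0 <= `|L - Ls| by [].
move: b1 b2 b3 b4.
move: (score Ls J (L - Ls)) (score Ls J H) (score L J H) => sD' sH' sLH b1 b2 b3 b4.
have b5 : `|dpp_pmf L J - p J| <= (B + 1) * `|L - Ls|.
  have -> : dpp_pmf L J - p J = (dpp_pmf L J - p J - p J * sD') + p J * sD' by rewrite subrK.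
  apply: le_trans (ler_normD _ _) _.
  have : eta * `|L - Ls| <= `|L - Ls| by rewrite ler_piMl.
  by move: b2 b4; clear; move=> *; lra.
apply: le_trans (ler_normD _ _) _; rewrite !normrM.
rewrite [`|_ - (dpp_pmf L J - p J)|]distrC [`|sH' - _|]distrC.
(* The two products contribute B and B + 1 to the factor of the norm of L - Ls, whence 2 B + 1. *)
have c1 : `|dpp_pmf L J - p J - p J * sD'| * `|sH'| <= eta * `|L - Ls| * B.
  by rewrite ler_pM.
have c2 : `|dpp_pmf L J - p J - (q J - p J)| * `|sLH - sH'| <=
   ((B + 1) * `|L - Ls| + `|q J - p J|) * eta.
  by rewrite ler_pM// (le_trans (ler_normB _ _))// lerD2r.
by move: c1 c2; clear; move=> *; lra.
Qed.

Lemma mle_expansion (eps : R) : 0 < eps -> exists2 del, 0 < del &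
  forall q : {set 'I_N} -> R,
    (forall J, 0 <= q J <= 1) -> (forall J, `|q J - p J| <= del) ->
    (exists L, maximizer_on posdefmx (entropy_loglik q) L) /\
    forall D L, maximizer_on posdefmx (entropy_loglik q) L -> closest_sign D L ->
      forall i j, `|(D *m L *m D - Ls - \sum_J (q J - p J) *: influence Ls J) i j|
        <= eps * \sum_J `|q J - p J|.
Proof.
move=> e0; have [C C0 hC] := fisher_inv_bound.
pose B := \sum_J \sum_i \sum_j `|score Ls J (delta_mx i j)|.
pose K := #|{set 'I_N}|%:R * (B *+ 2 + 1).
have B0 : 0 <= B.
  by apply: sumr_ge0 => J _; apply: sumr_ge0 => i _; apply: sumr_ge0.
have K0 : 0 < K.
  rewrite mulr_gt0 ?ltr_wpDl ?mulrn_wge0// ltr0n.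
  by apply/card_gt0P; exists finset.set0.
pose B2 := \sum_J `|influence Ls J|.
have B20 : 0 <= B2 by apply: sumr_ge0.
(* M comes from inserting the a priori bound 2 (B2 + C) S on the norm of L' - Ls, proved in [db2],
   into K times this norm plus S. *)
pose M := K * (B2 + C) *+ 2 + 1.
have M0 : 0 < M.
  by rewrite ltr_wpDl// mulrn_wge0// mulr_ge0 ?(ltW K0)// addr_ge0// ltW.
(* The second bound absorbs half of the norm of L' - Ls into the left-hand side of [db]; the third
   makes the final remainder at most eps times S. *)
pose eta := Num.min 1 (Num.min (C * K *+ 2)^-1 (eps / (C * M))).
have eta0 : 0 < eta.
  by rewrite !lt_min ltr01/= invr_gt0 divr_gt0 ?mulr_gt0// pmulrn_lgt0// mulr_gt0.
have [eta1 eta2 eta3] : [/\ eta <= 1, eta * (C * K *+ 2) <= 1 & eta * (C * M) <= eps].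
  split; first by rewrite ge_min lexx.
    have h : 0 < C * K *+ 2 by rewrite pmulrn_lgt0// mulr_gt0.
    rewrite -[leRHS](mulVf (lt0r_neq0 h)) ler_pM2r//.
    by rewrite !ge_min lexx orbT.
  rewrite -ler_pdivlMr ?mulr_gt0//.
  by rewrite !ge_min lexx !orbT.
have [d1 d10 h1] := dpp_expansion eta0; have [d2 d20 h2] := score_near eta0.
have [del del0 hdel] := mle_consistent pL iL (ltac:(by rewrite lt_min d10) : 0 < Num.min d1 d2).
exists del => // q q01 hq; have [hex hmax] := hdel q q01 hq; split=> //.
move=> D L mL [sD Dmin] i j; set L' := D *m L *m D.
have [D' sD' D'd] := hmax L mL.
(* Consistency provides some conjugate near [Ls]; the one chosen by D is at least as close. *)
have L'd a b : `|L' a b - Ls a b| < Num.min d1 d2.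
  have := entry_le_frobenius (L' - Ls) a b; rewrite !mxE => h.
  by apply: le_lt_trans (le_trans h (Dmin D' sD')) D'd.
have mL' := maximizer_conj sD mL.
have [pL' _] := mL'; have [sL' _] := (posdefP _).1 pL'; have [sL _] := (posdefP _).1 pL.
have sDel : (L' - Ls)^T = L' - Ls by rewrite linearB/= sL' sL.
have := @score_equation_remainder eta B q L' _ erefl mL' _ _.
rewrite (ltW eta0) eta1 => /(_ isT) hX.
have Ld1 a b : `|L' a b - Ls a b| <= d1.
  by have := L'd a b; rewrite lt_min => /andP[/ltW].
have Ld2 a b : `|L' a b - Ls a b| <= d2.
  by have := L'd a b; rewrite lt_min => /andP[_ /ltW].
have {}hX := hX (h1 L' Ld1) (h2 L' Ld2).
set S := \sum_J `|q J - p J| in hX *; rewrite -/K in hX.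
have S0 : 0 <= S by apply: sumr_ge0.
have n0 : 0 <= `|L' - Ls| by [].
have X0 : 0 <= eta * (K * `|L' - Ls| + S).
  by rewrite mulr_ge0 ?(ltW eta0)// addr_ge0// mulr_ge0// ltW.
have := hC _ _ X0 hX.
have -> : fisher_inv Ls (fisher Ls (L' - Ls) - \sum_J (q J - p J) *: score_mx Ls J) =
    L' - Ls - \sum_J (q J - p J) *: influence Ls J.
  rewrite linearB/= fisherK// linear_sum/=; congr (_ - _).
  by apply: eq_bigr => J _; rewrite linearZ.
move=> hF; set Y := \sum_J (q J - p J) *: influence Ls J in hF *.
have Yb a b : `|Y a b| <= B2 * S.
  rewrite summxE; apply: le_trans (ler_norm_sum _ _ _) _.
  rewrite /S mulr_sumr; apply: ler_sum => J _; rewrite mxE normrM mulrC ler_wpM2r//.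
  apply: le_trans (mx_entry_le _ _ _) _.
  by rewrite /B2 (bigD1 J)//= lerDl sumr_ge0.
have db : `|L' - Ls| <= B2 * S + C * (eta * (K * `|L' - Ls| + S)).
  apply/mx_norm_leP => [|a b].
    by rewrite addr_ge0// mulr_ge0// ltW.
  have -> : (L' - Ls) a b = Y a b + (L' - Ls - Y) a b.
    by rewrite [(L' - Ls - Y) a b]mxE [(- Y) a b]mxE addrCA subrr addr0.
  by apply: le_trans (ler_normD _ _) _; rewrite lerD.
apply: le_trans (hF i j) _.
have db2 : `|L' - Ls| <= (B2 + C) * S *+ 2.
  have : C * (eta * S) <= C * S by rewrite ler_pM2l// ler_piMl.
  have : (eta * (C * K *+ 2)) * `|L' - Ls| <= `|L' - Ls| by rewrite ler_piMl.
  by move: db; clear; move=> *; lra.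
have : C * (eta * (K * `|L' - Ls| + S)) <= C * (eta * (K * ((B2 + C) * S *+ 2) + S)).
  by rewrite ler_pM2l// ler_pM2l// lerD2r ler_pM2l.
have : (eta * (C * M)) * S <= eps * S by rewrite ler_wpM2r.
by rewrite /M; clear; move=> *; lra.
Qed.

End Expansion.

(** * Bernstein polynomials *)

Section Bernstein.
Variable (R : realType).

Definition bern n k (y : R) : R := 'C(n, k)%:R * y ^+ k * (1 - y) ^+ (n - k).

Lemma bern_ge0 n k y : 0 <= y <= 1 -> 0 <= bern n k y.
Proof.
move=> /andP[y0 y1]; rewrite !mulr_ge0// ?exprn_ge0// subr_ge0//.
Qed.

Lemma bern_sum n y : \sum_(k < n.+1) bern n k y = 1.
Proof.
have := exprDn y (1 - y) n; rewrite addrC subrK expr1n => ->.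
rewrite (reindex_inj rev_ord_inj)/=; apply: eq_bigr => i _.
have iN : (i <= n)%N by rewrite -ltnS.
by rewrite /bern -[RHS]mulr_natl subSS bin_sub// subKn// mulrA.
Qed.

(* The first and second moments follow from 'C(n, k) * k = n * 'C(n - 1, k - 1). *)
Lemma bern_shift n k y : bern n.+1 k.+1 y * k.+1%:R = n.+1%:R * y * bern n k y.
Proof.
rewrite /bern subSS exprS.
have : k.+1%:R * 'C(n.+1, k.+1)%:R = n.+1%:R * 'C(n, k)%:R :> R.
  by rewrite -!natrM mul_bin_diag.
move=> e; transitivity ((k.+1%:R * 'C(n.+1, k.+1)%:R) * y * y ^+ k * (1 - y) ^+ (n - k)).
  by ring.
by rewrite e; ring.
Qed.

Lemma bern_moment1 n y : \sum_(k < n.+1) bern n k y * k%:R = n%:R * y.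
Proof.
case: n => [|n]; first by rewrite big_ord1 mulr0 mul0r.
rewrite big_ord_recl mulr0 add0r.
under eq_bigr do rewrite bern_shift.
by rewrite -mulr_sumr bern_sum mulr1.
Qed.

Lemma bern_moment2 n y :
  \sum_(k < n.+1) bern n k y * (k%:R * (k%:R - 1)) = n%:R * (n%:R - 1) * y ^+ 2.
Proof.
case: n => [|n]; first by rewrite big_ord1 !mul0r mulr0.
rewrite big_ord_recl mul0r mulr0 add0r.
have E (k : 'I_n.+1) : bern n.+1 (lift ord0 k) y * ((lift ord0 k)%:R * ((lift ord0 k)%:R - 1)) =
    n.+1%:R * y * (bern n k y * k%:R).
  rewrite lift0 [LHS]mulrA bern_shift.
  have -> : k.+1%:R - 1 = k%:R :> R by rewrite -natr1 addrK.
  by rewrite mulrA.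
under eq_bigr do rewrite E.
by rewrite -mulr_sumr bern_moment1 -natr1 addrK; ring.
Qed.

Lemma bern_variance n y :
  \sum_(k < n.+1) bern n k y * (k%:R - n%:R * y) ^+ 2 = n%:R * y * (1 - y).
Proof.
have -> : \sum_(k < n.+1) bern n k y * (k%:R - n%:R * y) ^+ 2 =
  \sum_(k < n.+1) bern n k y * (k%:R * (k%:R - 1)) +
  (1 - n%:R * y *+ 2) * \sum_(k < n.+1) bern n k y * k%:R +
  (n%:R * y) ^+ 2 * \sum_(k < n.+1) bern n k y.
  rewrite !mulr_sumr -!big_split/=; apply: eq_bigr => k _; ring.
by rewrite bern_moment1 bern_moment2 bern_sum; ring.
Qed.

(** Chebyshev's inequality for the binomial law, with y (1 - y) bounded by 1. *)
Lemma bern_tail n (y d : R) : 0 <= y <= 1 -> 0 < d -> (0 < n)%N ->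
  \sum_(k < n.+1 | d <= `|k%:R / n%:R - y|) bern n k y <= (n%:R * d ^+ 2)^-1.
Proof.
move=> y01 d0 n0; have n0' : 0 < n%:R :> R by rewrite ltr0n.
have nd0 : 0 < n%:R * d ^+ 2 by rewrite mulr_gt0// exprn_gt0.
rewrite -[leRHS]mul1r ler_pdivlMr// mulr_suml.
apply: (@le_trans _ _ (\sum_(k < n.+1) bern n k y * (k%:R - n%:R * y) ^+ 2 / n%:R)).
  rewrite [leRHS](bigID (fun k : 'I_n.+1 => d <= `|k%:R / n%:R - y|))/=.
  rewrite -[leLHS]addr0 lerD//; last first.
    apply: sumr_ge0 => k _; rewrite divr_ge0// mulr_ge0 ?sqr_ge0//; exact: bern_ge0.
  apply: ler_sum => k hk.
  have -> : bern n k y * (k%:R - n%:R * y) ^+ 2 / n%:R =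
     bern n k y * (n%:R * (k%:R / n%:R - y) ^+ 2) by field; rewrite gt_eqF.
  rewrite ler_wpM2l ?bern_ge0// ler_pM2l// -[leRHS]real_normK ?num_real//.
  by rewrite ler_pXn2r// ?nnegrE// ltW.
rewrite -mulr_suml bern_variance; have -> : n%:R * y * (1 - y) / n%:R = y * (1 - y).
  by field; rewrite gt_eqF.
by move: y01 => /andP[y0 y1]; rewrite mulr_ile1// ?subr_ge0// gerBl.
Qed.

End Bernstein.

(** * Bernstein operators in several variables *)

Section Weierstrass.
Variables (R : realType) (I : finType).

(** The expectation of [g] at independent binomial proportions with parameters [y i]. *)
Definition bernstein n (g : {ffun I -> R} -> R) (y : I -> R) : R :=
  \sum_(k : {ffun I -> 'I_n.+1})
    g [ffun i => (k i)%:R / n%:R] * \prod_i bern n (k i) (y i).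

Lemma bern_prod_sum n (y : I -> R) :
  \sum_(k : {ffun I -> 'I_n.+1}) \prod_i bern n (k i) (y i) = 1.
Proof.
rewrite -(bigA_distr_bigA (fun i (k : 'I_n.+1) => bern n k (y i))).
by rewrite big1// => i _; exact: bern_sum.
Qed.

Lemma bern_prod_tail n (y : I -> R) d i0 : (forall i, 0 <= y i <= 1) -> 0 < d -> (0 < n)%N ->
  \sum_(k : {ffun I -> 'I_n.+1} | d <= `|(k i0)%:R / n%:R - y i0|)
     \prod_i bern n (k i) (y i) <= (n%:R * d ^+ 2)^-1.
Proof.
move=> y01 d0 n0; apply: le_trans (bern_tail (y01 i0) d0 n0).
pose F i (k : 'I_n.+1) : R := if i == i0 then
  (if d <= `|k%:R / n%:R - y i0| then bern n k (y i0) else 0) else bern n k (y i).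
have -> : \sum_(k : {ffun I -> 'I_n.+1} | d <= `|(k i0)%:R / n%:R - y i0|)
     \prod_i bern n (k i) (y i) = \sum_(k : {ffun I -> 'I_n.+1}) \prod_i F i (k i).
  rewrite big_mkcond; apply: eq_bigr => k _; case: ifP => hk.
    by apply: eq_bigr => i _; rewrite /F; case: eqP => // ->; rewrite hk.
  by rewrite (bigD1 i0)//= /F eqxx hk mul0r.
rewrite -bigA_distr_bigA (bigD1 i0)//= [X in _ * X]big1 ?mulr1; last first.
  by move=> i /negbTE ii; rewrite /F ii bern_sum.
by rewrite /F eqxx -big_mkcond.
Qed.

Lemma bernstein_bound n g (y : I -> R) C : (forall i, 0 <= y i <= 1) ->
  (forall z, `|g z| <= C) -> `|bernstein n g y| <= C.
Proof.
move=> y01 gC; apply: le_trans (ler_norm_sum _ _ _) _.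
rewrite -[leRHS]mulr1 -[X in _ <= _ * X](bern_prod_sum n y) mulr_sumr.
apply: ler_sum => k _; have b0 : 0 <= \prod_i bern n (k i) (y i) by apply: prodr_ge0 => i _; exact: bern_ge0.
by rewrite normrM (ger0_norm b0) ler_wpM2r.
Qed.

(** Grid points within d of y in every coordinate cost e. The others cost at most 2 C each, and a
    union bound over the coordinates controls their total weight. *)
Lemma bernstein_error n g (y : {ffun I -> R}) C d e : (forall i, 0 <= y i <= 1) ->
  (0 < n)%N -> 0 < d -> 0 <= e -> (forall z, `|g z| <= C) ->
  (forall z : {ffun I -> R}, (forall i, 0 <= z i <= 1) ->
    (forall i, `|z i - y i| < d) -> `|g z - g y| <= e) ->
  `|bernstein n g y - g y| <= e + (C *+ 2) * (#|I|%:R * (n%:R * d ^+ 2)^-1).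
Proof.
move=> y01 n0 d0 e0 gC gd.
have C0 : 0 <= C by apply: le_trans (gC y).
pose B (k : {ffun I -> 'I_n.+1}) := \prod_i bern n (k i) (y i).
have b0 k : 0 <= B k by apply: prodr_ge0 => i _; exact: bern_ge0.
pose z (k : {ffun I -> 'I_n.+1}) : {ffun I -> R} := [ffun i => (k i)%:R / n%:R].
have -> : bernstein n g y - g y = \sum_k (g (z k) - g y) * B k.
  under [RHS]eq_bigr do rewrite mulrBl.
  by rewrite sumrB -[X in _ = _ - X]mulr_sumr bern_prod_sum mulr1.
apply: le_trans (ler_norm_sum _ _ _) _.
apply: (@le_trans _ _ (\sum_k (e * B k + (C *+ 2) * \sum_(i | d <= `|(k i)%:R / n%:R - y i|) B k))).
  apply: ler_sum => k _; rewrite normrM (ger0_norm (b0 k)).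
  have [/existsP[i hi]|/existsPn hn] := boolP [exists i, d <= `|(k i)%:R / n%:R - y i|].
    rewrite -[leLHS]add0r lerD ?mulr_ge0//.
    rewrite (bigD1 i)//= mulrDr -[leLHS]addr0 lerD//.
      rewrite ler_wpM2r// mulr2n; apply: le_trans (ler_normB _ _) _.
      by rewrite lerD.
    by rewrite mulr_ge0 ?mulrn_wge0// sumr_ge0.
  rewrite -[leLHS]addr0 lerD//; last by rewrite mulr_ge0 ?mulrn_wge0// sumr_ge0.
  rewrite ler_wpM2r// gd// => i; rewrite /z ffunE; last by have := hn i; rewrite -ltNge.
  by rewrite divr_ge0//= ler_pdivrMr ?ltr0n// mul1r ler_nat -ltnS.
rewrite big_split/= -!mulr_sumr bern_prod_sum mulr1 lerD2l ler_wpM2l ?mulrn_wge0//.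
rewrite (exchange_big_dep xpredT)//= -sum1_card natr_sum mulr_suml.
apply: ler_sum => i _; rewrite mul1r; exact: bern_prod_tail.
Qed.

End Weierstrass.

(** * Trigonometric polynomials *)

Section SinModulus.
Variable (R : realType).

Lemma MVT_sin (a b : R) : a < b -> exists2 c, c \in `]a, b[ & sin b - sin a = cos c * (b - a).
Proof.
move=> ab; apply: (@MVT R (@sin R) (@cos R) a b ab).
by apply: continuous_subspaceT; exact: continuous_sin.
Qed.

Lemma MVT_cos (a b : R) : a < b -> exists2 c, c \in `]a, b[ & cos b - cos a = - sin c * (b - a).
Proof.
move=> ab; apply: (@MVT R (@cos R) (fun x => - sin x) a b ab).
by apply: continuous_subspaceT; exact: continuous_cos.
Qed.

Lemma cos_lip (a b : R) : `|cos b - cos a| <= `|b - a|.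
Proof.
wlog ab : a b / a < b => [h|].
  have [ab|ba|->] := ltgtP a b; [exact: h| |by rewrite !subrr].
  by rewrite distrC [leRHS]distrC; exact: h.
have [c _ ->] := MVT_cos ab.
by rewrite normrM normrN ler_piMl// sin_max.
Qed.

Lemma cos_ge_cos1 (c : R) : `|c| <= 1 -> cos 1 <= cos c.
Proof.
move=> c1; rewrite -[cos c]cos_norm; have pi1 : 1 <= pi :> R.
  by apply: le_trans (pi_ge2 R); rewrite ler1n.
rewrite leNgt ltr_cos ?in_itv/= ?ler01 ?pi1 ?normr_ge0 ?(le_trans c1)//.
by rewrite -leNgt.
Qed.

Lemma sin_expand (a b : R) : a <= b -> - 1 <= a -> b <= 1 ->
  cos 1 * (b - a) <= sin b - sin a.
Proof.
rewrite le_eqVlt => /predU1P[->|ab a1 b1]; first by rewrite !subrr mulr0.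
have [c] := MVT_sin ab; rewrite in_itv/= => /andP[ac cb] ->.
apply: ler_wpM2r; first by rewrite subr_ge0 ltW.
apply: cos_ge_cos1; rewrite ler_norml.
by rewrite (le_trans a1 (ltW ac)) (le_trans (ltW cb) b1).
Qed.

(** On [-1, 1] the sine expands distances by at least the factor cos 1, and t - eta and t + eta stay
    there. Monotonicity on [- pi / 2, pi / 2] handles a u farther away. *)
Lemma sin_modulus (t u eta : R) : `|t| <= 2^-1 -> - (pi / 2) <= u <= pi / 2 ->
  0 < eta <= 2^-1 -> `|sin u - sin t| < cos 1 * eta -> `|u - t| <= eta.
Proof.
move=> t2 uI /andP[e0 e2]; move: t2; rewrite ler_norml => /andP[t1 t2].
have p1 := pihalf_ge1 R.
have mon (x y : R) : - (pi / 2) <= x <= pi / 2 -> - (pi / 2) <= y <= pi / 2 ->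
    x <= y -> sin x <= sin y.
  move=> xI yI; rewrite le_eqVlt => /predU1P[->//|xy].
  by rewrite ltW// ltr_sin// in_itv.
rewrite ltr_norml => /andP[s1 s2]; rewrite ler_distl; apply/andP; split.
- rewrite leNgt; apply/negP => ut; move: s1; apply/negP; rewrite -leNgt.
  have h1 : sin u <= sin (t - eta).
    by apply: mon => //; [apply/andP; split; lra|exact: ltW].
  have := @sin_expand (t - eta) t ltac:(lra) ltac:(lra) ltac:(lra).
  by rewrite opprB addrCA subrr addr0 => h2; lra.
- rewrite leNgt; apply/negP => ut; move: s2; apply/negP; rewrite -leNgt.
  have h1 : sin (t + eta) <= sin u.
    by apply: mon => //; [apply/andP; split; lra|exact: ltW].
  have := @sin_expand t (t + eta) ltac:(lra) ltac:(lra) ltac:(lra).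
  by rewrite addrAC subrr add0r => h2; lra.
Qed.

End SinModulus.

(** * Waves in the entries of a matrix and approximation by their sums *)

Section Trig.
Variables (R : realType) (m n : nat).
Notation V := 'M[R]_(m, n).

Definition dot (t x : V) : R := \sum_i \sum_j t i j * x i j.

(** The triple is (amplitude, frequency, phase). The free phase covers sines and turns products of
    waves into sums of waves. *)
Definition wave (w : R * V * R) (x : V) : R := w.1.1 * cos (w.2 + dot w.1.2 x).

Definition trigpoly (q : V -> R) := exists s : seq (R * V * R),
  forall x, q x = \sum_(w <- s) wave w x.

Lemma dotDl s t x : dot (s + t) x = dot s x + dot t x.
Proof.
rewrite -big_split/=; apply: eq_bigr => i _; rewrite -big_split/=.
by apply: eq_bigr => j _; rewrite mxE mulrDl.
Qed.

Lemma dotZl a t x : dot (a *: t) x = a * dot t x.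
Proof.
rewrite mulr_sumr; apply: eq_bigr => i _; rewrite mulr_sumr.
by apply: eq_bigr => j _; rewrite mxE mulrA.
Qed.

Lemma dotNl t x : dot (- t) x = - dot t x.
Proof. by rewrite -scaleN1r dotZl mulN1r. Qed.

Lemma dotDr t x y : dot t (x + y) = dot t x + dot t y.
Proof.
rewrite -big_split/=; apply: eq_bigr => i _; rewrite -big_split/=.
by apply: eq_bigr => j _; rewrite mxE mulrDr.
Qed.

Lemma dotZr t a x : dot t (a *: x) = a * dot t x.
Proof.
rewrite mulr_sumr; apply: eq_bigr => i _; rewrite mulr_sumr.
by apply: eq_bigr => j _; rewrite mxE mulrCA.
Qed.

Lemma dot0l x : dot 0 x = 0.
Proof. by apply: (addrI (dot 0 x)); rewrite -dotDl !addr0. Qed.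

Lemma dot0r t : dot t 0 = 0.
Proof. by have := dotZr t 0 0; rewrite scale0r mul0r. Qed.

Lemma dot_sum (I : Type) (r : seq I) (F : I -> V) t :
  dot t (\sum_(i <- r) F i) = \sum_(i <- r) dot t (F i).
Proof. by elim: r => [|x r IH]; rewrite ?big_nil ?dot0r// !big_cons dotDr IH. Qed.

Lemma dot_delta a i j x : dot (a *: delta_mx i j) x = a * x i j.
Proof.
rewrite /dot (bigD1 i)//= (bigD1 j)//= !mxE !eqxx mulr1.
rewrite !big1 ?addr0// => k kb; last by rewrite !mxE eqxx (negbTE kb) mulr0 mul0r.
by rewrite big1// => l _; rewrite !mxE (negbTE kb) mulr0 mul0r.
Qed.

Lemma dot_bound t (x : V) e : 0 <= e -> (forall i j, `|x i j| <= e) ->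
  `|dot t x| <= (\sum_i \sum_j `|t i j|) * e.
Proof.
move=> e0 xe; apply: le_trans (ler_norm_sum _ _ _) _.
rewrite mulr_suml; apply: ler_sum => i _; apply: le_trans (ler_norm_sum _ _ _) _.
by rewrite mulr_suml; apply: ler_sum => j _; rewrite normrM ler_wpM2l.
Qed.

Lemma trigpoly_cst c : trigpoly (fun=> c).
Proof.
exists [:: (c, 0, 0)] => x.
by rewrite big_seq1 /wave /= dot0l addr0 cos0 mulr1.
Qed.

Lemma trigpolyD f g : trigpoly f -> trigpoly g -> trigpoly (fun x => f x + g x).
Proof.
by move=> [s fs] [t gt]; exists (s ++ t) => x; rewrite big_cat fs gt.
Qed.

Lemma trigpoly_sum (I : Type) (r : seq I) (F : I -> V -> R) :
  (forall i, trigpoly (F i)) -> trigpoly (fun x => \sum_(i <- r) F i x).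
Proof.
move=> tF; elim: r => [|i r IH].
  have [s hs] := trigpoly_cst 0; exists s => x.
  by rewrite big_nil -hs.
by have [s hs] := trigpolyD (tF i) IH; exists s => x; rewrite big_cons -hs.
Qed.

Lemma trigpoly_wave2 (w v : R * V * R) : trigpoly (fun x => wave w x * wave v x).
Proof.
exists [:: (w.1.1 * v.1.1 / 2, w.1.2 + v.1.2, w.2 + v.2);
           (w.1.1 * v.1.1 / 2, w.1.2 - v.1.2, w.2 - v.2)] => x.
rewrite big_cons big_seq1 /wave /= !dotDl dotNl.
set a := dot w.1.2 x; set b := dot v.1.2 x.
have -> : w.2 + v.2 + (a + b) = (w.2 + a) + (v.2 + b) by ring.
have -> : w.2 - v.2 + (a - b) = (w.2 + a) - (v.2 + b) by ring.
by move: (w.2 + a) (v.2 + b) => A B; rewrite cosD cosB; field.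
Qed.

Lemma trigpolyM f g : trigpoly f -> trigpoly g -> trigpoly (fun x => f x * g x).
Proof.
move=> [s fs] [t gt].
have h : trigpoly (fun x => \sum_(w <- s) \sum_(v <- t) wave w x * wave v x).
  by apply: trigpoly_sum => w; apply: trigpoly_sum => v; exact: trigpoly_wave2.
have [r hr] := h; exists r => x; rewrite -hr fs gt mulr_suml.
by apply: eq_bigr => w _; rewrite mulr_sumr.
Qed.

Lemma trigpolyX f k : trigpoly f -> trigpoly (fun x => f x ^+ k).
Proof.
move=> tf; elim: k => [|k IH].
  by have [s hs] := trigpoly_cst 1; exists s => x; rewrite expr0 -hs.
by have [s hs] := trigpolyM tf IH; exists s => x; rewrite exprS -hs.
Qed.

Lemma trigpoly_prod (I : Type) (r : seq I) (F : I -> V -> R) :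
  (forall i, trigpoly (F i)) -> trigpoly (fun x => \prod_(i <- r) F i x).
Proof.
move=> tF; elim: r => [|i r IH].
  by have [s hs] := trigpoly_cst 1; exists s => x; rewrite big_nil -hs.
by have [s hs] := trigpolyM (tF i) IH; exists s => x; rewrite big_cons -hs.
Qed.

Lemma trigpoly_sin a i j : trigpoly (fun x => sin (a * x i j)).
Proof.
exists [:: (1, a *: delta_mx i j, - (pi / 2))] => x.
rewrite big_seq1 /wave /= mul1r dot_delta addrC cosBpihalf//.
Qed.

Lemma trigpoly_bernstein k (g : {ffun 'I_m * 'I_n -> R} -> R) a :
  trigpoly (fun x => bernstein k g (fun ij => (1 + sin (a * x ij.1 ij.2)) / 2)).
Proof.
have ts ij : trigpoly (fun x => (1 + sin (a * x ij.1 ij.2)) / 2).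
  apply: trigpolyM (trigpoly_cst _); apply: trigpolyD; first exact: trigpoly_cst.
  exact: trigpoly_sin.
apply: trigpoly_sum => z; apply: trigpolyM; first exact: trigpoly_cst.
apply: trigpoly_prod => ij; apply: trigpolyM.
  by apply: trigpolyM; [exact: trigpoly_cst|exact: trigpolyX].
apply: trigpolyX.
have [s hs] := trigpolyD (trigpoly_cst 1) (trigpolyM (trigpoly_cst (-1)) (ts ij)).
by exists s => x; rewrite -hs mulN1r.
Qed.

(** Only x is confined to the compact set: in [trigpoly_approx] the comparison point may leave the
    cube. *)
Lemma unif_continuous_compact (f : V -> R) (A : set V) e : continuous f ->
  compact A -> 0 < e -> exists2 d, 0 < d & forall x x', A x -> `|x - x'| < d ->
    `|f x' - f x| <= e.
Proof.
move=> cf /compact_near_coveringP cA e0.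
have : \forall d \near (0 : R)^'+, A `<=` (fun x => forall x', `|x - x'| < d -> `|f x' - f x| <= e).
  apply: cA => x Ax.
  have /cvgrPdist_le/(_ (e / 2) (ltac:(by rewrite divr_gt0))) /nbhs_ballP[r /= r0 hr] := cf x.
  exists (ball x (r / 2), [set d : R | d < r / 2]).
    split; first by apply: nbhsx_ballx; rewrite divr_gt0.
    by apply: nbhs_right_lt; rewrite divr_gt0.
  move=> [y d] [/= xy dr] x' yx'.
  have h1 : `|f x - f y| <= e / 2.
    apply: hr; apply: le_ball xy; by rewrite ler_pdivrMr// ler_peMr ?ler1n// ltW.
  have h2 : `|f x - f x'| <= e / 2.
    apply: hr; rewrite -ball_normE/= (_ : x - x' = (x - y) + (y - x')); last by rewrite addrA subrK.
    apply: le_lt_trans (ler_normD _ _) _; rewrite [ltRHS]splitr ltrD//.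
      by move: xy; rewrite -ball_normE.
    exact: lt_trans dr.
  have -> : f x' - f y = (f x - f y) - (f x - f x') by ring.
  apply: le_trans (ler_normB _ _) _; rewrite [leRHS]splitr lerD//.
move=> hd; near (0 : R)^'+ => d; exists d => //.
by move=> x x' Ax; apply: (near hd d) => //.
Unshelve. all: by end_near. Qed.

Lemma compact_cube K : compact [set x : V | forall i j, `|x i j| <= K].
Proof.
apply: (@compact_mx _ _ _ _ K) => //.
have -> : [set x : V | forall i j, `|x i j| <= K] =
   [set x : V | forall i j, - K <= x i j] `&` [set x : V | forall i j, - K <= - x i j].
  apply/seteqP; split=> [x h|x [h1 h2] i j /=].
    by split=> i j; have := h i j; rewrite ler_norml ?lerN2 => /andP[].
  by rewrite ler_norml h1 -lerN2 h2.
have cc i j : continuous (fun L : V => L i j) by exact: coord_continuous.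
apply: closedI.
  by apply: closed_forall => i; apply: closed_forall => j; exact: closed_ge_fun.
apply: closed_forall => i; apply: closed_forall => j; apply: closed_ge_fun.
by move=> L; exact: (cvgN (cc i j L)).
Qed.

(* On the cube, sin(x_ij / 2K) determines x_ij, so f is there a continuous
   function of these sines, which the Bernstein operator makes polynomial. *)
Lemma trigpoly_approx (f : V -> R) C K e : continuous f ->
  (forall x, `|f x| <= C) -> 0 < K -> 0 < e ->
  exists q, [/\ trigpoly q, forall x, `|q x| <= C &
    forall x : V, (forall i j, `|x i j| <= K) -> `|q x - f x| <= e].
Proof.
move=> cf fC K0 e0.
have C0 : 0 <= C := le_trans (normr_ge0 _) (fC 0).
have e20 : 0 < e / 2 by rewrite divr_gt0.
have [d0 d00 hd0] := unif_continuous_compact cf (@compact_cube K) e20.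
(* This undoes [s] on the cube, where the sine is taken on [-1/2, 1/2] and [asin] inverts it. *)
pose inv (z : {ffun 'I_m * 'I_n -> R}) : V :=
  \matrix_(i, j) (K *+ 2 * asin (z (i, j) *+ 2 - 1)).
pose g z := f (inv z).
have K20 : 0 < K *+ 2 by rewrite pmulrn_lgt0.
pose a := (K *+ 2)^-1.
pose s (x : V) : 'I_m * 'I_n -> R := fun ij => (1 + sin (a * x ij.1 ij.2)) / 2.
have s01 x ij : 0 <= s x ij <= 1.
  have := sin_max (a * x ij.1 ij.2); rewrite ler_norml => /andP[h1 h2].
  by apply/andP; split; rewrite /s; lra.
(* 1/2 is the range of [sin_modulus]; d0 / (4 K), rescaled by 2 K, gives a displacement of at most
   d0 / 2. *)
pose eta := Num.min 2^-1 (d0 / (K *+ 4)).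
have eta0 : 0 < eta <= 2^-1.
  by rewrite lt_min invr_gt0 ltr0n/= divr_gt0 ?pmulrn_lgt0//= ge_min lexx.
(* The division by 2 reflects that [s] is half of 1 + sin. *)
pose d := cos 1 * eta / 2.
have d_gt0 : 0 < d.
  by rewrite divr_gt0// mulr_gt0 ?cos1_gt0//; have /andP[] := eta0.
have [k k0 hk] : exists2 k, (0 < k)%N & (C *+ 2) * (#|{: 'I_m * 'I_n}|%:R * (k%:R * d ^+ 2)^-1) <= e / 2.
  pose M := C *+ 2 * #|{: 'I_m * 'I_n}|%:R / d ^+ 2 / (e / 2).
  exists (Num.bound M).+1 => //.
  have M0 : 0 <= M.
    apply: divr_ge0; last exact: ltW.
    by apply: divr_ge0; [rewrite mulr_ge0// mulrn_wge0|exact: sqr_ge0].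
  have hb : M <= (Num.bound M).+1%:R.
    apply: ltW; apply: lt_le_trans (archi_boundP M0) _; by rewrite ler_nat.
  have k0 : 0 < (Num.bound M).+1%:R :> R by rewrite ltr0n.
  have -> : C *+ 2 * (#|{: 'I_m * 'I_n}|%:R / ((Num.bound M).+1%:R * d ^+ 2)) =
      M * (e / 2) / (Num.bound M).+1%:R.
    rewrite /M divfK ?gt_eqF//; field.
    by rewrite !gt_eqF.
  by rewrite ler_pdivrMr// mulrC ler_wpM2l// ltW.
exists (fun x => bernstein k g (s x)); split.
- exact: trigpoly_bernstein.
(* The bound holds on the whole space, because the sines never leave [-1, 1]. *)
- by move=> x; apply: bernstein_bound => // z; exact: fC.
move=> x xK; pose y : {ffun 'I_m * 'I_n -> R} := [ffun ij => s x ij].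
have ax i j : `|a * x i j| <= 2^-1.
  rewrite normrM ger0_norm; last by rewrite /a invr_ge0 ltW.
  have -> : 2^-1 = a * K by rewrite /a; field; rewrite gt_eqF.
  by rewrite ler_wpM2l// /a invr_ge0 ltW.
have p1 := pihalf_ge1 R.
have axI i j : - (pi / 2) <= a * x i j <= pi / 2.
  by have := ax i j; rewrite ler_norml => /andP[h1 h2]; apply/andP; split; lra.
have sy i j : s x (i, j) *+ 2 - 1 = sin (a * x i j) by rewrite /s/=; field.
have gy : g y = f x.
  rewrite /g; congr f; apply/matrixP => i j; rewrite mxE ffunE sy.
  by rewrite sinK ?in_itv//= /a mulVKf// gt_eqF.
have -> : bernstein k g (s x) = bernstein k g y.
  by apply: eq_bigr => z _; congr (_ * _); apply: eq_bigr => ij _; rewrite ffunE.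
rewrite -gy; apply: (le_trans (bernstein_error (d := d) (e := e / 2) (C := C) _ _ _ _ _ _)) => //.
- by move=> ij; rewrite ffunE.
- exact: ltW.
- by move=> z; exact: fC.
- move=> z z01 zy; rewrite gy; apply: hd0 => //.
  apply: (@le_lt_trans _ _ (d0 / 2)); last by rewrite ltr_pdivrMr// ltr_pMr// ltr1n.
  apply/mx_norm_leP => [|i j]; first by rewrite divr_ge0// ltW.
  have zI : - 1 <= z (i, j) *+ 2 - 1 <= 1.
    by have /andP[h1 h2] := z01 (i, j); apply/andP; split; lra.
  have [uI su] := asin_def zI.
  rewrite !mxE; set u := asin _ in uI su *.
  have : `|u - a * x i j| <= eta.
    apply: sin_modulus => //; rewrite su -sy.
    have := zy (i, j); rewrite ffunE /d ltr_pdivlMr//.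
    have -> : z (i, j) *+ 2 - 1 - (s x (i, j) *+ 2 - 1) = (z (i, j) - s x (i, j)) * 2 by ring.
    by rewrite normrM [`|2|]ger0_norm.
  move=> hu; have -> : x i j - K *+ 2 * u = - (K *+ 2 * (u - a * x i j)).
    by rewrite mulrBr /a mulVKf ?gt_eqF// opprB.
  rewrite normrN normrM ger0_norm ?(ltW K20)//.
  apply: (@le_trans _ _ (K *+ 2 * (d0 / (K *+ 4)))).
    by rewrite ler_pM2l//; apply: le_trans hu _; rewrite ge_min lexx orbT.
  rewrite le_eqVlt; apply/orP; left; apply/eqP; field.
  by rewrite gt_eqF.
by rewrite [leRHS]splitr lerD2l.
Qed.

End Trig.

(** * Expectations and the characteristic function of normal laws *)

Section BoundedExpectation.
Context {R : realType} {d : measure_display} {T : measurableType d}.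
Variable P : probability T R.
Implicit Types X Y : T -> R.

(** For bounded measurable functions integrability is automatic, so expectations can be handled as
    real numbers. *)
Definition bmf X := measurable_fun setT X /\ exists C, forall w, `|X w| <= C.

Lemma bmf_integrable X : bmf X -> P.-integrable setT (EFin \o X).
Proof.
move=> [mX [C XC]]; apply: measurable_bounded_integrable => //.
  exact: le_lt_trans (probability_le1 _ _) (ltry _).
exists C; split; first exact: num_real.
by move=> M CM w _ /=; apply: le_trans (XC w) (ltW CM).
Qed.

Definition Ex X : R := \int[P]_w X w.

Lemma expectation_Ex X : bmf X -> ('E_P[X] = (Ex X)%:E)%E.
Proof.
move=> bX; rewrite unlock /Ex /Rintegral fineK//.
apply: integrable_fin_num => //; exact: bmf_integrable.
Qed.

Lemma bmf_cst c : bmf (cst c).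
Proof. by split; [exact: measurable_cst|exists `|c|]. Qed.

Lemma bmfD X Y : bmf X -> bmf Y -> bmf (fun w => X w + Y w).
Proof.
move=> [mX [C XC]] [mY [D YD]]; split; first exact: measurable_funD.
by exists (C + D) => w; apply: le_trans (ler_normD _ _) _; rewrite lerD.
Qed.

Lemma bmfM X Y : bmf X -> bmf Y -> bmf (fun w => X w * Y w).
Proof.
move=> [mX [C XC]] [mY [D YD]]; split; first exact: measurable_funM.
by exists (C * D) => w; rewrite normrM ler_pM.
Qed.

Lemma bmfZ c X : bmf X -> bmf (fun w => c * X w).
Proof. by move=> bX; apply: bmfM => //; exact: bmf_cst. Qed.

Lemma bmf_sum (I : Type) (r : seq I) (F : I -> T -> R) :
  (forall i, bmf (F i)) -> bmf (fun w => \sum_(i <- r) F i w).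
Proof.
move=> bF; elim: r => [|i r IH].
  by rewrite (_ : (fun w => _) = cst 0); [exact: bmf_cst|apply/funext => w; rewrite big_nil].
rewrite (_ : (fun w => _) = fun w => F i w + \sum_(j <- r) F j w); first exact: bmfD.
by apply/funext => w; rewrite big_cons.
Qed.

Lemma bmf_indic (A : set T) : measurable A -> bmf (\1_A : T -> R).
Proof.
move=> mA; split; first exact: measurable_indic.
by exists 1 => w; rewrite indicE; case: (_ \in _); rewrite ?normr1 ?normr0.
Qed.

Lemma bmf_bounded (h : R -> R) X C : measurable_fun setT h -> (forall x, `|h x| <= C) ->
  measurable_fun setT X -> bmf (fun w => h (X w)).
Proof.
by move=> mh hC mX; split; [exact: measurableT_comp|exists C => w; exact: hC].
Qed.

Lemma bmf_cos Y : measurable_fun setT Y -> bmf (fun w => cos (Y w)).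
Proof.
move=> mY; apply: (@bmf_bounded cos _ 1) => //.
  exact: continuous_measurable_fun (@continuous_cos R).
by move=> x; exact: cos_max.
Qed.

Lemma ExD X Y : bmf X -> bmf Y -> Ex (fun w => X w + Y w) = Ex X + Ex Y.
Proof. by move=> bX bY; rewrite /Ex RintegralD//; exact: bmf_integrable. Qed.

Lemma ExZ c X : bmf X -> Ex (fun w => c * X w) = c * Ex X.
Proof. by move=> bX; rewrite /Ex RintegralZl//; exact: bmf_integrable. Qed.

Lemma Ex_cst c : Ex (cst c) = c.
Proof.
transitivity (c * fine (P setT)); first exact: Rintegral_cst.
by rewrite probability_setT mulr1.
Qed.

Lemma Ex_sum (I : Type) (r : seq I) (F : I -> T -> R) : (forall i, bmf (F i)) ->
  Ex (fun w => \sum_(i <- r) F i w) = \sum_(i <- r) Ex (F i).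
Proof.
move=> bF; elim: r => [|i r IH].
  by rewrite big_nil (_ : (fun w => _) = cst 0) ?Ex_cst//; apply/funext => w; rewrite big_nil.
rewrite big_cons -IH -ExD//; last exact: bmf_sum.
by congr Ex; apply/funext => w; rewrite big_cons.
Qed.

Lemma bmfB X Y : bmf X -> bmf Y -> bmf (fun w => X w - Y w).
Proof.
move=> bX bY; under eq_fun do rewrite -mulN1r.
by apply: bmfD => //; exact: bmfZ.
Qed.

Lemma ExB X Y : bmf X -> bmf Y -> Ex (fun w => X w - Y w) = Ex X - Ex Y.
Proof.
move=> bX bY; under eq_fun do rewrite -mulN1r.
by rewrite ExD ?ExZ ?mulN1r//; exact: bmfZ.
Qed.

Lemma Ex_le X Y : bmf X -> bmf Y -> (forall w, X w <= Y w) -> Ex X <= Ex Y.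
Proof.
by move=> bX bY XY; apply: le_Rintegral => //; exact: bmf_integrable.
Qed.

Lemma Ex_indic (A : set T) : measurable A -> Ex \1_A = fine (P A).
Proof. by move=> mA; rewrite /Ex /Rintegral integral_indic// setIT. Qed.

(** Applied with A of small probability: escape from a cube, or atypical frequencies. *)
Lemma Ex_close X Y (A : set T) e C : bmf X -> bmf Y -> measurable A ->
  (forall w, ~ A w -> `|X w - Y w| <= e) -> 0 <= e ->
  (forall w, `|X w| <= C) -> (forall w, `|Y w| <= C) ->
  `|Ex X - Ex Y| <= e + C *+ 2 * fine (P A).
Proof.
move=> bX bY mA AXY e0 XC YC.
have C0 : 0 <= C by apply: le_trans (XC point).
have bA := bmf_indic mA.
have bB : bmf (fun w => e + C *+ 2 * \1_A w).
  by apply: bmfD; [exact: bmf_cst|exact: bmfZ].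
have EB : Ex (fun w => e + C *+ 2 * \1_A w) = e + C *+ 2 * fine (P A).
  rewrite ExD; [|exact: bmf_cst|exact: bmfZ].
  by rewrite [X in X + _]Ex_cst ExZ// Ex_indic.
have key w : `|X w - Y w| <= e + C *+ 2 * \1_A w.
  rewrite indicE; have [wA|/negP wA] := boolP (w \in A).
    rewrite mulr1; apply: le_trans (ler_normB _ _) _.
    by rewrite mulr2n -[leLHS]add0r lerD// lerD.
  by rewrite mulr0 addr0; apply: AXY => /mem_set.
have bD := bmfB bX bY.
rewrite -ExB// -EB ler_norml; apply/andP; split.
  rewrite -[leLHS]mulN1r -ExZ//; apply: Ex_le => //; first exact: bmfZ.
  by move=> w; rewrite mulN1r; have := key w; rewrite ler_norml => /andP[].
by apply: Ex_le => // w; have := key w; rewrite ler_norml => /andP[].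
Qed.

End BoundedExpectation.

(* The characteristic function phi of N(0, s^2) solves phi'(t) = - s^2 t phi(t), by
   differentiation under the integral sign and integration by parts; the phase th
   treats its real and imaginary parts at once. *)
Section NormalChar.
Context {R : realType}.
Variable s : R.
Hypothesis s0 : s != 0.
Notation mu := (@lebesgue_measure R).

Let q (x : R) := normal_peak s * expR (- x ^+ 2 / (s ^+ 2 *+ 2)).

Lemma normal_pdf_q : normal_pdf 0 s = q.
Proof. by rewrite normal_pdfE//; apply/funext => x; rewrite /normal_fun subr0. Qed.

(** The Radon-Nikodym derivative of the normal law is identified almost everywhere with the density,
    by comparing integrals over measurable sets. *)
Lemma integral_normal_prob (f : R -> R) : measurable_fun setT f ->
  (exists C, forall x, `|f x| <= C) ->
  \int[normal_prob 0 s]_x f x = \int[mu]_x (f x * normal_pdf 0 s x).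
Proof.
move=> mf [C fC]; rewrite /Rintegral; congr fine.
have If : (normal_prob 0 s).-integrable setT (EFin \o f).
  by apply: (@bmf_integrable _ _ _ (normal_prob 0 s)); split=> //; exists C.
rewrite -(Radon_Nikodym_change_of_variables (normal_prob_dominates 0 s))//=.
apply: ae_eq_integral => //.
- apply: emeasurable_funM => //; first exact/measurable_EFinP.
  by apply: (measurable_int mu); apply: Radon_Nikodym_integrable; exact: normal_prob_dominates.
- by apply/measurable_EFinP; apply: measurable_funM => //; exact: measurable_normal_pdf.
- under [X in ae_eq _ _ _ X]eq_fun do rewrite EFinM.
  apply: ae_eqe_mul2l => /=.
  rewrite Radon_NikodymE//=; first exact: normal_prob_dominates.
  move=> dom; case: cid => /= h [h1 h2 h3].
  apply: integral_ae_eq => //=.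
  + by apply/measurable_EFinP; exact: measurable_normal_pdf.
  + by move=> E E01 mE; rewrite -h3.
Qed.

Lemma q_ge0 x : 0 <= q x.
Proof. by rewrite -normal_pdf_q normal_pdf_ge0. Qed.

Lemma measurable_q : measurable_fun setT q.
Proof. by rewrite -normal_pdf_q; exact: measurable_normal_pdf. Qed.

Lemma integrable_q : mu.-integrable setT (EFin \o q).
Proof.
have := integrable_normal_pdf 0 s; by rewrite normal_pdf_q.
Qed.

(** With y = x^2 / (4 s^2), the factor |x| is at most |s| (1 + y) <= |s| exp(y). Half of the
    exponent absorbs it and the other half is the density with standard deviation s sqrt(2). *)
Lemma abs_q_bound : exists2 K, 0 <= K & forall x, `|x| * q x <= K * normal_pdf 0 (s * Num.sqrt 2) x.
Proof.
have s20 : s * Num.sqrt 2 != 0 by rewrite mulf_neq0// gt_eqF// sqrtr_gt0.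
have pk0 := normal_peak_gt0 s20.
have as0 : 0 < `|s| by rewrite normr_gt0.
exists (`|s| * normal_peak s / normal_peak (s * Num.sqrt 2)).
  by rewrite divr_ge0 ?mulr_ge0 ?normal_peak_ge0.
move=> x; rewrite normal_pdfE// /normal_fun subr0 /q mulrA.
rewrite [leRHS]mulrA divfK ?gt_eqF// exprMn sqr_sqrtr//.
pose y := x ^+ 2 / (s ^+ 2 *+ 4).
have ss0 : 0 < s ^+ 2 by rewrite exprn_even_gt0.
have -> : - x ^+ 2 / (s ^+ 2 *+ 2) = - y - y by rewrite /y; field; rewrite s0.
have -> : - x ^+ 2 / (s ^+ 2 * 2 *+ 2) = - y by rewrite /y; field; rewrite s0.
rewrite expRD [`|x| * _]mulrC -!mulrA [leRHS]mulrCA.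
rewrite ler_wpM2l ?normal_peak_ge0// mulrA ler_wpM2r ?expR_ge0//.
rewrite expRN ler_pdivrMr ?expR_gt0//.
apply: (@le_trans _ _ (`|s| * (1 + y))); last by rewrite ler_wpM2l// expR_ge1Dx.
rewrite -subr_ge0 (_ : _ - _ = `|s| * (1 - `|x| / (`|s| * 2)) ^+ 2).
  by rewrite mulr_ge0// sqr_ge0.
have -> : y = `|x| ^+ 2 / (`|s| ^+ 2 *+ 4) by rewrite /y !real_normK ?num_real.
by field; rewrite gt_eqF.
Qed.

Lemma measurable_absq : measurable_fun setT (fun x : R => `|x| * q x).
Proof.
apply: measurable_funM; last exact: measurable_q.
exact: continuous_measurable_fun (@norm_continuous _ R^o).
Qed.

Lemma integrable_absq : mu.-integrable setT (EFin \o (fun x => `|x| * q x)).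
Proof.
have [K K0 hK] := abs_q_bound.
have I2 : mu.-integrable setT (fun x => (K * normal_pdf 0 (s * Num.sqrt 2) x)%:E).
  by under eq_fun do rewrite EFinM; apply: integrableZl => //; exact: integrable_normal_pdf.
apply: (le_integrable _ _ _ I2) => //; first by apply/measurable_EFinP; exact: measurable_absq.
move=> x _; rewrite /comp !abse_EFin lee_fin.
rewrite (ger0_norm (mulr_ge0 (normr_ge0 x) (q_ge0 x))).
exact: le_trans (hK x) (ler_norm _).
Qed.

Lemma integrable_dom (f g : R -> R) : measurable_fun setT f ->
  mu.-integrable setT (EFin \o g) -> (forall x, `|f x| <= g x) ->
  mu.-integrable setT (EFin \o f).
Proof.
move=> mf Ig fg; apply: (le_integrable _ _ _ Ig) => //; first exact/measurable_EFinP.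
by move=> x _ /=; rewrite lee_fin (le_trans (fg x))// ler_norm.
Qed.


(** The fundamental theorem of calculus on growing symmetric intervals, combined with domination by
    |g|. The index [n.+1] keeps the intervals nondegenerate. *)
Lemma integral_derive0 (G g : R -> R) : (forall x : R, is_derive x 1 G (g x)) ->
  continuous g -> mu.-integrable setT (EFin \o g) ->
  G n%:R @[n --> \oo] --> (0 : R) -> G (- n%:R) @[n --> \oo] --> (0 : R) ->
  \int[mu]_x g x = 0.
Proof.
move=> dG cg Ig Gp Gm.
have cG : continuous G.
  move=> x; apply: differentiable_continuous; apply/derivable1_diffP.
  by have [] := dG x.
pose D (n : nat) : set R := `[(- n.+1%:R)%R, n.+1%:R%R]%classic.
pose f_ n x := ((EFin \o g) \_ (D n)) x.
have mg : measurable_fun setT (EFin \o g) by exact: measurable_int Ig.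
have IE : (\int[mu]_x f_ n x)%E @[n --> \oo] --> (\int[mu]_x (EFin \o g) x)%E.
  apply: (@dominated_cvg _ _ _ mu setT _ _ _ (fun x => `|g x|%:E)) => //.
  - move=> n; apply/(measurable_restrictT _ _).1; first exact: measurable_itv.
    exact: measurable_funTS mg.
  - move=> x _; apply: cvg_near_cst.
    exists (Num.bound `|x|) => // n /= hn; rewrite /f_ patchE ifT//.
    rewrite inE /D /= in_itv/= -ler_norml ltW//.
    apply: lt_le_trans (archi_boundP (normr_ge0 x)) _.
    by rewrite ler_nat (leq_trans hn).
  - by have := integrable_norm Ig.
  - move=> n x _; rewrite /f_ patchE; case: ifP => _ //=.
    by rewrite normr0 lee_fin.
have Fn n : (\int[mu]_x f_ n x = (G n.+1%:R - G (- n.+1%:R))%:E)%E.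
  rewrite -integral_mkcond EFinB; apply: continuous_FTC2.
  - by rewrite (@lt_trans _ _ 0)// ?oppr_lt0 ltr0n.
  - exact: continuous_subspaceT.
  - split; first by move=> x _; have [] := dG x.
    + by apply: cvg_at_right_filter; exact: cG.
    + by apply: cvg_at_left_filter; exact: cG.
  - by move=> x _; rewrite derive1E; have [_ ->] := dG x.
have GE : (G n.+1%:R - G (- n.+1%:R))%:E @[n --> \oo] --> (0 : R)%:E.
  apply: cvg_EFin; first exact: nearW.
  rewrite -[0](subrr 0); apply: cvgB.
  - by have := Gp; rewrite -(cvg_shiftS (fun n : nat => G n%:R)).
  - by have := Gm; rewrite -(cvg_shiftS (fun n : nat => G (- n%:R))).
have E0 : (\int[mu]_x (EFin \o g) x)%E = 0%E.
  apply: (cvg_unique _ IE) => //.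
  by rewrite (_ : (fun n => _) = fun n => (G n.+1%:R - G (- n.+1%:R))%:E)//; apply/funext.
by rewrite /Rintegral E0.
Qed.

(** Supplies the decay K / |x| of the boundary terms in [by_parts]. *)
Lemma q_small : exists2 K, 0 <= K & forall x, `|x| * q x <= K.
Proof.
have [K K0 hK] := abs_q_bound.
have s20 : s * Num.sqrt 2 != 0 by rewrite mulf_neq0// gt_eqF// sqrtr_gt0.
exists (K * normal_peak (s * Num.sqrt 2)).
  by rewrite mulr_ge0// normal_peak_ge0.
move=> x; apply: le_trans (hK x) _; rewrite ler_wpM2l//; exact: normal_pdf_ub.
Qed.

Lemma continuous_q : continuous q.
Proof. by rewrite -normal_pdf_q; exact: continuous_normal_pdf. Qed.

Lemma is_derive_q (x : R) : is_derive x 1 q (- (x / s ^+ 2) * q x).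
Proof.
pose h (y : R) := - y ^+ 2 / (s ^+ 2 *+ 2).
have dh : is_derive x 1 h (- (x / s ^+ 2)).
  rewrite /h; apply: is_derive_eq.
  rewrite ?scaler0 ?addr0 ?add0r /GRing.scale/=; field.
  by rewrite s0.
have := is_derive1_comp (@is_derive_expR R (h x)) dh => d1.
rewrite /q (_ : (fun y => _) = normal_peak s *: (expR \o h))//.
apply: is_derive_eq; rewrite /GRing.scale/= /h; ring.
Qed.

Variable th : R.
Let f (t x : R) := cos (th + t * x) * q x.
Let phi (t : R) := \int[mu]_x f t x.

Lemma is_derive_lin (a t x : R) : is_derive x 1 (fun x : R => a + t * x) t.
Proof.
apply: is_derive_eq; rewrite ?scaler0 ?addr0 ?add0r /GRing.scale/=; ring.
Qed.

Lemma is_derive_lin' (a t x : R) : is_derive x 1 (fun x : R => a + x * t) t.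
Proof.
rewrite (_ : (fun x => _) = (fun x : R => a + t * x)).
  exact: is_derive_lin.
by apply/funext => y; rewrite mulrC.
Qed.

Lemma continuous_lin (a t : R) : continuous (fun x : R => a + t * x).
Proof.
move=> x; apply: differentiable_continuous; apply/derivable1_diffP.
by have [] := is_derive_lin a t x.
Qed.

Lemma continuous_coslin (a t : R) : continuous (fun x : R => cos (a + t * x)).
Proof.
move=> x; apply: continuous_comp; [exact: continuous_lin|exact: continuous_cos].
Qed.

Lemma continuous_sinlin (a t : R) : continuous (fun x : R => sin (a + t * x)).
Proof.
move=> x; apply: continuous_comp; [exact: continuous_lin|exact: continuous_sin].
Qed.

Lemma is_derive_f (t x : R) : is_derive t 1 (f^~ x) (- (x * sin (th + t * x) * q x)).
Proof.
have d1 := @is_derive1_comp R cos (fun t : R => th + t * x) t _ _ (@is_derive_cos R (th + t * x)) (is_derive_lin' th x t).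
rewrite /f (_ : (fun t => _) = q x *: (cos \o (fun t => th + t * x))).
  by apply: is_derive_eq; rewrite /GRing.scale/=; ring.
by apply/funext => y; rewrite /GRing.scale/= mulrC.
Qed.

Lemma measurable_continuous (g : R -> R) : continuous g -> measurable_fun setT g.
Proof. exact: continuous_measurable_fun. Qed.

Lemma integrable_sin (t : R) : mu.-integrable setT (EFin \o (fun x => x * sin (th + t * x) * q x)).
Proof.
apply: (integrable_dom _ integrable_absq).
  apply: measurable_continuous => x; apply: cvgM; last exact: continuous_q.
  by apply: cvgM; [exact: cvg_id|exact: continuous_sinlin].
move=> x; rewrite normrM (ger0_norm (q_ge0 x)) normrM ler_wpM2r ?q_ge0//.
by rewrite ler_piMr// sin_max.
Qed.

Lemma integrable_cos (t : R) : mu.-integrable setT (EFin \o f t).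
Proof.
apply: (integrable_dom _ integrable_q).
  apply: measurable_continuous => x; apply: cvgM; last exact: continuous_q.
  exact: continuous_coslin.
move=> x; rewrite normrM (ger0_norm (q_ge0 x)).
by rewrite ler_piMl ?q_ge0// cos_max.
Qed.

Lemma cvg_inv_nat (K : R) : K / n%:R @[n --> \oo] --> (0 : R).
Proof.
rewrite -[0](mulr0 K); apply: cvgM; first exact: cvg_cst.
rewrite -(cvg_shiftS (fun n : nat => n%:R^-1 : R)).
exact: cvg_harmonic.
Qed.

(** The derivative of sin(th + t x) q(x) is t f(t, x) minus the integrand divided by s^2, and it
    integrates to zero. *)
Lemma by_parts (t : R) :
  \int[mu]_x (x * sin (th + t * x) * q x) = s ^+ 2 * t * phi t.
Proof.
pose G (x : R) := sin (th + t * x) * q x.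
pose g (x : R) := t * f t x - (s ^+ 2)^-1 * (x * sin (th + t * x) * q x).
have dG (x : R) : is_derive x 1 G (g x).
  have d1 := @is_derive1_comp R sin (fun x : R => th + t * x) x _ _ (@is_derive_sin R (th + t * x)) (is_derive_lin th t x).
  have d2 := is_derive_q x.
  rewrite /G (_ : (fun x => _) = ((sin \o (fun x => th + t * x)) * q))//.
  apply: is_derive_eq; rewrite /g /f /GRing.scale/=; ring.
have If : mu.-integrable setT (EFin \o (fun x => t * f t x)).
  rewrite (_ : EFin \o _ = fun x => (t%:E * (f t x)%:E)%E)//.
  by apply: integrableZl => //; exact: integrable_cos.
have Is : mu.-integrable setT (EFin \o (fun x => (s ^+ 2)^-1 * (x * sin (th + t * x) * q x))).
  rewrite (_ : EFin \o _ = fun x => ((s ^+ 2)^-1%:E * (x * sin (th + t * x) * q x)%:E)%E)//.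
  by apply: integrableZl => //; exact: integrable_sin.
have [K K0 hK] := q_small.
have Gx x : x != 0 -> `|G x| <= K / `|x|.
  move=> x0; rewrite /G normrM (ger0_norm (q_ge0 x)).
  apply: (@le_trans _ _ (q x)); first by rewrite ler_piMl ?q_ge0// sin_max.
  by rewrite ler_pdivlMr ?normr_gt0// mulrC.
have cvgG (u : R^nat) : (forall n, `|u n| = n%:R) -> G (u n) @[n --> \oo] --> (0 : R).
  move=> un; apply: norm_cvg0; apply: (@squeeze_cvgr _ _ _ _ (cst 0) (fun n => K / n%:R)).
  - near=> n; rewrite normr_ge0/= -un Gx// -normr_gt0 un ltr0n.
    by near: n; exact: nbhs_infty_gt.
  - exact: cvg_cst.
  - exact: cvg_inv_nat.
have I0 : \int[mu]_x g x = 0.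
  apply: (@integral_derive0 G g) => //.
  - move=> x; apply: cvgB; apply: cvgM; try exact: cvg_cst.
      by apply: cvgM; [exact: continuous_coslin|exact: continuous_q].
    apply: cvgM; last exact: continuous_q.
    by apply: cvgM; [exact: cvg_id|exact: continuous_sinlin].
  - rewrite (_ : EFin \o _ = fun x => ((t * f t x)%:E - ((s ^+ 2)^-1 * (x * sin (th + t * x) * q x))%:E)%E)//.
    exact: integrableB.
  - by apply: cvgG => n; rewrite ger0_norm.
  - by apply: cvgG => n; rewrite normrN ger0_norm.
move: I0; rewrite /g RintegralB// RintegralZl//; last exact: integrable_cos.
rewrite RintegralZl//; last exact: integrable_sin.
rewrite -/(phi t) => /eqP; rewrite subr_eq0 => /eqP h.
have ss0 : s ^+ 2 != 0 by rewrite expf_neq0.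
by rewrite -mulrA h mulVKf.
Unshelve. all: by end_near. Qed.

Lemma is_derive_phi (t : R) : is_derive t 1 phi (- (s ^+ 2 * t * phi t)).
Proof.
have tI : `]t - 1, t + 1[%classic t by rewrite /= in_itv/= ltrBlDr ltrDl ltr01.
have d1f u x : partial1of2 f u x = - (x * sin (th + u * x) * q x).
  by rewrite /partial1of2 derive1E; have [_ ->] := is_derive_f u x.
have h1 : forall u, `]t - 1, t + 1[%classic u -> mu.-integrable setT (EFin \o f u).
  by move=> u _; exact: integrable_cos.
have h2 : forall u x, `]t - 1, t + 1[%classic u -> setT x -> derivable (f^~ x) u 1.
  by move=> u x _ _; have [] := is_derive_f u x.
have h3 : forall x, 0 <= `|x| * q x by move=> x; rewrite mulr_ge0// q_ge0.
have h4 : forall u x, `]t - 1, t + 1[%classic u -> setT x -> `|partial1of2 f u x| <= `|x| * q x.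
  move=> u x _ _; rewrite d1f normrN normrM (ger0_norm (q_ge0 x)) normrM ler_wpM2r ?q_ge0//.
  by rewrite ler_piMr// sin_max.
have D := @derivable_under_integral R _ _ mu f setT measurableT t (t - 1) (t + 1) tI h1 h2 _ h3 integrable_absq h4.
have E := @differentiation_under_integral R _ _ mu f setT measurableT t (t - 1) (t + 1) tI h1 h2 _ h3 integrable_absq h4.
apply: DeriveDef; first exact: D.
rewrite -derive1E E -by_parts; under eq_Rintegral do rewrite d1f.
rewrite -[RHS]mulN1r -RintegralZl//; last exact: integrable_sin.
by apply: eq_Rintegral => x _; rewrite mulN1r.
Qed.

Lemma integral_q : \int[mu]_x q x = 1.
Proof.
by have := integral_normal_pdf 0 s; rewrite normal_pdf_q /Rintegral => ->.
Qed.

(** The product phi(t) exp(s^2 t^2 / 2) has zero derivative and equals cos th at t = 0. *)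
Lemma phiE (t : R) : phi t = cos th * expR (- (s ^+ 2 * t ^+ 2 / 2)).
Proof.
pose e (t : R) := s ^+ 2 * t ^+ 2 / 2.
have de (v : R) : is_derive v 1 e (s ^+ 2 * v).
  rewrite /e; apply: is_derive_eq.
  by rewrite ?scaler0 ?addr0 ?add0r /GRing.scale/=; field.
pose h (t : R) := phi t * expR (e t).
have dh (v : R) : is_derive v 1 h 0.
  have d1 := is_derive_phi v.
  have d2 := is_derive1_comp (@is_derive_expR R (e v)) (de v).
  rewrite /h (_ : (fun t => _) = phi * (expR \o e))//.
  apply: is_derive_eq; rewrite /GRing.scale/=; ring.
have := is_derive_0_is_cst t 0 dh; rewrite /h => ht.
have -> : phi t = h t * expR (- e t).
  by rewrite /h -mulrA -expRD subrr expR0 mulr1.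
rewrite /h ht /e expr0n/= mulr0 mul0r expR0 mulr1; congr (_ * _).
rewrite /phi (_ : (\int[mu]_x f 0 x) = \int[mu]_x (cos th * q x)).
  by rewrite RintegralZl// ?integral_q ?mulr1//; exact: integrable_q.
by apply: eq_Rintegral => x _; rewrite /f mul0r addr0.
Qed.

Lemma normal_char (t : R) :
  Ex (normal_prob 0 s) (fun x => cos (th + t * x)) = cos th * expR (- (s ^+ 2 * t ^+ 2 / 2)).
Proof.
rewrite -phiE /Ex integral_normal_prob ?normal_pdf_q//.
  by apply: measurable_continuous; exact: continuous_coslin.
by exists 1 => x; exact: cos_max.
Qed.

End NormalChar.

(** * Convergence in distribution *)

Section RandomMatrices.
Context {R : realType} {d : measure_display} {T : measurableType d}.
Variables (P : probability T R) (m n : nat).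
Implicit Types X : T -> 'M[R]_(m, n).

Definition entries_measurable X := forall i j, measurable_fun setT (fun w => X w i j).

Definition outside X K : set T := [set w | ~ forall i j, `|X w i j| <= K].

Lemma measurable_outside X K : entries_measurable X -> measurable (outside X K).
Proof.
move=> mX; rewrite /outside -[X in measurable X]/(~` [set w | forall i j, `|X w i j| <= K]).
apply: measurableC.
rewrite (_ : mkset _ = \bigcap_(ij in [set: 'I_m * 'I_n]) [set w | `|X w ij.1 ij.2| <= K]).
  apply: fin_bigcap_measurable => [|[i j] _]; first exact: finite_finset.
  rewrite (_ : mkset _ = setT `&` (fun w => `|X w i j|) @^-1` `]-oo, K]%classic).
    have := @measurableT_comp _ _ _ _ _ _ _ _ _ (@normr_measurable R setT) (mX i j).
    by apply => //; exact: measurable_itv.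
  by rewrite setTI; apply/seteqP; split => w /=; rewrite in_itv.
by apply/seteqP; split => [w h [i j] _|w h i j]; [exact: h|exact: (h (i, j))].
Qed.

(** Continuity from above: the sets [outside X k] decrease to the empty set. *)
Lemma outside_tail X e : entries_measurable X -> 0 < e ->
  exists2 K, 0 < K & fine (P (outside X K)) <= e.
Proof.
move=> mX e0; pose F (k : nat) := outside X k%:R.
have mF k : measurable (F k) by exact: measurable_outside.
have F0 : \bigcap_k F k = set0.
  rewrite -subset0 => w h.
  pose M := \sum_i \sum_j `|X w i j|.
  have M0 : 0 <= M by apply: sumr_ge0 => i _; apply: sumr_ge0.
  have := h (Num.bound M) I; apply => i j.
  apply: (@le_trans _ _ M); last by apply: ltW; exact: archi_boundP.
  exact: (@ler_sum_entries _ _ _ (fun i j => `|X w i j|)).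
have : P (F k) @[k --> \oo] --> P (\bigcap_k F k).
  apply: nonincreasing_cvg_mu => //.
  - exact: le_lt_trans (probability_le1 _ (mF _)) (ltry _).
  - by rewrite F0.
  - move=> k l kl; apply/subsetPset => w /= h1 h2; apply: h1 => i j.
    by apply: le_trans (h2 i j) _; rewrite ler_nat.
rewrite F0 measure0 => /fine_cvgP[_ /cvgr0_norm_le/(_ _ e0)[k0 _ hk]].
exists (k0.+1)%:R; first by rewrite ltr0n.
by have := hk k0.+1 (leqnSn _) => /= /(le_trans (ler_norm _)).
Qed.

Lemma measurable_dot X t : entries_measurable X -> measurable_fun setT (fun w => dot t (X w)).
Proof.
move=> mX; apply: measurable_sum => i; apply: measurable_sum => j.
by apply: measurable_funM => //; exact: mX.
Qed.

Lemma bmf_wave X w : entries_measurable X -> bmf (fun x => wave w (X x)).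
Proof.
move=> mX; rewrite /wave; apply: bmfZ; apply: bmf_cos.
by apply: measurable_funD => //; exact: measurable_dot.
Qed.

Lemma bmf_trigpoly X q : entries_measurable X -> trigpoly q -> bmf (fun x => q (X x)).
Proof.
move=> mX [s qs]; rewrite (_ : (fun x => _) = fun x => \sum_(w <- s) wave w (X x)).
  by apply: bmf_sum => w; exact: bmf_wave.
by apply/funext.
Qed.

(** Measurability is only known entry by entry. The composition inherits it as a pointwise limit of
    trigonometric polynomials that approximate f on growing cubes. *)
Lemma bmf_continuous X (f : 'M[R]_(m, n) -> R) C : entries_measurable X -> continuous f ->
  (forall x, `|f x| <= C) -> bmf (fun x => f (X x)).
Proof.
move=> mX cf fC; split; last by exists C.
have e0 (k : nat) : 0 < k.+1%:R^-1 :> R by rewrite invr_gt0.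
have k0 (k : nat) : 0 < k.+1%:R :> R by rewrite ltr0n.
pose q k := projT1 (cid (trigpoly_approx cf fC (k0 k) (e0 k))).
have hq k := projT2 (cid (trigpoly_approx cf fC (k0 k) (e0 k))).
apply: (@measurable_fun_cvg _ _ _ _ (fun k w => q k (X w))) => [k|w _].
  by have [/(bmf_trigpoly mX)[]] := hq k.
apply/cvgrPdist_le => /= e e_gt0.
pose M := \sum_i \sum_j `|X w i j|.
have M0 : 0 <= M by apply: sumr_ge0 => i _; apply: sumr_ge0.
have XM i j : `|X w i j| <= M by exact: (@ler_sum_entries _ _ _ (fun i j => `|X w i j|)).
near=> k; rewrite distrC.
have [_ _ h] := hq k; apply: le_trans (h (X w) _) _.
  move=> i j; apply: le_trans (XM i j) _; apply: ltW.
  apply: lt_le_trans (archi_boundP M0) _; rewrite ler_nat.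
  by apply: leqW; near: k; exact: nbhs_infty_ge.
near: k; have := @cvg_harmonic R; move/cvgr0_norm_le => /(_ _ e_gt0).
apply: filterS => k; by rewrite /harmonic/= ger0_norm// ltW.
Unshelve. all: by end_near. Qed.

End RandomMatrices.

(** * From convergence on waves to convergence in distribution *)

Section Levy.
Context {R : realType}.
Variables (m n : nat).

Lemma Ex_trigpoly_cvg d (T : measurableType d) (P : probability T R)
    d' (T' : measurableType d') (P' : probability T' R)
    (X : nat -> T -> 'M[R]_(m, n)) (A : T' -> 'M[R]_(m, n)) q :
  (forall k, entries_measurable (X k)) -> entries_measurable A ->
  (forall w, Ex P (fun x => wave w (X k x)) @[k --> \oo] --> Ex P' (fun x => wave w (A x))) ->
  trigpoly q ->
  Ex P (fun x => q (X k x)) @[k --> \oo] --> Ex P' (fun x => q (A x)).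
Proof.
move=> mX mA XA [s qs].
have E1 k : Ex P (fun x => q (X k x)) = \sum_(w <- s) Ex P (fun x => wave w (X k x)).
  rewrite -Ex_sum; last by move=> w; exact: bmf_wave.
  by congr Ex; apply/funext.
have -> : Ex P' (fun x => q (A x)) = \sum_(w <- s) Ex P' (fun x => wave w (A x)).
  rewrite -Ex_sum; last by move=> w; exact: bmf_wave.
  by congr Ex; apply/funext.
under eq_fun do rewrite E1.
exact: cvgr_bigsum.
Qed.

Lemma levy_cvg d (T : measurableType d) (P : probability T R)
    d' (T' : measurableType d') (P' : probability T' R)
    (X : nat -> T -> 'M[R]_(m, n)) (A : T' -> 'M[R]_(m, n)) f C :
  (forall k, entries_measurable (X k)) -> entries_measurable A ->
  (forall w, Ex P (fun x => wave w (X k x)) @[k --> \oo] --> Ex P' (fun x => wave w (A x))) ->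
  (forall e, 0 < e -> exists2 K, 0 < K &
     \forall k \near \oo, fine (P (outside (X k) K)) <= e) ->
  continuous f -> (forall x, `|f x| <= C) ->
  Ex P (fun x => f (X k x)) @[k --> \oo] --> Ex P' (fun x => f (A x)).
Proof.
move=> mX mA XA tX cf fC; apply/cvgrPdist_le => /= e e0.
have C0 : 0 <= C := le_trans (normr_ge0 _) (fC 0).
(* One e' pays for the convergence of q, and e' + 2 C e' for each of the two replacements of f by q:
   3 + 4 C in all. *)
pose e' := e / (3 + C *+ 4).
have D0 : 0 < 3 + C *+ 4 by rewrite ltr_pwDl// mulrn_wge0.
have e'0 : 0 < e' by rewrite divr_gt0.
have [K1 K10 hK1] := tX _ e'0.
have [K2 K20 hK2] := outside_tail P' mA e'0.
pose K := Num.max K1 K2.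
have K0 : 0 < K by rewrite lt_max K10.
have [q [tq qC qf]] := trigpoly_approx cf fC K0 e'0.
have close d0 (T0 : measurableType d0) (P0 : probability T0 R) (Y : T0 -> 'M[R]_(m, n)) K0' :
    entries_measurable Y -> K0' <= K -> fine (P0 (outside Y K0')) <= e' ->
    `|Ex P0 (fun x => q (Y x)) - Ex P0 (fun x => f (Y x))| <= e' + C *+ 2 * e'.
  move=> mY KK hP; apply: le_trans (@Ex_close _ _ _ P0 _ _ (outside Y K0') e' C _ _ _ _ _ _ _) _.
  - exact: bmf_trigpoly.
  - exact: bmf_continuous fC.
  - exact: measurable_outside.
  - move=> w /contrapT h; apply: qf => i j; exact: le_trans (h i j) KK.
  - exact: ltW.
  - by move=> w; exact: qC.
  - by move=> w; exact: fC.
  - by rewrite lerD2l ler_wpM2l// mulrn_wge0.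
have /cvgrPdist_le/(_ _ e'0) hq := Ex_trigpoly_cvg mX mA XA tq.
near=> k.
have h1 : `|Ex P' (fun x => q (A x)) - Ex P (fun x => q (X k x))| <= e' by near: k.
have h2 : fine (P (outside (X k) K1)) <= e' by near: k.
have h3 := close _ _ P (X k) K1 (mX k) ltac:(by rewrite le_max lexx) h2.
have h4 := close _ _ P' A K2 mA ltac:(by rewrite le_max lexx orbT) hK2.
have -> : e = e' + (e' + C *+ 2 * e') + (e' + C *+ 2 * e').
  have eE : e = e' * (3 + C *+ 4) by rewrite divfK// gt_eqF.
  by rewrite [LHS]eE; ring.
move: h1 h3 h4.
move: (Ex P' (fun x => q (A x))) (Ex P (fun x => q (X k x))) => a b.
move: (Ex P' (fun x => f (A x))) (Ex P (fun x => f (X k x))) => c z h1 h3 h4.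
have -> : c - z = (a - b) + (b - z) - (a - c) by ring.
apply: le_trans (ler_normB _ _) _; apply: lerD h4.
by apply: le_trans (ler_normD _ _) _; apply: lerD h1 h3.
Unshelve. all: by end_near. Qed.

End Levy.

(** * Uniqueness of a law on the line *)

Section CharacteristicFunction.
Context {R : realType}.

(* The clamp of 1 - k (x - a) to [0, 1]. *)
Definition ramp (a : R) (k : nat) (x : R) : R :=
  let y := 1 - k%:R * (x - a) in (`|y| - `|y - 1| + 1) / 2.

Lemma ramp_cont a k : continuous (ramp a k).
Proof.
have c1 : continuous (fun x : R => 1 - k%:R * (x - a)).
  move=> x; apply: cvgB; first exact: cvg_cst.
  apply: cvgM; first exact: cvg_cst.
  by apply: cvgB; [exact: cvg_id|exact: cvg_cst].
move=> x; apply: cvgM; last exact: cvg_cst.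
apply: cvgD; last exact: cvg_cst.
apply: cvgB; apply: cvg_norm; first exact: c1.
by apply: cvgB; [exact: c1|exact: cvg_cst].
Qed.

Lemma ramp01 a k x : 0 <= ramp a k x <= 1.
Proof.
rewrite /ramp; set y := 1 - _.
have := ler_normB y (y - 1); rewrite opprB addrCA subrr addr0 normr1 => h1.
have h2 : `|y| <= `|y - 1| + 1 by have := ler_normD (y - 1) 1; rewrite subrK normr1.
have h3 : `|y - 1| <= `|y| + 1 by have := ler_normB y 1; rewrite normr1.
by clear h1; apply/andP; split; lra.
Qed.

Lemma ramp1 a k x : x <= a -> ramp a k x = 1.
Proof.
move=> xa; rewrite /ramp.
have h : 0 <= k%:R * (a - x) by rewrite mulr_ge0// subr_ge0.
have -> : 1 - k%:R * (x - a) = k%:R * (a - x) + 1 by ring.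
by rewrite addrK !ger0_norm ?addr_ge0//; field.
Qed.

Lemma ramp0 a k x : a + k.+1%:R^-1 < x -> ramp a k.+1 x = 0.
Proof.
move=> xa; rewrite /ramp.
have k0 : 0 < k.+1%:R :> R by rewrite ltr0n.
have h : 1 < k.+1%:R * (x - a).
  by rewrite mulrC -ltr_pdivrMr// div1r ltrBrDl.
rewrite ler0_norm ?subr_le0 1?ltW// ler0_norm; first by field.
by rewrite addrAC subrr sub0r oppr_le0 (le_trans ler01)// ltW.
Qed.

Section Rays.
Context {d : measure_display} {T : measurableType d}.
Variables (P : probability T R) (X : T -> R).

Lemma measurable_ray b : measurable_fun setT X -> measurable (X @^-1` `]-oo, b]%classic).
Proof.
by move=> mX; rewrite -[X in measurable X]setTI; apply: mX => //; exact: measurable_itv.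
Qed.

Lemma ray_le_ramp a k :
  measurable_fun setT X ->
  fine (P (X @^-1` `]-oo, a]%classic)) <= Ex P (fun x => ramp a k (X x)).
Proof.
move=> mX; have mA := measurable_ray a mX.
rewrite -Ex_indic//; apply: Ex_le; first exact: bmf_indic.
  apply: (@bmf_bounded _ _ _ (ramp a k) _ 1) => //.
    exact: continuous_measurable_fun (@ramp_cont a k).
  by move=> x; have /andP[h1 h2] := ramp01 a k x; rewrite ger0_norm.
move=> w; rewrite indicE; have [|_] := boolP (w \in _); last by have /andP[] := ramp01 a k (X w).
by rewrite inE/= in_itv/= => /ramp1 ->.
Qed.

Lemma ramp_le_ray a k :
  measurable_fun setT X ->
  Ex P (fun x => ramp a k.+1 (X x)) <= fine (P (X @^-1` `]-oo, a + k.+1%:R^-1]%classic)).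
Proof.
move=> mX; have mA := measurable_ray (a + k.+1%:R^-1) mX.
rewrite -Ex_indic//; apply: Ex_le; last 1 first.
- move=> w; rewrite indicE; have [_|] := boolP (w \in _); first by have /andP[] := ramp01 a k.+1 (X w).
  by rewrite notin_setE/= in_itv/= => /negP; rewrite -ltNge => /ramp0 ->.
- apply: (@bmf_bounded _ _ _ (ramp a k.+1) _ 1) => //.
    exact: continuous_measurable_fun (@ramp_cont a k.+1).
  by move=> x; have /andP[h1 h2] := ramp01 a k.+1 x; rewrite ger0_norm.
- exact: bmf_indic.
Qed.

Lemma cvg_ray a :
  measurable_fun setT X ->
  fine (P (X @^-1` `]-oo, a + k.+1%:R^-1]%classic)) @[k --> \oo] --> fine (P (X @^-1` `]-oo, a]%classic)).
Proof.
move=> mX; have mA b := measurable_ray b mX.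
apply: fine_cvg; rewrite fineK ?fin_num_measure//.
pose F (k : nat) := X @^-1` `]-oo, a + k.+1%:R^-1]%classic.
have -> : X @^-1` `]-oo, a]%classic = \bigcap_k F k.
  apply/seteqP; split=> w /=; rewrite /F /= in_itv/=.
    by move=> h k _ /=; rewrite in_itv/= (le_trans h)// lerDl.
  move=> h; apply/ler_addgt0Pr => e e0.
  have /cvgr0_norm_le/(_ _ e0)[k0 _ hk] := @cvg_harmonic R.
  have := hk k0 (leqnn _); rewrite /harmonic/= ger0_norm// => hk'.
  have := h k0 I; rewrite /F/= in_itv/= => h'.
  by apply: le_trans h' _; rewrite lerD2l.
apply: nonincreasing_cvg_mu => //.
- exact: le_lt_trans (probability_le1 _ (mA _)) (ltry _).
- by apply: bigcap_measurable => // k _; exact: mA.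
- move=> k l kl; apply/subsetPset => w /=; rewrite /F/= !in_itv/= => h.
  by apply: le_trans h _; rewrite lerD2l lef_pV2 ?posrE// ler_nat.
Qed.

End Rays.

(** Half-open intervals form a generating class stable under intersection, and each is a difference
    of two rays. *)
Lemma law_unique d1 (T1 : measurableType d1) (P1 : probability T1 R) (X1 : T1 -> R)
    d2 (T2 : measurableType d2) (P2 : probability T2 R) (X2 : T2 -> R) :
  measurable_fun setT X1 -> measurable_fun setT X2 ->
  (forall a, P1 (X1 @^-1` `]-oo, a]%classic) = P2 (X2 @^-1` `]-oo, a]%classic)) ->
  forall B : set R, measurable B -> P1 (X1 @^-1` B) = P2 (X2 @^-1` B).
Proof.
move=> mX1 mX2 rays.
pose M1 : {mfun T1 >-> measurableTypeR R} :=
  HB.pack_for {mfun T1 >-> measurableTypeR R} X1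
    (isMeasurableFun.Build _ _ T1 (measurableTypeR R) X1 mX1).
pose M2 : {mfun T2 >-> measurableTypeR R} :=
  HB.pack_for {mfun T2 >-> measurableTypeR R} X2
    (isMeasurableFun.Build _ _ T2 (measurableTypeR R) X2 mX2).
move=> B mB.
apply: (@measure_unique _ R (measurableTypeR R) (@ocitv R)
  (fun k => `](- k%:R)%R, k%:R%R]%classic) _ _ _ _
  (pushforward P1 M1) (pushforward P2 M2)) => //.
- exact: ocitvI.
- by move=> k; exact: is_ocitv.
- apply/seteqP; split=> // x _; exists (Num.bound `|x|).+1 => //=.
  rewrite in_itv/=; have h := archi_boundP (normr_ge0 x).
  have : `|x| < (Num.bound `|x|).+1%:R by apply: lt_trans h _; rewrite ltr_nat.
  by rewrite ltr_norml => /andP[-> /ltW].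
- move=> _ [[a b] _ <-] /=; rewrite /pushforward.
  have [ba|ab] := leP b a.
    by rewrite set_itv_ge ?preimage_set0 ?measure0// bnd_simp -leNgt.
  have -> : `]a, b]%classic = `]-oo, b]%classic `\` `]-oo, a]%classic.
    by rewrite -[RHS]setCK setCD setCitvl setUC -[LHS]setCK setCitv.
  have sub d (T : measurableType d) (X : T -> R) :
      X @^-1` `]-oo, b]%classic `&` X @^-1` `]-oo, a]%classic = X @^-1` `]-oo, a]%classic.
    by rewrite setIidr//; apply: preimage_subset; apply: subset_itvl; rewrite bnd_simp ltW.
  have preD (T : Type) (X : T -> R) (E F : set R) : X @^-1` (E `\` F) = X @^-1` E `\` X @^-1` F by [].
  rewrite !preD !measureD ?sub//=; try exact: measurable_ray.
  + by rewrite !rays.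
  + by rewrite -ge0_fin_numE// fin_num_measure//; exact: measurable_ray.
  + by rewrite -ge0_fin_numE// fin_num_measure//; exact: measurable_ray.
- by move=> k; apply: le_lt_trans (probability_le1 _ _) (ltry _);
    have := mX1 measurableT; rewrite /pushforward => h;
    rewrite -[X in measurable X]setTI; apply: h; exact: measurable_itv.
Qed.

(** [levy_cvg] for a constant sequence of 1 x 1 matrices equates the expectations of bounded
    continuous functions; ramps then squeeze the indicators of rays. *)
Lemma char_unique d1 (T1 : measurableType d1) (P1 : probability T1 R) (X1 : T1 -> R)
    d2 (T2 : measurableType d2) (P2 : probability T2 R) (X2 : T2 -> R) :
  measurable_fun setT X1 -> measurable_fun setT X2 ->
  (forall th t, Ex P1 (fun x => cos (th + t * X1 x)) = Ex P2 (fun x => cos (th + t * X2 x))) ->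
  forall B : set R, measurable B -> P1 (X1 @^-1` B) = P2 (X2 @^-1` B).
Proof.
move=> mX1 mX2 X12.
pose Y1 w : 'M[R]_1 := const_mx (X1 w); pose Y2 w : 'M[R]_1 := const_mx (X2 w).
have mY1 : entries_measurable Y1.
  by move=> i j; rewrite (_ : (fun w => _) = X1)//; apply/funext => w; rewrite mxE.
have mY2 : entries_measurable Y2.
  by move=> i j; rewrite (_ : (fun w => _) = X2)//; apply/funext => w; rewrite mxE.
have Ef (f : R -> R) C : continuous f -> (forall x, `|f x| <= C) ->
    Ex P1 (fun x => f (X1 x)) = Ex P2 (fun x => f (X2 x)).
  move=> cf fC; pose g (M : 'M[R]_1) := f (M 0 0).
  have cg : continuous g.
    by move=> M; apply: continuous_comp; [exact: coord_continuous|exact: cf].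
  have := @levy_cvg R 1 1 _ _ P1 _ _ P2 (fun=> Y1) Y2 g C (fun=> mY1) mY2 _ _ cg (fun x => fC _).
  have -> : (fun x => g (Y1 x)) = fun x => f (X1 x) by apply/funext => x; rewrite /g mxE.
  have -> : (fun x => g (Y2 x)) = fun x => f (X2 x) by apply/funext => x; rewrite /g mxE.
  move=> h; apply: (@cvg_unique _ (@Rhausdorff R) (Ex P1 (fun x => f (X1 x)) @[k --> \oo])).
    exact: cvg_cst.
  apply: h.
    move=> w; have wE (x : R) : wave w (const_mx x : 'M[R]_1) = w.1.1 * cos (w.2 + w.1.2 0 0 * x).
      by rewrite /wave /dot !big_ord1 mxE.
    rewrite (_ : (fun x => wave w (Y1 x)) = fun x => w.1.1 * cos (w.2 + w.1.2 0 0 * X1 x)); last by apply/funext => x; rewrite wE.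
    rewrite (_ : (fun x => wave w (Y2 x)) = fun x => w.1.1 * cos (w.2 + w.1.2 0 0 * X2 x)); last by apply/funext => x; rewrite wE.
    rewrite !ExZ; last 2 first.
    - by apply: bmf_cos; apply: measurable_funD => //; apply: measurable_funM.
    - by apply: bmf_cos; apply: measurable_funD => //; apply: measurable_funM.
    by rewrite X12; exact: cvg_cst.
  move=> e e0; have [K K0 hK] := outside_tail P1 mY1 e0.
  by exists K => //; near=> k.
have ray_sub d (T : measurableType d) (P : probability T R) (X : T -> R)
    d' (T' : measurableType d') (P' : probability T' R) (X' : T' -> R) a :
    measurable_fun setT X -> measurable_fun setT X' ->
    (forall f C, continuous f -> (forall x, `|f x| <= C) -> Ex P (fun x => f (X x)) = Ex P' (fun x => f (X' x))) ->
    fine (P (X @^-1` `]-oo, a]%classic)) <= fine (P' (X' @^-1` `]-oo, a]%classic)).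
  move=> mX mX' E; apply: (ler_cvg_to (cvg_cst _) (@cvg_ray _ _ P' X' a mX')).
  apply: nearW => k; apply: le_trans (ray_le_ramp P a k.+1 mX) _.
  rewrite (E _ 1); [exact: ramp_le_ray|exact: ramp_cont|].
  by move=> x; have /andP[h1 h2] := ramp01 a k.+1 x; rewrite ger0_norm.
have rays a : P1 (X1 @^-1` `]-oo, a]%classic) = P2 (X2 @^-1` `]-oo, a]%classic).
  have mA1 := measurable_ray a mX1; have mA2 := measurable_ray a mX2.
  rewrite -[LHS]fineK ?fin_num_measure// -[RHS]fineK ?fin_num_measure//; congr EFin.
  by apply/eqP; rewrite eq_le !ray_sub// => f C cf fC; rewrite (Ef f C).
exact: (law_unique (X1 := X1) (X2 := X2)).
Unshelve. all: by end_near. Qed.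

End CharacteristicFunction.

(** * The Gaussian limit *)

Section GaussianVectors.
Context {R : realType}.

Lemma Ex_prod d1 (T1 : measurableType d1) (P1 : probability T1 R)
    d2 (T2 : measurableType d2) (P2 : probability T2 R) (h : T1 * T2 -> R) :
  bmf h -> Ex (P1 \x P2)%E h = Ex P1 (fun x => Ex P2 (fun y => h (x, y))).
Proof.
move=> bh; have Ih := bmf_integrable (P1 \x P2)%E bh.
rewrite /Ex /Rintegral; congr fine.
have <- := integral12_prod_meas1 Ih.
apply: eq_integral => x _; rewrite /fubini_F fineK//.
apply: integrable_fin_num => //; apply: (@bmf_integrable _ _ _ P2).
have [mh [C hC]] := bh; split; last by exists C => y; exact: hC.
exact: measurableT_comp mh (pair1_measurable x).
Qed.

(** Only the joint characteristic function is recorded, as it encodes independence and is all that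
    the limit needs. Each induction step takes the product with a fresh standard normal law. *)
Lemma gaussian_vector (n : nat) :
  exists d (T : measurableType d) (P : probability T R) (g : nat -> T -> R),
    (forall i, measurable_fun setT (g i)) /\
    forall th (a : nat -> R), Ex P (fun w => cos (th + \sum_(i < n) a i * g i w))
      = cos th * expR (- (\sum_(i < n) a i ^+ 2) / 2).
Proof.
elim: n => [|n [d [T [P [g [mg hg]]]]]].
  exists _, _, (normal_prob 0 1 : probability _ R), (fun _ => cst 0); split=> // th a.
  rewrite (_ : (fun w => _) = cst (cos th)); last by apply/funext => w; rewrite big_ord0 addr0.
  by rewrite Ex_cst big_ord0 oppr0 mul0r expR0 mulr1.
pose Q : probability _ R := normal_prob 0 1.
exists _, _, (P \x Q)%E, (fun i w => if i == n then w.2 else g i w.1); split.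
  move=> i; case: eqP => _; first exact: measurable_snd.
  exact: measurableT_comp (mg i) measurable_fst.
move=> th a.
have mS : measurable_fun setT (fun w => \sum_(i < n) a i * g i w).
  by apply: measurable_sum => i; apply: measurable_funM.
have E (w : T * _) : \sum_(i < n.+1) a i * (if i == n :> nat then w.2 else g i w.1) =
    \sum_(i < n) a i * g i w.1 + a n * w.2.
  rewrite big_ord_recr/= eqxx; congr (_ + _); apply: eq_bigr => i _.
  by rewrite ltn_eqF.
rewrite (_ : (fun w => _) = fun w => cos (th + (\sum_(i < n) a i * g i w.1 + a n * w.2)));
  last by apply/funext => w; rewrite E.
rewrite Ex_prod; last first.
  apply: bmf_cos; apply: measurable_funD => //; apply: measurable_funD.
    exact: measurableT_comp mS measurable_fst.
  by apply: measurable_funM => //; exact: measurable_snd.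
pose c := expR (- (a n ^+ 2 / 2)).
rewrite (_ : (fun x => _) = fun x => c * cos (th + \sum_(i < n) a i * g i x)); last first.
  apply/funext => x; rewrite mulrC /c -[a n ^+ 2]mul1r -[X in X * a n ^+ 2](expr1n _ 2).
  rewrite -normal_char ?oner_neq0//; congr (Ex _ _).
  by apply/funext => y /=; rewrite addrA.
rewrite ExZ; last by apply: bmf_cos; apply: measurable_funD.
rewrite hg mulrCA /c -expRD big_ord_recr/=; congr (_ * expR _).
by rewrite !mulNr -opprD -mulrDl addrC.
Qed.

(** For v = 0 the comparison variable is the constant 0, in accordance with the Dirac case of
    [gaussian_law]. *)
Lemma gaussian_lawP d (T : measurableType d) (P : probability T R) (X : T -> R) v :
  measurable_fun setT X -> 0 <= v ->
  (forall th t, Ex P (fun w => cos (th + t * X w)) = cos th * expR (- (v * t ^+ 2 / 2))) ->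
  forall B, measurable B -> P (X @^-1` B) = gaussian_law 0 v B.
Proof.
move=> mX v0 hX B mB; rewrite /gaussian_law; case: eqP => [v0'|/eqP vn].
  pose Q : probability (measurableTypeR R) R := normal_prob 0 1.
  rewrite (@char_unique R _ _ P X _ _ Q (cst 0)) => //.
    rewrite diracE; have [/set_mem B0|B0] := boolP (0 \in B).
      by rewrite (_ : cst 0 @^-1` B = setT) ?probability_setT//; apply/seteqP; split.
    rewrite (_ : cst 0 @^-1` B = set0) ?measure0//; rewrite -subset0 => x /= /mem_set.
    by rewrite (negbTE B0).
  move=> th t; rewrite hX v0' !mul0r oppr0 expR0 mulr1.
  rewrite (_ : (fun x => _) = cst (cos th)) ?Ex_cst//.
  by apply/funext => x; rewrite mulr0 addr0.
have sv0 : Num.sqrt v != 0 by rewrite gt_eqF// sqrtr_gt0 lt_def vn.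
rewrite (@char_unique R _ _ P X _ _ (normal_prob 0 (Num.sqrt v)) idfun) => //.
  exact: measurable_id.
by move=> th t; rewrite hX normal_char// sqr_sqrtr.
Qed.

End GaussianVectors.

(** * The limiting Gaussian matrix *)

Section GaussianLimit.
Context {R : realType} {N : nat}.
Variables (Ls : 'M[R]_N).
Hypotheses (pL : Ls \in posdefmx) (iL : irreducible_mx Ls).
Notation V := 'M[R]_N.
Let p := dpp_pmf Ls.
Let v := influence Ls.

Lemma tr_dot (A H : V) : \tr (A *m H) = dot H^T A.
Proof.
rewrite /dot /mxtrace; apply: eq_bigr => i _; rewrite mxE; apply: eq_bigr => j _.
by rewrite mxE mulrC.
Qed.

Lemma limit_matrix :
  exists d (T : measurableType d) (P : probability T R) (A : T -> V),
    [/\ entries_measurable A, forall w, A w \in symmx &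
     forall th t, Ex P (fun w => cos (th + dot t (A w))) =
       cos th * expR (- (\sum_J p J * dot t (v J) ^+ 2) / 2)].
Proof.
pose I := {set 'I_N}.
have [d [T [P [g [mg hg]]]]] := @gaussian_vector R #|{: I}|.
pose A w : V := \sum_(J : I) (Num.sqrt (p J) * g (enum_rank J) w) *: v J.
exists d, T, P, A; split.
- move=> i j; rewrite (_ : (fun w => _) = fun w => \sum_(J : I) (Num.sqrt (p J) * g (enum_rank J) w) * v J i j).
    apply: measurable_sum => J; apply: measurable_funM => //.
    by apply: measurable_funM.
  by apply/funext => w; rewrite summxE; apply: eq_bigr => J _; rewrite mxE.
- move=> w; rewrite inE /symmx /= /A; rewrite linear_sum/=; apply: eq_bigr => J _.
  by rewrite linearZ/= influence_sym.
move=> th t.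
(* [gaussian_vector] takes coefficients indexed by natural numbers; the default 0 lies outside the
   range of summation. *)
pose a (i : nat) := if insub i is Some k then Num.sqrt (p (enum_val (k : 'I_#|{: I}|))) * dot t (v (enum_val k)) else 0.
have aE (k : 'I_#|{: I}|) : a k = Num.sqrt (p (enum_val k)) * dot t (v (enum_val k)).
  by rewrite /a valK.
have sumE (F : I -> R) : \sum_J F J = \sum_(k < #|{: I}|) F (enum_val k).
  by rewrite (reindex (@enum_val I (mem {: I})))//; apply: onW_bij; exact: enum_val_bij.
have -> : \sum_J p J * dot t (v J) ^+ 2 = \sum_(k < #|{: I}|) a k ^+ 2.
  rewrite sumE; apply: eq_bigr => k _; rewrite aE exprMn sqr_sqrtr//.
  by apply: ltW; exact: dpp_gt0.
rewrite -hg; congr Ex; apply/funext => w; congr (cos (th + _)).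
have -> : dot t (A w) = \sum_J (Num.sqrt (p J) * g (enum_rank J) w) * dot t (v J).
  by rewrite dot_sum; apply: eq_bigr => J _; rewrite dotZr.
by rewrite sumE; apply: eq_bigr => k _; rewrite aE enum_valK; ring.
Qed.

Lemma limit_normal d (T : measurableType d) (P : probability T R) (A : T -> V) :
  entries_measurable A -> (forall w, A w \in symmx) ->
  (forall th t, Ex P (fun w => cos (th + dot t (A w))) =
       cos th * expR (- (\sum_J p J * dot t (v J) ^+ 2) / 2)) ->
  normal_random_symmx P A 0 (asymptotic_covariance Ls).
Proof.
move=> mA sA hA; split=> // H /set_mem /= sH B mB.
rewrite mul0mx mxtrace0 asymptotic_covarianceE//.
have E w : \tr (A w *m H) = dot H (A w) by rewrite tr_dot sH.
apply: gaussian_lawP => //.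
- rewrite (_ : (fun w => _) = fun w => dot H (A w)); last by apply/funext.
  exact: measurable_dot.
- by apply: sumr_ge0 => J _; rewrite mulr_ge0 ?sqr_ge0// ltW// dpp_gt0.
move=> th t.
rewrite (_ : (fun w => _) = fun w => cos (th + dot (t *: H) (A w))); last first.
  by apply/funext => w; rewrite E dotZl.
rewrite hA; congr (_ * expR _); rewrite mulNr; congr (- (_ / 2)).
rewrite mulr_suml; apply: eq_bigr => J _.
rewrite dotZl tr_dot sH -[dpp_pmf Ls J]/(p J) -[influence Ls J]/(v J).
by move: (p J) (dot H (v J)) => a b; ring.
Qed.

End GaussianLimit.

(** * Sums of independent observations *)

Section Taylor.
Context {R : realType}.

(** The points c are confined to the side of 0 where x lies: [expR_taylor2] can bound its derivative
    only there. *)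
Lemma mean_value_bound (F f : R -> R) (x M : R) :
  (forall c : R, is_derive c 1 F (f c)) -> F 0 = 0 ->
  (forall c, `|c| <= `|x| -> 0 <= c * x -> `|f c| <= M) -> `|F x| <= M * `|x|.
Proof.
move=> dF F0 fM.
have cF : continuous F.
  move=> y; apply: differentiable_continuous; apply/derivable1_diffP.
  by have [] := dF y.
have [x0|x0|x0] := ltgtP x 0; last by rewrite x0 F0 normr0 mulr0.
- have [c] := @MVT R F f x 0 x0 (fun c _ => dF c) (continuous_subspaceT cF).
  rewrite in_itv/= F0 !sub0r => /andP[xc c0] E.
  have -> : F x = f c * x by rewrite -[F x]opprK E mulrN opprK.
  rewrite normrM ler_wpM2r//; apply: fM; last by rewrite mulr_le0// ltW.
  by rewrite !ltr0_norm// lerN2 ltW.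
- have [c] := @MVT R F f 0 x x0 (fun c _ => dF c) (continuous_subspaceT cF).
  rewrite in_itv/= F0 !subr0 => /andP[c0 cx] ->.
  rewrite normrM ler_wpM2r//; apply: fM; last by rewrite mulr_ge0// ltW.
  by rewrite !gtr0_norm// ltW.
Qed.

Lemma is_derive_shift (th c : R) : is_derive c 1 (fun x : R => th + x) 1.
Proof.
rewrite (_ : (fun x => th + x) = cst th + id); last by apply/funext.
by apply: is_derive_eq; rewrite add0r.
Qed.

Lemma sin_taylor2 (th x : R) : `|sin (th + x) - sin th - x * cos th| <= `|x| * `|x|.
Proof.
apply: (@mean_value_bound (fun x => sin (th + x) - sin th - x * cos th)
  (fun x => cos (th + x) - cos th)).
- move=> c; have d1 := @is_derive1_comp R sin (fun x => th + x) c _ _ (@is_derive_sin R (th + c)) (is_derive_shift th c).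
  rewrite (_ : (fun x => _) = fun x => (sin \o (fun x => th + x)) x - sin th - x * cos th)//.
  by apply: is_derive_eq; rewrite /GRing.scale/=; ring.
- by rewrite addr0 subrr mul0r subrr.
move=> c cx _; apply: le_trans cx; apply: le_trans (cos_lip _ _) _.
by rewrite addrC addKr.
Qed.

Lemma cos_taylor3 (th x : R) :
  `|cos (th + x) - cos th + x * sin th + x ^+ 2 / 2 * cos th| <= `|x| ^+ 3.
Proof.
rewrite (_ : `|x| ^+ 3 = `|x| * `|x| * `|x|); last by ring.
apply: (@mean_value_bound (fun x => cos (th + x) - cos th + x * sin th + x ^+ 2 / 2 * cos th)
  (fun x => - (sin (th + x) - sin th - x * cos th))).
- move=> c; have d1 := @is_derive1_comp R cos (fun x => th + x) c _ _ (@is_derive_cos R (th + c)) (is_derive_shift th c).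
  rewrite (_ : (fun x => _) = fun x => (cos \o (fun x => th + x)) x - cos th + x * sin th + x ^+ 2 / 2 * cos th)//.
  by apply: is_derive_eq; rewrite /GRing.scale/=; field.
- by rewrite addr0 subrr mul0r expr0n/= !mul0r !addr0.
move=> c cx _; rewrite normrN; apply: le_trans (sin_taylor2 _ _) _.
by rewrite ler_pM.
Qed.

Lemma expR_taylor2 (y : R) : 0 <= y -> `|expR (- y) - (1 - y)| <= y ^+ 2.
Proof.
move=> y0; have -> : y ^+ 2 = y * `|y| by rewrite ger0_norm.
apply: (@mean_value_bound (fun y => expR (- y) - (1 - y)) (fun y => 1 - expR (- y))).
- move=> c; have d0 : is_derive c 1 (fun y : R => - y) (- 1).
    by apply: is_derive_eq.
  have d1 := @is_derive1_comp R (@expR R) (fun y => - y) c _ _ (@is_derive_expR R (- c)) d0.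
  rewrite (_ : (fun x => _) = fun x => ((@expR R) \o (fun y => - y)) x - (1 - x))//.
  by apply: is_derive_eq; ring.
- by rewrite oppr0 expR0 addr0 subrr.
move=> c cy; rewrite (ger0_norm y0) in cy; move=> cy0.
have c0 : 0 <= c.
  have [y00|yn] := eqVneq y 0.
    by move: cy; rewrite y00 normr_le0 => /eqP ->.
  by move: cy0; rewrite pmulr_lge0// lt_def yn.
have h1 := expR_ge1Dx (- c).
have h2 : expR (- c) <= 1 by rewrite -expR0 ler_expR oppr_le0.
rewrite ger0_norm ?subr_ge0//; apply: le_trans (le_trans (ler_norm _) cy).
by clear -h1; lra.
Qed.

End Taylor.

(** * Expectations along a random walk with finitely many steps *)

Section Walk.
Context {R : realType} {I : finType}.
Variables (p x : I -> R).

(* E h(u + S_k), where S_k has k i.i.d. steps equal to x J with probability p J. *)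
Fixpoint walk_mean (h : R -> R) (k : nat) (u : R) : R :=
  if k is k'.+1 then \sum_J p J * walk_mean h k' (u + x J) else h u.

Hypotheses (p0 : forall J, 0 <= p J) (p1 : \sum_J p J = 1).

(** One step multiplies the cosine by b up to eta, uniformly in the phase. Averaging does not
    increase the errors and powers of b are at most 1, so the errors just add up. *)
Lemma walk_mean_cos (b eta : R) k th : 0 <= b <= 1 ->
  (forall th, `|\sum_J p J * cos (th + x J) - b * cos th| <= eta) ->
  `|walk_mean cos k th - b ^+ k * cos th| <= k%:R * eta.
Proof.
move=> /andP[b0 b1] h; elim: k th => [|k IH] th.
  by rewrite /= expr0 mul1r subrr normr0 mul0r.
have -> : walk_mean cos k.+1 th - b ^+ k.+1 * cos th =
   \sum_J p J * (walk_mean cos k (th + x J) - b ^+ k * cos (th + x J)) +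
   b ^+ k * (\sum_J p J * cos (th + x J) - b * cos th).
  rewrite /= exprSr mulrBr mulr_sumr addrA -big_split/= mulrA; congr (_ - _).
  by apply: eq_bigr => J _; ring.
apply: le_trans (ler_normD _ _) _; rewrite -natr1 mulrDl mul1r; apply: lerD.
  apply: le_trans (ler_norm_sum _ _ _) _.
  have -> : k%:R * eta = \sum_J p J * (k%:R * eta) by rewrite -mulr_suml p1 mul1r.
  apply: ler_sum => J _.
  by rewrite normrM (ger0_norm (p0 J)) ler_wpM2l.
rewrite normrM -[leRHS]mul1r ler_pM// ger0_norm ?exprn_ge0//.
by rewrite exprn_ile1.
Qed.

Hypothesis px : \sum_J p J * x J = 0.

Lemma walk_mean_sqr k u :
  walk_mean (fun y => y ^+ 2) k u = u ^+ 2 + k%:R * \sum_J p J * x J ^+ 2.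
Proof.
elim: k u => [|k IH] u /=; first by rewrite mul0r addr0.
under eq_bigr do rewrite IH.
rewrite (eq_bigr (fun J => p J * (u ^+ 2 + k%:R * \sum_J p J * x J ^+ 2) +
  (2 * u) * (p J * x J) + p J * x J ^+ 2)); last by move=> J _; ring.
rewrite !big_split/= -mulr_suml -mulr_sumr p1 px mulr0 addr0 mul1r -natr1.
by rewrite mulrDl mul1r addrA.
Qed.

(** As the steps are centered, the terms of order at most 2 average to (1 - s / 2) cos th; then 1 -
    s / 2 is replaced by its exponential. *)
Lemma cos_step s th : \sum_J p J * x J ^+ 2 = s ->
  `|\sum_J p J * cos (th + x J) - expR (- (s / 2)) * cos th|
    <= \sum_J p J * `|x J| ^+ 3 + (s / 2) ^+ 2.
Proof.
move=> sE; have s0 : 0 <= s / 2.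
  by rewrite -sE divr_ge0//; apply: sumr_ge0 => J _; rewrite mulr_ge0// sqr_ge0.
have -> : \sum_J p J * cos (th + x J) - expR (- (s / 2)) * cos th =
   \sum_J p J * (cos (th + x J) - cos th + x J * sin th + x J ^+ 2 / 2 * cos th)
   - (expR (- (s / 2)) - (1 - s / 2)) * cos th.
  rewrite [X in _ = X - _](_ : _ = \sum_J p J * cos (th + x J) - cos th + s / 2 * cos th).
    by ring.
  rewrite (eq_bigr (fun J => p J * cos (th + x J) + (- cos th) * p J + sin th * (p J * x J)
    + (cos th / 2) * (p J * x J ^+ 2))); last by move=> J _; field.
  by rewrite !big_split/= -!mulr_sumr p1 px mulr0 addr0 mulr1 sE; field.
apply: le_trans (ler_normB _ _) _; apply: lerD.
  apply: le_trans (ler_norm_sum _ _ _) _; apply: ler_sum => J _.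
  by rewrite normrM (ger0_norm (p0 J)) ler_wpM2l// cos_taylor3.
rewrite normrM -[leRHS]mulr1 ler_pM//; last exact: cos_max.
exact: expR_taylor2.
Qed.

End Walk.

(** * The scalar central limit theorem *)

Section CLT.
Context {R : realType} {I : finType}.
Variables (p y : I -> R).
Hypotheses (p0 : forall J, 0 <= p J) (p1 : \sum_J p J = 1).
Hypothesis py : \sum_J p J * y J = 0.

(** With steps divided by sqrt(n), the factor b = exp(- s / (2 n)) has n-th power exp(- s / 2), and
    the n one-step errors total M / sqrt(n) + (s / 2)^2 / n. *)
Lemma walk_mean_clt th :
  walk_mean p (fun J => y J / Num.sqrt n%:R) cos n th @[n --> \oo]
    --> cos th * expR (- (\sum_J p J * y J ^+ 2) / 2).
Proof.
pose s := \sum_J p J * y J ^+ 2; pose M := \sum_J p J * `|y J| ^+ 3.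
have s0 : 0 <= s by apply: sumr_ge0 => J _; rewrite mulr_ge0// sqr_ge0.
have bound n : (0 < n)%N -> `|cos th * expR (- s / 2) -
    walk_mean p (fun J => y J / Num.sqrt n%:R) cos n th| <=
    M * Num.sqrt n%:R^-1 + (s / 2) ^+ 2 * n%:R^-1.
  move=> n0; have n0' : 0 < n%:R :> R by rewrite ltr0n.
  have r0 : 0 < Num.sqrt n%:R :> R by rewrite sqrtr_gt0.
  pose x J := y J / Num.sqrt n%:R.
  have px : \sum_J p J * x J = 0.
    rewrite (eq_bigr (fun J => p J * y J / Num.sqrt n%:R)); last by move=> J _; rewrite mulrA.
    by rewrite -mulr_suml py mul0r.
  have sx : \sum_J p J * x J ^+ 2 = s / n%:R.
    rewrite mulr_suml; apply: eq_bigr => J _.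
    by rewrite exprMn exprVn sqr_sqrtr ?ltW// mulrA.
  have step t := cos_step p0 p1 px t sx.
  have b01 : 0 <= expR (- (s / n%:R / 2)) <= 1.
    by rewrite expR_ge0/= -expR0 ler_expR oppr_le0 !divr_ge0// ltW.
  have := walk_mean_cos p0 p1 n th b01 step.
  rewrite -expRM_natl (_ : n%:R * - (s / n%:R / 2) = - s / 2); last first.
    by field; rewrite gt_eqF.
  rewrite distrC [cos th * _]mulrC => h; apply: le_trans h _.
  rewrite le_eqVlt; apply/orP; left; apply/eqP; rewrite mulrDr; congr (_ + _).
    rewrite /M mulr_suml mulr_sumr; apply: eq_bigr => J _.
    rewrite sqrtrV ?ltW// normrM exprMn normrV ?unitfE ?gt_eqF// (gtr0_norm r0).
    have := sqr_sqrtr (ltW n0'); move: (Num.sqrt n%:R) r0 => r r0 <-.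
    by field; rewrite gt_eqF.
  by field; rewrite gt_eqF.
have lim0 : M * Num.sqrt n%:R^-1 + (s / 2) ^+ 2 * n%:R^-1 @[n --> \oo] --> (0 : R).
  have h1 : n%:R^-1 @[n --> \oo] --> (0 : R).
    by have := @cvg_inv_nat R 1; under eq_fun do rewrite mul1r.
  have h2 : Num.sqrt n%:R^-1 @[n --> \oo] --> (0 : R).
    rewrite -[0](@sqrtr0 R); apply: (cvg_comp _ Num.sqrt h1); exact: sqrt_continuous.
  have := cvgD (cvgM (cvg_cst M) h2) (cvgM (cvg_cst ((s / 2) ^+ 2)) h1).
  by rewrite !mulr0 addr0; apply.
apply/cvgrPdist_le => e e0; have /cvgr0_norm_le/(_ _ e0) h := lim0.
near=> n; apply: le_trans (bound n _) _; first by near: n; exact: nbhs_infty_gt.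
by apply: le_trans (ler_norm _) _; near: n.
Unshelve. all: by end_near. Qed.

End CLT.

(** * Partial sums over independent observations *)

Section Sampling.
Context {R : realType} {N : nat} {d : measure_display} {T : measurableType d}.
Variables (P : probability T R) (L : 'M[R]_N) (Z : nat -> T -> {set 'I_N}).
Hypotheses (mZ : forall i, random_subset (Z i)) (lZ : forall i, has_dpp_law P L (Z i))
  (iZ : mutually_independent P Z).
Let p := dpp_pmf L.

(** Fixes the m observations from index k on; indexing by [iota] matches the sequences in
    [mutually_independent]. *)
Definition cylinder k m (z : nat -> {set 'I_N}) : set T :=
  \bigcap_(i in [set` iota k m]) Z i @^-1` [set z i].

Lemma measurable_cylinder k m z : measurable (cylinder k m z).
Proof. by apply: fin_bigcap_measurable => // i _; exact: mZ. Qed.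

Lemma cylinder_prob k m z : fine (P (cylinder k m z)) = \prod_(i <- iota k m) p (z i).
Proof.
rewrite iZ ?iota_uniq//.
have -> : (\prod_(i <- iota k m) P (Z i @^-1` [set z i]) = (\prod_(i <- iota k m) p (z i))%:E)%E.
  by rewrite -prodEFin; apply: eq_bigr => i _; exact: lZ.
by [].
Qed.

Lemma bmf_fun i (f : {set 'I_N} -> R) : bmf (fun w => f (Z i w)).
Proof.
split.
  by move=> _ B mB; rewrite setTI -[X in measurable X]/(Z i @^-1` (f @^-1` B)); exact: mZ.
exists (\sum_J `|f J|) => w; rewrite (bigD1 (Z i w))//= lerDl.
by apply: sumr_ge0.
Qed.

Definition partial_sum (x : {set 'I_N} -> R) k w := \sum_(i < k) x (Z i w).

Lemma bmf_partial_sum x k : bmf (partial_sum x k).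
Proof. by apply: bmf_sum => i; exact: bmf_fun. Qed.

Lemma Ex_partial_sum (x : {set 'I_N} -> R) (h : R -> R) k u :
  (forall k u, bmf (fun w => h (u + partial_sum x k w))) ->
  Ex P (fun w => h (u + partial_sum x k w)) = walk_mean p x h k u.
Proof.
move=> bh.
(* Removing the last step adds one observation to the conditioning cylinder. *)
have key m z : Ex P (fun w => h (u + partial_sum x k w) * \1_(cylinder k m z) w) =
    walk_mean p x h k u * fine (P (cylinder k m z)).
  elim: k u m z => [|k IH] u m z.
    rewrite (_ : (fun w => _) = fun w => h u * \1_(cylinder 0 m z) w); last first.
      by apply/funext => w; rewrite /partial_sum big_ord0 addr0.
    have mc := measurable_cylinder 0 m z.
    by rewrite ExZ ?Ex_indic//; exact: bmf_indic.
  pose z' J i := if i == k then J else z i.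
  have cylE J w : \1_(cylinder k m.+1 (z' J)) w = (Z k w == J)%:R * \1_(cylinder k.+1 m z) w :> R.
    rewrite !indicE -natrM mulnb; congr (nat_of_bool _)%:R.
    apply/idP/andP => [|[/eqP kJ]].
      rewrite inE => h1; split.
        by have := h1 k; rewrite /= inE eqxx /z' eqxx => /(_ isT) <-.
      rewrite inE => i /= hi; have := h1 i; rewrite /= inE hi orbT => /(_ isT).
      rewrite /z' ifN//; apply: contraTneq hi => ->.
      by rewrite mem_iota ltnn.
    rewrite !inE => h1 i /=; rewrite inE => /predU1P[->|hi].
      by rewrite /z' eqxx.
    rewrite /z' ifN; first exact: h1.
    by apply: contraTneq hi => ->; rewrite mem_iota ltnn.
  rewrite (_ : (fun w => _) = fun w => \sum_J (h (u + x J + partial_sum x k w) * \1_(cylinder k m.+1 (z' J)) w)); last first.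
    apply/funext => w; rewrite (bigD1 (Z k w))//= cylE eqxx mul1r big1 ?addr0.
      by rewrite /partial_sum big_ord_recr/= addrAC addrA.
    by move=> J JZ; rewrite cylE eq_sym (negbTE JZ) mul0r mulr0.
  rewrite Ex_sum; last first.
    by move=> J; apply: bmfM => //; apply: bmf_indic; exact: measurable_cylinder.
  rewrite /= mulr_suml; apply: eq_bigr => J _; rewrite IH !cylinder_prob /= big_cons /z' eqxx.
  rewrite [X in _ * (_ * X)](_ : _ = \prod_(i <- iota k.+1 m) p (z i)); first by rewrite mulrCA mulrA.
  rewrite big_seq [RHS]big_seq; apply: eq_bigr => i hi.
  by rewrite ifN//; apply: contraTneq hi => ->; rewrite mem_iota ltnn.
have := key 0 (fun=> finset.set0).
have -> : cylinder k 0 (fun=> finset.set0) = setT.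
  by apply/seteqP; split=> // w _ i.
rewrite probability_setT mulr1 => <-; congr Ex; apply/funext => w.
by rewrite indicT mulr1.
Qed.

Lemma bmf_cos_partial_sum x k u : bmf (fun w => cos (u + partial_sum x k w)).
Proof.
apply: bmf_cos; apply: measurable_funD; first exact: measurable_cst.
by have [] := bmf_partial_sum x k.
Qed.

Lemma bmf_sqr_partial_sum x k u : bmf (fun w => (u + partial_sum x k w) ^+ 2).
Proof.
rewrite (_ : (fun w => _) = fun w => (u + partial_sum x k w) * (u + partial_sum x k w)).
  have b1 : bmf (fun w => u + partial_sum x k w).
    by apply: bmfD; [exact: bmf_cst|exact: bmf_partial_sum].
  exact: bmfM.
by apply/funext => w.
Qed.

Lemma measurable_large_sum x k M : measurable [set w | M < `|partial_sum x k w|].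
Proof.
have [mS _] := bmf_partial_sum x k.
have := measurableT_comp (@normr_measurable R setT) mS => /(_ measurableT `]M, +oo[%classic (measurable_itv _)).
rewrite setTI; congr measurable.
by apply/seteqP; split=> w /=; rewrite in_itv/= andbT.
Qed.

Hypothesis pL : L \in posdefmx.

Lemma chebyshev_partial_sum (x : {set 'I_N} -> R) k M : 0 < M ->
  \sum_J p J * x J = 0 ->
  fine (P [set w | M < `|partial_sum x k w|]) * M ^+ 2 <= k%:R * \sum_J p J * x J ^+ 2.
Proof.
move=> M0 px.
have mA := measurable_large_sum x k M.
have := @Ex_partial_sum x (fun y => y ^+ 2) k 0 (bmf_sqr_partial_sum x).
rewrite (walk_mean_sqr (dpp_sum pL) px) expr0n/= add0r => <-.
rewrite -Ex_indic// mulrC -ExZ; last exact: bmf_indic.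
apply: Ex_le.
- by apply: bmfZ; exact: bmf_indic.
- exact: bmf_sqr_partial_sum.
move=> w; rewrite add0r indicE; have [|_] := boolP (w \in _); last by rewrite mulr0 sqr_ge0.
rewrite inE/= mulr1 => h; rewrite -[leRHS]real_normK ?num_real//.
by rewrite lerXn2r ?nnegrE ?(ltW M0)// ltW.
Qed.

End Sampling.

(** * Asymptotic normality *)

Section Estimation.
Context {R : realType} {N : nat} {d : measure_display} {T : measurableType d}.
Variables (P : probability T R) (Ls : 'M[R]_N) (Z : nat -> T -> {set 'I_N}).
Hypotheses (pL : Ls \in posdefmx) (iL : irreducible_mx Ls).
Hypotheses (mZ : forall i, random_subset (Z i)) (lZ : forall i, has_dpp_law P Ls (Z i))
  (iZ : mutually_independent P Z).
Notation p := (dpp_pmf Ls).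
Notation v := (influence Ls).
Notation I := {set 'I_N}.

Lemma Ex_indic_le (A B : set T) : measurable A -> measurable B -> A `<=` B ->
  fine (P A) <= fine (P B).
Proof.
move=> mA mB AB; rewrite -!Ex_indic//; apply: Ex_le; try exact: bmf_indic.
move=> w; rewrite !indicE; have [/set_mem wA|_] := boolP (w \in A) => //.
by rewrite (mem_set (AB _ wA)).
Qed.

Definition freq n w (J : I) : R := n%:R^-1 * \sum_(i < n) (Z i w == J)%:R.

Lemma sum_observations (V : lmodType R) (f : I -> V) n w :
  \sum_(i < n) f (Z i w) = \sum_J (\sum_(i < n) (Z i w == J)%:R) *: f J.
Proof.
under [RHS]eq_bigr do rewrite scaler_suml.
rewrite exchange_big/=; apply: eq_bigr => i _.
rewrite (bigD1 (Z i w))//= eqxx scale1r big1 ?addr0// => J JZ.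
by rewrite eq_sym (negbTE JZ) scale0r.
Qed.

Lemma freq01 n w J : 0 <= freq n w J <= 1.
Proof.
rewrite /freq; case: n => [|n]; first by rewrite big_ord0 mulr0 lexx ler01.
have h0 : 0 <= \sum_(i < n.+1) (Z i w == J)%:R :> R by apply: sumr_ge0.
have h1 : \sum_(i < n.+1) (Z i w == J)%:R <= n.+1%:R :> R.
  rewrite -[X in _ <= X%:R]card_ord -sum1_card natr_sum; apply: ler_sum => i _.
  by case: (_ == _).
by rewrite mulr_ge0//= mulrC ler_pdivrMr ?ltr0n// mul1r.
Qed.

Lemma loglik_freq n w : loglik (Z^~ w) n = entropy_loglik (freq n w).
Proof.
apply/funext => L; rewrite /loglik /entropy_loglik.
rewrite (@sum_observations R^o (fun J => ln (dpp_pmf L J))) mulr_sumr.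
by apply: eq_bigr => J _; rewrite /GRing.scale/= mulrA.
Qed.

Definition centered (J K : I) : R := (K == J)%:R - p J.

Lemma sum_centered J : \sum_K p K * centered J K = 0.
Proof.
under eq_bigr do rewrite mulrBr.
rewrite sumrB -mulr_suml dpp_sum// mul1r (bigD1 J)//= eqxx mulr1 big1 ?addr0 ?subrr//.
by move=> K KJ; rewrite (negbTE KJ) mulr0.
Qed.

Lemma sum_centered2 J : \sum_K p K * centered J K ^+ 2 <= 1.
Proof.
rewrite -(dpp_sum pL); apply: ler_sum => K _.
rewrite -[leRHS]mulr1 ler_wpM2l ?(ltW (dpp_gt0 _ pL))//.
have p0 := dpp_gt0 J pL; have p1 := dpp_le1 J pL.
rewrite -real_normK ?num_real// exprn_ile1// /centered.
by case: eqP => _ /=; rewrite ler_norml; apply/andP; split; rewrite ?sub0r ?lerN2 ?gerBl ?lerBrDr; lra.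
Qed.

Lemma partial_sum_centered n w J : (0 < n)%N ->
  partial_sum Z (centered J) n w = n%:R * (freq n w J - p J).
Proof.
move=> n0; rewrite /partial_sum /centered sumrB sumr_const card_ord.
by rewrite mulrBr /freq mulVKf ?mulr_natl// pnatr_eq0 -lt0n.
Qed.

(** For n > 0, off this event every frequency is within K / sqrt(n) of its probability, and the
    estimates become deterministic. *)
Definition atypical n K : set T :=
  \bigcup_(J in [set: I]) [set w | K * Num.sqrt n%:R < `|partial_sum Z (centered J) n w|].

Lemma measurable_atypical n K : measurable (atypical n K).
Proof.
apply: fin_bigcup_measurable => [|J _]; first exact: finite_finset.
exact: measurable_large_sum.
Qed.

(** Union bound over [J], with Chebyshev's inequality for each centered indicator, whose variance is
    at most 1. *)
Lemma atypical_prob n K : (0 < n)%N -> 0 < K ->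
  fine (P (atypical n K)) <= #|{: I}|%:R / K ^+ 2.
Proof.
move=> n0 K0; have n0' : 0 < n%:R :> R by rewrite ltr0n.
have r0 : 0 < Num.sqrt n%:R :> R by rewrite sqrtr_gt0.
pose F J := [set w | K * Num.sqrt n%:R < `|partial_sum Z (centered J) n w|].
have mF J : measurable (F J) by exact: measurable_large_sum.
have FP J : fine (P (F J)) <= (K ^+ 2)^-1.
  have := chebyshev_partial_sum mZ lZ iZ pL n (mulr_gt0 K0 r0) (sum_centered J).
  rewrite exprMn (sqr_sqrtr (ltW n0')) => h.
  have {h} : fine (P (F J)) * (K ^+ 2 * n%:R) <= n%:R.
    by apply: le_trans h _; rewrite -[leRHS]mulr1 ler_wpM2l ?sum_centered2// ltW.
  by rewrite mulrA -[leRHS]mul1r ler_pM2r// -ler_pdivlMr ?exprn_gt0// div1r.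
rewrite -Ex_indic; last exact: measurable_atypical.
apply: (@le_trans _ _ (Ex P (fun w => \sum_J \1_(F J) w))).
  apply: Ex_le.
  - by apply: bmf_indic; exact: measurable_atypical.
  - by apply: bmf_sum => J; exact: bmf_indic.
  move=> w; rewrite indicE; have [|_] := boolP (w \in _); last by apply: sumr_ge0.
  rewrite inE => -[J _ FJ]; rewrite (bigD1 J)//= indicE mem_set//= lerDl.
  by apply: sumr_ge0.
rewrite Ex_sum; last by move=> J; exact: bmf_indic.
apply: (@le_trans _ _ (\sum_(J : I) (K ^+ 2)^-1)).
  by apply: ler_sum => J _; rewrite Ex_indic.
by rewrite sumr_const mulr_natl.
Qed.

(** The sum needs no centering, because the influences have mean zero under the true law. *)
Definition linearized n w : 'M[R]_N := (Num.sqrt n%:R)^-1 *: \sum_(i < n) v (Z i w).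

Lemma linearizedE n w : (0 < n)%N ->
  linearized n w = Num.sqrt n%:R *: \sum_J (freq n w J - p J) *: v J.
Proof.
move=> n0; have n0' : 0 < n%:R :> R by rewrite ltr0n.
under eq_bigr do rewrite scalerBl.
rewrite sumrB sum_influence// subr0 /linearized sum_observations.
rewrite !scaler_sumr; apply: eq_bigr => J _; rewrite !scalerA; congr (_ *: _).
rewrite mulrA; congr (_ * _).
by rewrite -[X in _ = _ / X](sqr_sqrtr (ltW n0')) expr2 invfM mulVKf ?gt_eqF ?sqrtr_gt0.
Qed.

Lemma entries_measurable_linearized n : entries_measurable (linearized n).
Proof.
move=> i j; rewrite (_ : (fun w => _) = fun w => (Num.sqrt n%:R)^-1 * \sum_(k < n) v (Z k w) i j).
  apply: measurable_funM => //; apply: measurable_sum => k.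
  by have [] := @bmf_fun R N _ _ Z mZ k (fun J => v J i j).
by apply/funext => w; rewrite /linearized mxE summxE.
Qed.

Lemma dot_linearized n w t :
  dot t (linearized n w) = partial_sum Z (fun J => dot t (v J) / Num.sqrt n%:R) n w.
Proof.
rewrite /linearized dotZr mulrC /partial_sum -mulr_suml; congr (_ / _).
exact: dot_sum.
Qed.

Lemma typical_freq n K w J : (0 < n)%N -> ~ atypical n K w ->
  Num.sqrt n%:R * `|freq n w J - p J| <= K.
Proof.
move=> n0 wK; have n0' : 0 < n%:R :> R by rewrite ltr0n.
have r0 : 0 < Num.sqrt n%:R :> R by rewrite sqrtr_gt0.
rewrite leNgt; apply/negP => h; apply: wK; exists J => //=.
rewrite partial_sum_centered// normrM ger0_norm ?ltW//.
by rewrite -[X in _ < X * _](sqr_sqrtr (ltW n0')) expr2 -mulrA mulrC ltr_pM2l.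
Qed.

Lemma typical_linearized n K w i j : (0 < n)%N -> ~ atypical n K w ->
  `|linearized n w i j| <= \sum_J K * `|v J i j|.
Proof.
move=> n0 wK; rewrite linearizedE// mxE summxE mulr_sumr.
apply: le_trans (ler_norm_sum _ _ _) _; apply: ler_sum => J _.
rewrite mxE mulrA normrM ler_wpM2r// normrM ger0_norm ?sqrtr_ge0//.
exact: typical_freq.
Qed.

(** Testing against one frequency turns the matrix sum into a scalar walk, to which [walk_mean_clt]
    applies. *)
Lemma wave_linearized_cvg d' (T' : measurableType d') (P' : probability T' R)
    (A : T' -> 'M[R]_N) w :
  entries_measurable A ->
  (forall th t, Ex P' (fun x => cos (th + dot t (A x))) =
       cos th * expR (- (\sum_J p J * dot t (v J) ^+ 2) / 2)) ->
  Ex P (fun x => wave w (linearized n x)) @[n --> \oo] --> Ex P' (fun x => wave w (A x)).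
Proof.
move=> mA hA.
have bA : bmf (fun x => cos (w.2 + dot w.1.2 (A x))).
  by apply: bmf_cos; apply: measurable_funD => //; exact: measurable_dot.
rewrite /wave ExZ// hA.
have E n : Ex P (fun x => w.1.1 * cos (w.2 + dot w.1.2 (linearized n x))) =
    w.1.1 * walk_mean p (fun J => dot w.1.2 (v J) / Num.sqrt n%:R) cos n w.2.
  rewrite (_ : (fun x => _) = fun x => w.1.1 * cos (w.2 +
    partial_sum Z (fun J => dot w.1.2 (v J) / Num.sqrt n%:R) n x)); last first.
    by apply/funext => x; rewrite dot_linearized.
  rewrite ExZ; last exact: bmf_cos_partial_sum.
  by rewrite (Ex_partial_sum mZ lZ iZ)// => k u; exact: bmf_cos_partial_sum.
under eq_fun do rewrite E.
apply: cvgM; first exact: cvg_cst.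
apply: walk_mean_clt.
- by move=> J; exact: ltW (dpp_gt0 _ pL).
- exact: dpp_sum.
rewrite -[RHS](dot0r w.1.2) -(sum_influence pL) dot_sum.
by apply: eq_bigr => J _; rewrite dotZr.
Qed.

Variables (Lhat Dhat : nat -> T -> 'M[R]_N).
Hypotheses (mL : forall n, entries_measurable (Lhat n)) (mD : forall n, entries_measurable (Dhat n)).
Hypothesis mleL : forall n w, (0 < n)%N ->
  (exists L : 'M[R]_N, maximizer_on posdefmx (loglik (Z^~ w) n) L) ->
  maximizer_on posdefmx (loglik (Z^~ w) n) (Lhat n w).
Hypothesis signD : forall n w, closest_sign Ls (Dhat n w) (Lhat n w).

Definition rescaled_error n w : 'M[R]_N :=
  Num.sqrt n%:R *: (Dhat n w *m Lhat n w *m Dhat n w - Ls).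

Lemma entries_measurable_error n : entries_measurable (rescaled_error n).
Proof.
move=> i j; rewrite (_ : (fun w => _) = fun w => Num.sqrt n%:R *
  ((\sum_k (\sum_l Dhat n w i l * Lhat n w l k) * Dhat n w k j) - Ls i j)).
  apply: measurable_funM => //; apply: measurable_funB => //.
  apply: measurable_sum => k; apply: measurable_funM; last exact: mD.
  by apply: measurable_sum => l; apply: measurable_funM; [exact: mD|exact: mL].
apply/funext => w; rewrite !mxE; congr (_ * (_ - _)).
by apply: eq_bigr => k _; rewrite mxE.
Qed.

(** Off the atypical event, sqrt(n) times the sum of |q_J - p_J| is at most c, so the relative error
    e / c in [mle_expansion] becomes e after rescaling. *)
Lemma error_linearized K e : 0 < K -> 0 < e -> \forall n \near \oo,
  forall w, ~ atypical n K w ->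
  forall i j, `|(rescaled_error n w - linearized n w) i j| <= e.
Proof.
move=> K0 e0; pose c := #|{: I}|%:R * K.
have c0 : 0 < c.
  by rewrite mulr_gt0// ltr0n; apply/card_gt0P; exists finset.set0.
have [del del0 hdel] := mle_expansion pL iL (divr_gt0 e0 c0).
near=> n.
have n0 : (0 < n)%N by near: n; exact: nbhs_infty_gt.
have n0' : 0 < n%:R :> R by rewrite ltr0n.
have r0 : 0 < Num.sqrt n%:R :> R by rewrite sqrtr_gt0.
(* Taking n at least (K / del)^2 brings typical frequencies within the radius of [mle_expansion]. *)
have Kdel : K <= Num.sqrt n%:R * del.
  have KD0 : 0 <= K / del by rewrite divr_ge0 ?(ltW K0) ?(ltW del0).
  rewrite -ler_pdivrMr// -(ger0_norm KD0) -sqrtr_sqr; apply: ler_wsqrtr.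
  apply: ltW; apply: lt_le_trans (archi_boundP (sqr_ge0 (K / del))) _.
  by rewrite ler_nat; near: n; exact: nbhs_infty_ge.
move=> w wK i j.
have dev J : `|freq n w J - p J| <= del.
  by rewrite -(ler_pM2l r0); apply: le_trans Kdel; exact: typical_freq.
have [ex exp] := hdel (freq n w) (freq01 n w) dev.
have {}ex : maximizer_on posdefmx (entropy_loglik (freq n w)) (Lhat n w).
  by rewrite -loglik_freq; apply: mleL => //; rewrite loglik_freq.
rewrite linearizedE// -scalerBr mxE normrM ger0_norm ?(ltW r0)//.
apply: (@le_trans _ _ (Num.sqrt n%:R * (e / c * \sum_J `|freq n w J - p J|))).
  by rewrite ler_pM2l//; exact: exp.
rewrite mulrCA mulr_sumr.
apply: (@le_trans _ _ (e / c * c)); last by rewrite divfK ?gt_eqF.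
rewrite ler_pM2l ?divr_gt0// /c mulr_natl -[leRHS]sumr_const.
by apply: ler_sum => J _; exact: typical_freq.
Unshelve. all: by end_near. Qed.

(** The choice K = 1 + c gives K^2 >= c, which is what [atypical_prob] requires. *)
Lemma atypical_small e : 0 < e -> exists2 K, 0 < K &
  forall n, (0 < n)%N -> fine (P (atypical n K)) <= e.
Proof.
move=> e0; pose c := #|{: I}|%:R / e : R.
have c0 : 0 <= c by rewrite divr_ge0// ltW.
have K0 : 0 < 1 + c by rewrite ltr_pwDl.
exists (1 + c) => // n n0; apply: le_trans (atypical_prob n0 K0) _.
rewrite ler_pdivrMr ?exprn_gt0// mulrC -ler_pdivrMr// -/c.
apply: (@le_trans _ _ (1 + c)); first by rewrite lerDr.
by rewrite expr2 ler_peMr ?(ltW K0)// lerDl.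
Qed.

(** The wave is bounded on the atypical event and Lipschitz elsewhere. The 1 in each denominator
    covers a vanishing amplitude or frequency. *)
Lemma wave_error_linearized w :
  Ex P (fun x => wave w (rescaled_error n x)) - Ex P (fun x => wave w (linearized n x))
    @[n --> \oo] --> (0 : R).
Proof.
apply/cvgr0Pnorm_le => e e0; pose c := `|w.1.1|.
pose t := \sum_i \sum_j `|w.1.2 i j|.
have t0 : 0 <= t by apply: sumr_ge0 => i _; apply: sumr_ge0.
have c0 : 0 <= c := normr_ge0 _.
have c1 : 0 < 1 + c *+ 2 by rewrite ltr_pwDl// mulrn_wge0.
have ct1 : 0 < 1 + c * t by rewrite ltr_pwDl// mulr_ge0.
have e1 : 0 < e / 2 / (1 + c *+ 2) by rewrite !divr_gt0.
have e2 : 0 < e / 2 / (1 + c * t) by rewrite !divr_gt0.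
have [K K0 hK] := atypical_small e1.
pose del := e / 2 / (1 + c * t).
have delE : (1 + c * t) * del = e / 2 by rewrite mulrC divfK// gt_eqF.
have hclose : \forall n \near \oo, forall w, ~ atypical n K w ->
  forall i j, `|(rescaled_error n w - linearized n w) i j| <= del by exact: error_linearized.
near=> n.
have n0 : (0 < n)%N by near: n; exact: nbhs_infty_gt.
have hn : forall x, ~ atypical n K x -> forall i j, `|(rescaled_error n x - linearized n x) i j| <= del.
  by near: n.
have wb (y : 'M[R]_N) : `|wave w y| <= c by rewrite normrM ler_piMr// cos_max.
apply: le_trans (@Ex_close _ _ _ P _ _ (atypical n K) (e / 2) c _ _ _ _ _ _ _) _ => //.
- by apply: bmf_wave; exact: entries_measurable_error.
- by apply: bmf_wave; exact: entries_measurable_linearized.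
- exact: measurable_atypical.
- move=> x /hn hx; rewrite /wave -mulrBr normrM -/c.
  apply: (@le_trans _ _ (c * (t * del))).
    rewrite ler_wpM2l//; apply: le_trans (cos_lip _ _) _.
    rewrite opprD addrACA subrr add0r -mulN1r -dotZr scaleN1r -dotDr.
    by apply: dot_bound => //; exact: ltW.
  rewrite mulrA; apply: (@le_trans _ _ ((1 + c * t) * del)).
    by rewrite ler_pM2r// lerDr.
  by rewrite delE.
- by rewrite divr_ge0// ltW.
rewrite [leRHS]splitr lerD2l.
apply: (@le_trans _ _ ((1 + c *+ 2) * (e / 2 / (1 + c *+ 2)))); last by rewrite mulrC divfK// gt_eqF.
apply: ler_pM; rewrite ?mulrn_wge0 ?fine_ge0 ?lerDr//; exact: hK.
Unshelve. all: by end_near. Qed.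

(** Off the atypical event the entries of [linearized] are bounded by B and the remainder by 1. *)
Lemma error_tight e : 0 < e -> exists2 K, 0 < K &
  \forall n \near \oo, fine (P (outside (rescaled_error n) K)) <= e.
Proof.
move=> e0; have [K K0 hK] := atypical_small e0.
pose B := \sum_i \sum_j \sum_J K * `|v J i j|.
have B1 i : 0 <= \sum_j \sum_J K * `|v J i j|.
  by apply: sumr_ge0 => j _; apply: sumr_ge0 => J _; rewrite mulr_ge0// ltW.
have B2 i j : 0 <= \sum_J K * `|v J i j|.
  by apply: sumr_ge0 => J _; rewrite mulr_ge0// ltW.
have BE i j : \sum_J K * `|v J i j| <= B.
  exact: (@ler_sum_entries _ _ _ (fun i j => \sum_J K * `|v J i j|)).
have B0 : 0 <= B by apply: sumr_ge0.
exists (B + 1); first by rewrite ltr_wpDl.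
have hclose := error_linearized K0 (@ltr01 R).
near=> n.
have n0 : (0 < n)%N by near: n; exact: nbhs_infty_gt.
have hn : forall x, ~ atypical n K x -> forall i j, `|(rescaled_error n x - linearized n x) i j| <= 1.
  by near: n.
apply: le_trans (hK n n0); apply: Ex_indic_le.
- by apply: measurable_outside; exact: entries_measurable_error.
- exact: measurable_atypical.
move=> x xo; apply: contrapT => wK; apply: xo => i j.
have -> : rescaled_error n x i j = linearized n x i j + (rescaled_error n x - linearized n x) i j.
  by rewrite [X in _ = _ + X]mxE [X in _ + (_ + X)]mxE addrC subrK.
apply: le_trans (ler_normD _ _) _; apply: lerD; last exact: hn.
by apply: le_trans (BE i j); exact: typical_linearized.
Unshelve. all: by end_near. Qed.

Lemma error_cvg_in_distribution d' (T' : measurableType d') (P' : probability T' R)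
    (A : T' -> 'M[R]_N) :
  entries_measurable A ->
  (forall th t, Ex P' (fun x => cos (th + dot t (A x))) =
       cos th * expR (- (\sum_J p J * dot t (v J) ^+ 2) / 2)) ->
  cvg_in_distribution P rescaled_error P' A.
Proof.
move=> mA hA f cf [C fC].
have mE n := @entries_measurable_error n.
have E n : ('E_P[f \o rescaled_error n] = (Ex P (fun x => f (rescaled_error n x)))%:E)%E.
  by apply: expectation_Ex; exact: (bmf_continuous (mE n) cf fC).
have -> : ('E_P'[f \o A] = (Ex P' (fun x => f (A x)))%:E)%E.
  by apply: expectation_Ex; exact: (bmf_continuous mA cf fC).
under eq_fun do rewrite E.
apply: cvg_EFin; first exact: nearW.
apply: (levy_cvg mE mA _ error_tight cf fC) => w.
rewrite (_ : (fun k => _) = fun k =>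
  (Ex P (fun x => wave w (rescaled_error k x)) - Ex P (fun x => wave w (linearized k x)))
  + Ex P (fun x => wave w (linearized k x))); last by apply/funext => k; rewrite subrK.
rewrite -[Ex P' _]add0r; apply: cvgD; first exact: wave_error_linearized.
exact: wave_linearized_cvg.
Qed.

End Estimation.

Unset Implicit Arguments.

Theorem theorem15 (R : realType) (N : nat) (hN : (0 < N)%N)
    (Lstar : 'M[R]_N) (hLstar : Lstar \in posdefmx)
    (hirr : irreducible_mx Lstar)
    (d : measure_display) (T : measurableType d) (P : probability T R)
    (Z : nat -> T -> {set 'I_N})
    (hZmeas : forall i, random_subset (Z i))
    (hZlaw : forall i, has_dpp_law P Lstar (Z i))
    (hZindep : mutually_independent P Z)
    (Lhat : nat -> T -> 'M[R]_N)
    (hLmeas : forall n, random_mx (Lhat n))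
    (hLmle : forall n w, (0 < n)%N ->
      (exists L : 'M[R]_N, maximizer_on posdefmx (loglik (Z^~ w) n) L) ->
      maximizer_on posdefmx (loglik (Z^~ w) n) (Lhat n w))
    (Dhat : nat -> T -> 'M[R]_N)
    (hDmeas : forall n, random_mx (Dhat n))
    (hDsign : forall n w, Dhat n w \in signmx)
    (hDmin : forall n w (D : 'M[R]_N), D \in signmx ->
      frobenius_norm (Dhat n w *m Lhat n w *m Dhat n w - Lstar)
        <= frobenius_norm (D *m Lhat n w *m D - Lstar)) :
  let Ltilde := fun n w => Dhat n w *m Lhat n w *m Dhat n w in
  exists (d' : measure_display) (T' : measurableType d')
    (P' : probability T' R) (A : T' -> 'M[R]_N),
    normal_random_symmx P' A 0 (asymptotic_covariance Lstar) /\
    cvg_in_distribution P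
      (fun n w => Num.sqrt n%:R *: (Ltilde n w - Lstar)) P' A.
Proof.
move=> Ltilde; have [d' [T' [P' [A [mA sA hA]]]]] := limit_matrix hLstar hirr.
exists d', T', P', A; split; first exact: limit_normal.
have hsign n w : closest_sign Lstar (Dhat n w) (Lhat n w) by split=> //; exact: hDmin.
exact: (error_cvg_in_distribution hLstar hirr hZmeas hZlaw hZindep hLmeas hDmeas hLmle hsign mA hA).
Qed.
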